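(* Let $H_i$ ($i\in\mathbb{N}$) and $H$ be functions $[0,T]\times\mathbb{R}^n\times\mathbb{R}^n\to\mathbb{R}$ satisfying (H1)–(H4) and (HLC) with the same integrable functions $c(\cdot)$ and $k_R(\cdot)$ ($R>0$). Let $g_i$, $g:\mathbb{R}^n\to\mathbb{R}$ be continuous with $g_i\to g$ uniformly on compact sets. Assume $\max\{|H_i(t,0,0)|,|H(t,0,0)|\}\le\mu(t)$ for all $t\in[0,T]$, $i\in\mathbb{N}$, for some integrable $\mu$. Let $(\mathbb{R}^{n+1},f_i,l_i)$ and $(\mathbb{R}^{n+1},f,l)$ be the Steiner representations of $H_i$ and $H$, and let $$V_i(t_0,x_0)=\inf_{(x,a)\in S_{f_i}(t_0,x_0)}\Big\{g_i(x(T))+\int_{t_0}^T l_i(t,x,a)\,dt\Big\},\quad V(t_0,x_0)=\inf_{(x,a)\in S_{f}(t_0,x_0)}\Big\{g(x(T))+\int_{t_0}^T l(t,x,a)\,dt\Big\}.$$ If $H_i(t,\cdot,\cdot)\to H(t,\cdot,\cdot)$ uniformly on compact sets for every $t\in[0,T]$, then $V_i\to V$ uniformly on compact subsets of $[0,T]\times\mathbb{R}^n$.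
   Context: Hypotheses: (H1) $H(\cdot,x,p)$ Lebesgue measurable; (H2) $H(t,\cdot,\cdot)$ continuous; (H3) $H(t,x,\cdot)$ convex; (H4) there is measurable $c\ge0$ with $|H(t,x,p)-H(t,x,q)|\le c(t)(1+|x|)|p-q|$; (HLC) for each $R>0$ there is measurable $k_R\ge0$ with $|H(t,x,p)-H(t,y,p)|\le k_R(t)(1+|p|)|x-y|$ for $x,y\in\bar B_R$, all $p$. $H^*(t,x,v)=\sup_p\{\langle v,p\rangle-H(t,x,p)\}$. $S_f(t_0,x_0)$: pairs $x(\cdot)$ absolutely continuous on $[t_0,T]$, $a(\cdot)\in L^1([t_0,T],\mathbb{R}^{n+1})$, $\dot x=f(t,x,a)$ a.e., $x(t_0)=x_0$. Steiner representation of a Hamiltonian $H$: $E(t,x)=\mathrm{epi}\,H^*(t,x,\cdot)\subset\mathbb{R}^{n+1}$; $\Phi(t,x,a)=E(t,x)\cap\bar B(a,2d(a,E(t,x)))$; Steiner point $s_m(K)=m\int_{S^{m-1}}p\max_{y\in K}\langle p,y\rangle\,\mu(dp)$ ($\mu$ normalized rotation-invariant measure on the unit sphere); $(f,l)(t,x,a)=s_{n+1}(\Phi(t,x,a))$ with $f\in\mathbb{R}^n$, $l\in\mathbb{R}$. *)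

(* Defs.v *)
From HB Require Import structures.
From mathcomp Require Import all_boot all_order all_algebra.
From mathcomp Require Import all_classical all_reals all_analysis.
Set Implicit Arguments. Unset Strict Implicit. Unset Printing Implicit Defensive.
Import Order.TTheory GRing.Theory Num.Theory.
Import numFieldNormedType.Exports.
Local Open Scope classical_set_scope.
Local Open Scope ring_scope.

Section SteinerDefs.
Context {R : realType}.

Definition dotv {m : nat} (u v : 'rV[R]_m) : R := \sum_(j < m) u 0 j * v 0 j.
Definition enorm {m : nat} (v : 'rV[R]_m) : R := Num.sqrt (dotv v v).

Definition Leb := @completed_lebesgue_measure R.
Definition LebT := caratheodory_type (R:=R)
  (T:=lebesgue_stieltjes_measure_ocitv_type__canonical__measurable_structure_SemiRingOfSets R)
  (wlength idfun)^*%mu.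
Definition leb_measurable (D : set R) (f : R -> R) :=
  measurable_fun (D : set LebT) (f : LebT -> R).
Definition leb_integrable (D : set R) (f : R -> R) :=
  Leb.-integrable (D : set LebT) (fun t : LebT => (f t)%:E).

Definition RvB (m : nat) := g_sigma_algebraType (@open 'rV[R]_m).
Definition usphere (m : nat) : set 'rV[R]_m := [set p | enorm p = 1].
Arguments usphere m : clear implicits.
Definition orthogonal_mx {m : nat} (Q : 'M[R]_m) := Q *m Q^T = 1%:M.
(* mu is a probability measure carried by the unit sphere and invariant under
   all orthogonal transformations: this characterizes the normalized
   rotation-invariant (surface) measure on S^{m-1} uniquely *)
Definition is_sphere_measure (m : nat) (mu : {measure set (RvB m) -> \bar R}) :=
  [/\ mu setT = 1%E,
      mu (~` (usphere m : set (RvB m))) = 0%E &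
      forall Q : 'M[R]_m, orthogonal_mx Q ->
        forall A : set (RvB m), measurable A ->
          mu ((fun p : RvB m => (p : 'rV[R]_m) *m Q : RvB m) @^-1` A) = mu A].

Definition supp_fun {m : nat} (K : set 'rV[R]_m) (p : 'rV[R]_m) : R :=
  sup [set dotv p y | y in K].
Definition steiner_point (m : nat) (mu : {measure set (RvB m) -> \bar R})
    (K : set 'rV[R]_m) : 'rV[R]_m :=
  \row_(j < m) (m%:R * fine (\int[mu]_(p in (usphere m : set (RvB m)))
                      (((p : 'rV[R]_m) 0 j * supp_fun K p)%:E))%E).

Definition Ham (n : nat) := R -> 'rV[R]_n -> 'rV[R]_n -> R.

Definition hypH1 {n : nat} (T : R) (H : Ham n) :=
  forall x p, leb_measurable `[0, T]%classic (fun t => H t x p).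
Definition hypH2 {n : nat} (T : R) (H : Ham n) :=
  forall t, `[0, T]%classic t -> continuous (fun xp : 'rV[R]_n * 'rV[R]_n => H t xp.1 xp.2).
Definition hypH3 {n : nat} (T : R) (H : Ham n) :=
  forall t, `[0, T]%classic t -> forall x p q (lam : R), 0 <= lam <= 1 ->
    H t x (lam *: p + (1 - lam) *: q) <= lam * H t x p + (1 - lam) * H t x q.
Definition hypH4 {n : nat} (T : R) (c : R -> R) (H : Ham n) :=
  forall t, `[0, T]%classic t -> forall x p q,
    `|H t x p - H t x q| <= c t * (1 + enorm x) * enorm (p - q).
Definition hypHLC {n : nat} (T : R) (k : R -> R -> R) (H : Ham n) :=
  forall Rad, 0 < Rad -> forall t, `[0, T]%classic t -> forall x y p,
    enorm x <= Rad -> enorm y <= Rad ->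
    `|H t x p - H t y p| <= k Rad t * (1 + enorm p) * enorm (x - y).

Definition Hstar {n : nat} (H : Ham n) (t : R) (x v : 'rV[R]_n) : \bar R :=
  ereal_sup [set ((dotv v p - H t x p)%:E) | p in [set: 'rV[R]_n]].
Definition epiH {n : nat} (H : Ham n) (t : R) (x : 'rV[R]_n) : set 'rV[R]_(n + 1) :=
  [set w | (Hstar H t x (lsubmx w) <= (rsubmx w 0 0)%:E)%E].

Definition dist_set {m : nat} (a : 'rV[R]_m) (E : set 'rV[R]_m) : R :=
  inf [set enorm (a - e) | e in E].

Definition PhiH {n : nat} (H : Ham n) (t : R) (x : 'rV[R]_n) (a : 'rV[R]_(n + 1))
  : set 'rV[R]_(n + 1) :=
  epiH H t x `&` [set y | enorm (y - a) <= 2 * dist_set a (epiH H t x)].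

Definition steinerFL {n : nat} (mu : {measure set (RvB (n + 1)) -> \bar R})
  (H : Ham n) (t : R) (x : 'rV[R]_n) (a : 'rV[R]_(n + 1)) : 'rV[R]_(n + 1) :=
  steiner_point mu (PhiH H t x a).
Definition steiner_f {n : nat} mu (H : Ham n) t x a : 'rV[R]_n :=
  lsubmx (steinerFL mu H t x a).
Definition steiner_l {n : nat} mu (H : Ham n) t x a : R :=
  rsubmx (steinerFL mu H t x a) 0 0.

Definition abs_cont_on {n : nat} (t0 T : R) (x : R -> 'rV[R]_n) :=
  forall e : R, 0 < e -> exists2 d : R, 0 < d &
    forall (k : nat) (a b : nat -> R),
      (forall i, (i < k)%N -> t0 <= a i /\ a i <= b i /\ b i <= T) ->
      (forall i j, (i < j)%N -> (j < k)%N -> b i <= a j) ->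
      \sum_(i < k) (b i - a i) < d ->
      \sum_(i < k) enorm (x (b i) - x (a i)) < e.

Definition admissible {n : nat}
  (f : R -> 'rV[R]_n -> 'rV[R]_(n + 1) -> 'rV[R]_n) (T t0 : R) (x0 : 'rV[R]_n)
  (x : R -> 'rV[R]_n) (a : R -> 'rV[R]_(n + 1)) :=
  [/\ abs_cont_on t0 T x,
      x t0 = x0,
      (forall j, leb_integrable `[t0, T]%classic (fun t => a t 0 j)) &
      {ae Leb, forall t : LebT, `[t0, T]%classic t ->
          derivable x t 1 /\ derive1 x t = f t (x t) (a t)}].

Definition value_fun {n : nat} (g : 'rV[R]_n -> R)
  (f : R -> 'rV[R]_n -> 'rV[R]_(n + 1) -> 'rV[R]_n)
  (l : R -> 'rV[R]_n -> 'rV[R]_(n + 1) -> R) (T : R) (tx : R * 'rV[R]_n) : \bar R :=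
  ereal_inf [set ((g (xa.1 T))%:E +
                  \int[Leb]_(t in (`[tx.1, T]%classic : set LebT)) (l t (xa.1 t) (xa.2 t))%:E)%E
            | xa in [set xa : (R -> 'rV[R]_n) * (R -> 'rV[R]_(n + 1)) |
                     admissible f T tx.1 tx.2 xa.1 xa.2]].

End SteinerDefs.

(* Main.v *)
Require Import Defs.
From HB Require Import structures.
From mathcomp Require Import all_boot all_order all_algebra.
From mathcomp Require Import all_classical all_reals all_analysis.
From mathcomp Require Import measurable_realfun ring lra.
Import Order.TTheory GRing.Theory Num.Theory.
Import numFieldNormedType.Exports.
Local Open Scope classical_set_scope.
Local Open Scope ring_scope.
Set Implicit Arguments. Unset Strict Implicit. Unset Printing Implicit Defensive.

(* The Steiner point of a compact convex set belongs to the set, and the Steiner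
   point of a singleton is its element; hence (f,l)(t,x,.) is onto epi H^*(t,x,.)
   and V is the infimum of g(x(T)) + int r over the arcs x with velocity v and
   running cost r such that <p,v> - H(t,x,p) <= r for all p.  Let such an arc be
   given for H_1 and let |H_1 - H_2| <= eta(t) for |x| <= M and |p| <= P.  By
   convexity in p the arc violates the constraint of H_2 by at most
   rho(t) (1 + |p|), where rho = eta + O(1/P) in L^1.  Filippov's theorem, a Picard
   iteration based on a measurable Hahn-Banach selection, corrects it to an arc of
   H_2, changing the endpoint and the cost by O(int rho).  With P large and then i
   large (dominated convergence for eta) this is small; applying it to (H_i, H) and
   to (H, H_i) gives both inequalities, without any compactness of trajectories. *)

(** * Integration against the completed Lebesgue measure *)

(** Three obstacles shape the proof. Along an admissible pair the running cost [steiner_l] is not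
    known to be measurable; it is exchanged for the least cost compatible with the velocity, a
    countable supremum, which is measurable and no larger almost everywhere. Next, the corrected
    velocity must depend measurably on time: projection onto the constraint set is replaced by an
    explicit Hahn-Banach functional over rational vectors, in which every step is a countable
    infimum of measurable functions. Finally, the [O(1/P)] part of the defect contains [|r| / P],
    where [r] depends on the arc. An a priori upper bound on the values makes expensive pairs
    irrelevant, and the lower bound [- phi <= r] then controls the integral of [|r|], so that [P]
    can be fixed before [i]. A defect [rho * (1 + |p|)] is spent in two ways: the part [rho * |p|]
    as a distance between velocities, the part [rho] as additional cost. This is why [steers]
    carries the same [rho] on both sides. *)

Section LebIntegral.
Context {R : realType}.
Implicit Types (a b c t : R) (f g h : R -> R) (D : set R).

Lemma borel_measurable_leb (A : set R) :
  measurable (A : set (measurableTypeR R)) -> measurable (A : set (@LebT R)).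
Proof. exact: sub_caratheodory. Qed.

Lemma measurable_itvL (i : interval R) : measurable ([set` i] : set (@LebT R)).
Proof. by apply: borel_measurable_leb; exact: measurable_itv. Qed.

Lemma borel_fun_leb D f : measurable (D : set (@LebT R)) ->
  measurable_fun (setT : set (measurableTypeR R)) f -> leb_measurable D f.
Proof.
move=> mD mf _ B mB; apply: measurableI => //.
by apply: borel_measurable_leb; rewrite -[X in measurable X]setTI; exact: mf.
Qed.

Lemma continuous_leb D f : measurable (D : set (@LebT R)) ->
  continuous f -> leb_measurable D f.
Proof. by move=> mD cf; apply: borel_fun_leb => //; exact: continuous_measurable_fun. Qed.

(** The domain is a set, so the integral is 0 for [b < a] and carries no orientation; sign and
    monotonicity rules hold without [a <= b]. *)
Definition Int a b f : R := fine (\int[@Leb R]_(t in (`[a, b]%classic : set LebT)) (f t)%:E)%E.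
Definition intg a b f := leb_integrable `[a, b]%classic f.

Lemma Leb_set1 t : @Leb R [set t] = 0%E.
Proof. exact: (@lebesgue_measure_set1 R t). Qed.

Lemma intgS a b c d f : a <= c -> d <= b -> intg a b f -> intg c d f.
Proof.
move=> ac db; apply: integrableS; [exact: measurable_itvL| exact: measurable_itvL|].
by move=> x /=; rewrite !in_itv/= => /andP[cx xd]; rewrite (le_trans ac cx) (le_trans xd db).
Qed.

Lemma intg_meas a b f : intg a b f -> leb_measurable `[a, b]%classic f.
Proof. by move=> /measurable_int /measurable_EFinP. Qed.

Lemma intg_le a b f g : leb_measurable `[a, b]%classic f ->
  (forall t, a <= t <= b -> `|f t| <= g t) -> intg a b g -> intg a b f.
Proof.
move=> mf fg; apply: le_integrable; first exact: measurable_itvL.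
  by apply/measurable_EFinP.
move=> t /=; rewrite in_itv/= => /fg h.
by rewrite lee_fin (le_trans h)// ler_norm.
Qed.

Lemma intgD a b f g : intg a b f -> intg a b g -> intg a b (fun t => f t + g t).
Proof. by move=> fi gi; exact: (integrableD (measurable_itvL _) fi gi). Qed.

Lemma intgN a b f : intg a b f -> intg a b (fun t => - f t).
Proof. by move=> fi; exact: (integrableN fi). Qed.

Lemma intgB a b f g : intg a b f -> intg a b g -> intg a b (fun t => f t - g t).
Proof. by move=> fi gi; apply: intgD => //; exact: intgN. Qed.

Lemma intgZ a b k f : intg a b f -> intg a b (fun t => k * f t).
Proof. by move=> fi; exact: (integrableZl (measurable_itvL _) k fi). Qed.

Lemma intg_norm a b f : intg a b f -> intg a b (fun t => `|f t|).
Proof. by move=> fi; exact: (integrable_norm fi). Qed.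

Lemma intg_cst a b k : intg a b (fun=> k).
Proof.
apply: measurable_bounded_integrable; first exact: measurable_itvL.
- have h : (lebesgue_measure (`[a, b]%classic : set R) < +oo)%E.
    by rewrite lebesgue_measure_itv; case: ifP => // _; rewrite ltry.
  exact: h.
- exact: measurable_cst.
- exists `|k|; split; first exact: num_real.
  by move=> x kx y /= _; exact: ltW.
Qed.

Lemma intg_sum a b (I : Type) (s : seq I) (F : I -> R -> R) :
  (forall i, intg a b (F i)) -> intg a b (fun t => \sum_(i <- s) F i t).
Proof.
move=> h; elim: s => [|i s IH].
  by rewrite (_ : (fun _ => _) = (fun=> 0)); [exact: intg_cst|apply/funext=> t; rewrite big_nil].
rewrite (_ : (fun _ => _) = (fun t => F i t + \sum_(i <- s) F i t)); first exact: intgD.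
by apply/funext=> t; rewrite big_cons.
Qed.

Lemma eq_intg a b f g : (forall t, a <= t <= b -> f t = g t) -> intg a b f -> intg a b g.
Proof.
move=> fg; apply: eq_integrable; first exact: measurable_itvL.
by move=> t; rewrite inE/= in_itv/= => /fg ->.
Qed.

Lemma eq_Int a b f g : (forall t, a <= t <= b -> f t = g t) -> Int a b f = Int a b g.
Proof.
move=> fg; congr fine; apply: eq_integral => t; rewrite inE/= in_itv/= => /fg -> //.
Qed.

Lemma IntE a b f : intg a b f ->
  (\int[@Leb R]_(t in (`[a, b]%classic : set LebT)) (f t)%:E)%E = (Int a b f)%:E.
Proof. by move=> fi; rewrite fineK//; apply: integrable_fin_num => //; exact: measurable_itvL. Qed.

Lemma IntD a b f g : intg a b f -> intg a b g ->
  Int a b (fun t => f t + g t) = Int a b f + Int a b g.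
Proof. by move=> fi gi; exact: (RintegralD (measurable_itvL _) fi gi). Qed.

Lemma IntB a b f g : intg a b f -> intg a b g ->
  Int a b (fun t => f t - g t) = Int a b f - Int a b g.
Proof. by move=> fi gi; exact: (RintegralB (measurable_itvL _) fi gi). Qed.

Lemma IntZ a b k f : intg a b f -> Int a b (fun t => k * f t) = k * Int a b f.
Proof. by move=> fi; rewrite /Int -[RHS](RintegralZl _ (measurable_itvL _) fi). Qed.

Lemma Int_sum a b (I : Type) (s : seq I) (F : I -> R -> R) :
  (forall i, intg a b (F i)) ->
  Int a b (fun t => \sum_(i <- s) F i t) = \sum_(i <- s) Int a b (F i).
Proof.
move=> h; elim: s => [|i s IH].
  rewrite big_nil (_ : (fun _ => _) = (fun=> 0)); last by apply/funext=> t; rewrite big_nil.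
  by rewrite /Int integral0.
rewrite big_cons -IH -IntD//; last exact: intg_sum.
by congr Int; apply/funext=> t; rewrite big_cons.
Qed.

Lemma le_Int a b f g : intg a b f -> intg a b g ->
  (forall t, a <= t <= b -> f t <= g t) -> Int a b f <= Int a b g.
Proof.
move=> fi gi fg; apply: (le_Rintegral (measurable_itvL _) fi gi) => t /=.
by rewrite in_itv/=; exact: fg.
Qed.

Lemma Int_ge0 a b f : (forall t, a <= t <= b -> 0 <= f t) -> 0 <= Int a b f.
Proof.
by move=> f0; apply: (@Rintegral_ge0 _ _ R Leb) => t /=; rewrite in_itv/=; exact: f0.
Qed.

Lemma le_norm_Int a b f : intg a b f -> `|Int a b f| <= Int a b (fun t => `|f t|).
Proof. by move=> fi; exact: (le_normr_Rintegral (measurable_itvL _) fi). Qed.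

Lemma Int_cst a b k : a <= b -> Int a b (fun=> k) = k * (b - a).
Proof.
move=> ab; rewrite [LHS](Rintegral_cst _ (measurable_itvL _)).
have -> : fine ((@Leb R) `[a, b]%classic) = fine (lebesgue_measure (`[a, b]%classic : set R)) by [].
rewrite lebesgue_measure_itv/= lte_fin; case: ifPn => [_|]; first by rewrite -EFinD.
by rewrite -leNgt => ba; have -> : a = b by [apply/eqP; rewrite eq_le ab]; rewrite subrr.
Qed.

Lemma Int_chasles a b c f : a <= b -> b <= c -> intg a c f ->
  Int a c f = Int a b f + Int b c f.
Proof.
move=> ab bc fi; have ac := le_trans ab bc.
(* Additivity wants disjoint pieces, so the second closed interval is traded for a half-open one,
   which differs from it by a null point. *)
have -> : Int b c f = fine (\int[@Leb R]_(t in (`]b, c]%classic : set LebT)) (f t)%:E)%E.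
  congr fine; have [->|bc'] := eqVneq b c.
    rewrite set_itvoc0 integral_set0 null_set_integral//.
    - exact: measurable_itvL.
    - exact: (measurable_int _ (intgS ac (lexx _) fi)).
    - by rewrite set_itv1; exact: Leb_set1.
  have blc : b < c by rewrite lt_neqAle bc' bc.
  rewrite (@negligible_integral _ _ R Leb _ [set b]).
  - congr (integral _ _ _); apply/seteqP; split => x /=; rewrite !in_itv/=.
      by move=> [/andP[bx ->] /eqP xb]; rewrite andbT lt_neqAle bx eq_sym xb.
    by move=> /andP[bx ->]; rewrite (ltW bx); split=> //; apply/eqP; rewrite gt_eqF.
  - by rewrite -[X in measurable X](set_itv1); exact: measurable_itvL.
  - exact: measurable_itvL.
  - exact: (intgS ab (lexx _) fi).
  - exact: Leb_set1.
have e : `[a, c]%classic = `[a, b]%classic `|` `]b, c]%classic :> set R.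
  apply/seteqP; split => x /=; rewrite !in_itv/=.
    move=> /andP[ax xc]; have [xb|xb] := leP x b; first by left; rewrite ax.
    by right.
  by move=> [/andP[-> xb]|/andP[bx ->]]; [rewrite (le_trans xb)|rewrite (le_trans ab)// ltW].
rewrite {1}/Int e.
apply: (@Rintegral_setU _ _ R Leb); [exact: measurable_itvL|exact: measurable_itvL| |].
  by rewrite -e.
apply/eqP/seteqP; split => x //=.
by rewrite !in_itv/= => -[/andP[_ xb]] /andP[bx _]; move: (le_lt_trans xb bx); rewrite ltxx.
Qed.

End LebIntegral.

(** * Differentiation of indefinite Lebesgue integrals *)

Section FTC.
Context {R : realType}.
Implicit Types (a b c t : R) (f g h v w : R -> R).

Lemma Int_dominated a b (f_ : nat -> R -> R) f g :
  (forall n, leb_measurable `[a, b]%classic (f_ n)) ->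
  (forall t, a <= t <= b -> f_ ^~ t @ \oo --> f t) ->
  intg a b g -> (forall n t, a <= t <= b -> `|f_ n t| <= g t) ->
  Int a b (f_ n) @[n --> \oo] --> Int a b f.
Proof.
move=> mf cf gi fg.
have mF : leb_measurable `[a, b]%classic f.
  by apply: (measurable_fun_cvg mf) => t /=; rewrite in_itv/=; exact: cf.
have [] := @dominated_convergence _ _ R (@Leb R) _ (measurable_itvL `[a, b])
  (fun n t => (f_ n t)%:E) (fun t => (f t)%:E) (fun t => (g t)%:E).
- by move=> n; apply/measurable_EFinP; exact: mf.
- by apply/measurable_EFinP.
- apply/aeW => t /=; rewrite in_itv/= => tab.
  by apply: cvg_EFin; [exact: nearW|exact: cf].
- exact: gi.
- apply/aeW => t n /=; rewrite in_itv/= => tab.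
  by rewrite lee_fin; exact: fg.
move=> fi _ cI.
have h := @fine_cvg R _ _ _ _ (Int a b f); apply: h.
by rewrite -IntE//; exact: cI.
Qed.

Lemma leb_completed (A : set R) : measurable (A : set (@LebT R)) ->
  completed_algebra_gen (@lebesgue_measure R) A.
Proof.
move=> mA; have : (completed_algebra_gen (@lebesgue_measure R)).-sigma.-measurable A.
  by rewrite completed_caratheodory_measurable.
by rewrite g_sigma_completed_algebra_genE.
Qed.

(** Each superlevel set at a rational height is Borel up to a Borel null set. Off the union [N] of
    these countably many null sets every superlevel set is a union of rational ones, and the value 0
    on [N] completes a Borel function. *)
Lemma leb_borel_ae f : leb_measurable setT f ->
  exists g (N : set R), [/\ measurable_fun (setT : set (measurableTypeR R)) g,
    measurable (N : set (measurableTypeR R)), lebesgue_measure N = 0%E &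
    forall t, ~ N t -> f t = g t].
Proof.
move=> mf.
have H (q : rat) : exists FM : set R * set R,
   [/\ measurable (FM.1 : set (measurableTypeR R)), measurable (FM.2 : set (measurableTypeR R)),
    lebesgue_measure FM.2 = 0%E & forall t, ~ FM.2 t -> (ratr q < f t <-> FM.1 t)].
  have : measurable ([set t | ratr q < f t] : set (@LebT R)).
    have := mf measurableT _ (measurable_itv `](ratr q : R), +oo[).
    by rewrite setTI => h; apply: eq_ind h _ _; apply/seteqP; split => t /=; rewrite in_itv/= andbT.
  move=> /leb_completed [F mF [N [M [mM M0 NM]] FN]].
  exists (F, M); split => //= t Mt.
  have -> : (ratr q < f t <-> F t) <-> ([set t | ratr q < f t] t <-> F t) by [].
  rewrite -FN; split; first by case=> // /NM.
  by left.
pose FM q := sval (cid (H q)).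
have FMP q := svalP (cid (H q)).
pose N := \bigcup_q (FM q).2.
have mN : measurable (N : set (measurableTypeR R)).
  by apply: bigcupT_measurable_rat => q; have [] := FMP q.
have N0 : lebesgue_measure N = 0%E.
  have /card_esym/ppcard_eqP[e] := card_rat.
  have NE : N = \bigcup_n (FM (e n)).2.
    apply/seteqP; split => t [q _ Nt]; last by exists (e q).
    by have [n _ nq] := @surj _ _ _ _ e q Logic.I; exists n => //=; rewrite nq.
  have : lebesgue_measure.-negligible N.
    rewrite NE; apply: negligible_bigcup => n; have [_ m2 m0 _] := FMP (e n).
    exact/negligibleP.
  by move/negligibleP; apply.
exists (fun t => if t \in N then 0 else f t), N; split => //; last first.
  by move=> t Nt; rewrite memNset.
apply: (measurability _ (RGenOInfty.measurableE R)) => _ [_ [r ->] <-]; rewrite setTI.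
have mP : measurable ((\bigcup_q (if r < ratr q then (FM q).1 else set0)) `\` N : set (measurableTypeR R)).
  apply: measurableD => //; apply: bigcupT_measurable_rat => q.
  by case: ifP => // _; have [] := FMP q.
(* The value 0 given on [N] exceeds [r] exactly when [r < 0]; only then does [N] belong to the
   superlevel set. *)
have [r0|r0] := ltP r 0.
  rewrite (_ : _ @^-1` _ = ((\bigcup_q (if r < ratr q then (FM q).1 else set0)) `\` N) `|` N).
    exact: measurableU.
  apply/seteqP; split => t /=; rewrite in_itv/= andbT.
    case: ifPn; first by rewrite inE; right.
    rewrite notin_setE => Nt rf; left; split => //.
    have [q] := rat_in_itvoo rf; rewrite in_itv/= => /andP[rq qf].
    exists q => //; rewrite rq; have [_ _ _ FMt] := FMP q.
    by apply/(FMt t) => // ?; apply: Nt; exists q.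
  case: ifPn => //; rewrite notin_setE => Nt [[[q _ FMt] _]|//].
  move: FMt; case: ifPn => // rq FMt; have [_ _ _ /(_ t) h] := FMP q.
  by apply: lt_trans rq _; apply/h => // ?; apply: Nt; exists q.
rewrite (_ : _ @^-1` _ = ((\bigcup_q (if r < ratr q then (FM q).1 else set0)) `\` N))//.
apply/seteqP; split => t /=; rewrite in_itv/= andbT.
  case: ifPn; first by move=> _ /(le_lt_trans r0); rewrite ltxx.
  rewrite notin_setE => Nt rf; split => //.
  have [q] := rat_in_itvoo rf; rewrite in_itv/= => /andP[rq qf].
  exists q => //; rewrite rq; have [_ _ _ FMt] := FMP q.
  by apply/(FMt t) => // ?; apply: Nt; exists q.
move=> [[q _ FMt] Nt]; rewrite memNset//.
move: FMt; case: ifPn => // rq FMt; have [_ _ _ /(_ t) h] := FMP q.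
by apply: lt_trans rq _; apply/h => // ?; apply: Nt; exists q.
Qed.

Lemma Leb_borel_cover (N : set R) : (@Leb R).-negligible (N : set LebT) ->
  exists M : set R, [/\ measurable (M : set (measurableTypeR R)), lebesgue_measure M = 0%E & N `<=` M].
Proof.
move=> [A [mA A0 NA]].
have /leb_completed [F mF [K [M [mM M0 KM]] FK]] := mA.
exists (F `|` M); split.
- exact: measurableU.
- have F0 : lebesgue_measure F = 0%E.
    apply/eqP; rewrite eq_le measure_ge0 andbT -A0.
    by apply: (le_outer_measure (wlength idfun)^*%mu); rewrite -FK; left.
  have /negligibleP : lebesgue_measure.-negligible (F `|` M).
    by apply: negligibleU; exact/negligibleP.
  by apply; exact: measurableU.
- by move=> t /NA; rewrite -FK => -[|/KM]; [left|right].
Qed.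

(** Lebesgue differentiation is applied to a Borel version [u] of [v], which has the same indefinite
    integrals; the points where it fails and those where [u] and [v] differ are both null. *)
Lemma FTC1_leb v a : leb_integrable setT v ->
  {ae @Leb R, forall t : LebT, a < t ->
    derivable (fun s : R => Int a s v) t 1 /\ derive1 (fun s : R => Int a s v) t = v t}.
Proof.
move=> vi.
have mv : leb_measurable setT v by apply/measurable_EFinP; exact: measurable_int vi.
have [u [N [mu_ mN N0 Nvu]]] := leb_borel_ae mv.
have mNL : measurable (N : set (@LebT R)) by exact: borel_measurable_leb.
have N0L : (@Leb R) (N : set LebT) = 0%E by exact: N0.
(* The identity pushes the completed measure forward to the Borel one, which transports
   integrability and integrals between the two. *)
have mid : measurable_fun (setT : set (@LebT R)) (id : LebT -> measurableTypeR R).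
  by move=> _ B mB; rewrite setTI; exact: borel_measurable_leb.
have uiL : leb_integrable setT u.
  have mu' : leb_measurable setT u by apply: borel_fun_leb => //; exact: measurableT.
  have /measurable_EFinP mu'' := mu'.
  apply: (negligible_integrable mNL (@measurableT _ LebT) mu'' N0L).2.
  apply: eq_integrable (integrableS (@measurableT _ LebT) _ _ vi).
  - exact: measurableD.
  - by move=> t; rewrite inE => -[_ Nt]; rewrite (Nvu t Nt).
  - exact: measurableD.
  - by move=> t.
have ui : lebesgue_measure.-integrable setT (EFin \o u).
  have := integrable_pushforward mid (mu := @Leb R) (f := EFin \o u) (D := setT).
  by apply=> //; apply/measurable_EFinP.
have IE y : Int a y v = (\int[lebesgue_measure]_(t in `[a, y]) u t)%R.
  rewrite /Int /Rintegral; congr fine.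
  transitivity (\int[@Leb R]_(t in (`[a, y]%classic : set LebT)) (u t)%:E)%E.
    have mI := measurable_itvL (R:=R) `[a, y].
    have vI := integrableS (@measurableT _ LebT) mI (@subsetT _ _) vi.
    have uI := integrableS (@measurableT _ LebT) mI (@subsetT _ _) uiL.
    rewrite (negligible_integral mNL mI vI N0L) (negligible_integral mNL mI uI N0L).
    by apply: eq_integral => t; rewrite inE => -[_ Nt]; rewrite (Nvu t Nt).
  symmetry; apply: (integral_pushforward mid (mu := @Leb R) (f := EFin \o u)) => //.
  - by apply/measurable_EFinP.
  - by apply: integrableS uiL => //; exact: measurable_itvL.
have := @FTC1 R u (BLeft a) _ _.
case.
- by move=> y; apply: integrableS ui => //; exact: measurable_itv.
- by apply: open_integrable_locally => //; exact: openT.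
move=> M [mM M0 /subsetCl MF].
exists (N `|` M); split.
- by apply: measurableU; exact: borel_measurable_leb.
- have /negligibleP : (@Leb R).-negligible (N `|` M : set LebT).
    by apply: negligibleU; apply/negligibleP => //; exact: borel_measurable_leb.
  by apply; apply: measurableU; exact: borel_measurable_leb.
move=> t /= nt; apply: contrapT => NMt; apply: nt => at_.
have /MF + : (~` M) t by move=> Mt; apply: NMt; right.
rewrite /mkset; have -> : (fun x => (\int[lebesgue_measure]_(t in `[a, x]) u t)%R) = (fun s => Int a s v).
  by apply/funext => y; rewrite IE.
have aT : (BLeft a < BRight (t : R))%E by exact: at_.
move=> /(_ aT)[h e]; split=> //; rewrite e Nvu// => Nt; apply: NMt; by left.
Qed.

End FTC.

(** * Absolutely continuous functions *)

Section AbsCont.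
Context {R : realType}.
Implicit Types (a b c t : R) (F f g v w : R -> R).

Definition acR (a b : R) (F : R -> R) :=
  forall e : R, 0 < e -> exists2 d : R, 0 < d &
    forall (k : nat) (l r : nat -> R),
      (forall i, (i < k)%N -> a <= l i /\ l i <= r i /\ r i <= b) ->
      (forall i j, (i < j)%N -> (j < k)%N -> r i <= l j) ->
      \sum_(i < k) (r i - l i) < d ->
      \sum_(i < k) `|F (r i) - F (l i)| < e.

(** Truncate at a height [n]: the excess of [w] over [n] has small integral by dominated
    convergence, and the rest contributes at most [n] times the total length. *)
Lemma Int_small a b w : intg a b w -> (forall t, 0 <= w t) ->
  forall e : R, 0 < e -> exists2 d : R, 0 < d &
    forall (k : nat) (l r : nat -> R),
      (forall i, (i < k)%N -> a <= l i /\ l i <= r i /\ r i <= b) ->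
      (forall i j, (i < j)%N -> (j < k)%N -> r i <= l j) ->
      \sum_(i < k) (r i - l i) < d ->
      \sum_(i < k) Int (l i) (r i) w < e.
Proof.
move=> wi w0 e e0.
pose f n t := Num.max (w t - n%:R) 0.
have mf n : leb_measurable `[a, b]%classic (f n).
  apply: measurable_maxr; last exact: measurable_cst.
  apply: measurable_funB; last exact: measurable_cst.
  exact: intg_meas wi.
have f0 n t : 0 <= f n t by rewrite /f le_max lexx orbT.
have fw n t : f n t <= w t by rewrite /f ge_max w0 gerBl ler0n.
have fi n : intg a b (f n).
  by apply: intg_le wi => // t _; rewrite ger0_norm.
have cf : Int a b (f n) @[n --> \oo] --> Int a b (fun=> 0).
  apply: (Int_dominated mf _ wi).
    move=> t _; apply: cvg_near_cst; near=> n.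
    apply/eqP; rewrite /f; apply/eqP/max_idPr; rewrite subr_le0.
    by near: n; exact: nbhs_infty_ger.
  by move=> n t _; rewrite ger0_norm.
have I0 : Int a b (fun=> 0) = 0 :> R by rewrite /Int integral0.
rewrite I0 in cf.
have [n fn] : exists n, Int a b (f n) < e / 2.
  have e2 : 0 < e / 2 by rewrite divr_gt0.
  have /cvgrPdist_lt /(_ _ e2) [n _ /(_ n (leqnn _))] := cf.
  rewrite sub0r normrN => h; exists n; apply: le_lt_trans h; exact: ler_norm.
(* The successor keeps the denominator positive when [n] is 0. *)
exists (e / 2 / n.+1%:R); first by rewrite divr_gt0 ?ltr0n// divr_gt0.
move=> k l r lr dis sm.
(* The intervals are ordered, so by induction the sum over the first [m.+1] of them is at most the
   integral up to [r m]: filling the gaps only adds. *)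
have sumI : forall g, intg a b g -> (forall t, 0 <= g t) ->
    forall m, (m <= k)%N -> \sum_(i < m) Int (l i) (r i) g <= Int a b g.
  move=> g gi g0; case=> [|m] mk; first by rewrite big_ord0 Int_ge0.
  have [am [lm rm]] := lr m mk.
  apply: (@le_trans _ _ (Int a (r m) g)); last first.
    rewrite (Int_chasles (le_trans am lm) rm gi) lerDl; exact: Int_ge0.
  elim: m mk am lm rm => [|m IH] mk am lm rm.
    rewrite big_ord1 (Int_chasles am lm); last exact: intgS (lexx _) rm gi.
    by rewrite lerDr; exact: Int_ge0.
  rewrite big_ord_recr/= (Int_chasles am lm); last exact: intgS (lexx _) rm gi.
  rewrite lerD2r.
  have [am' [lm' rm']] := lr m (ltnW mk).
  apply: le_trans (IH (ltnW mk) am' lm' rm') _.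
  have rl := dis m m.+1 (ltnSn m) mk.
  rewrite (@Int_chasles _ a (r m) (l m.+1))//.
  - by rewrite lerDl; exact: Int_ge0.
  - exact: le_trans am' lm'.
  - by apply: intgS (lexx _) _ gi; exact: le_trans lm rm.
apply: (@le_lt_trans _ _ (\sum_(i < k) (Int (l i) (r i) (f n) + n%:R * (r i - l i)))).
  apply: ler_sum => i _; have [ai [li ri]] := lr i (ltn_ord i).
  rewrite -(Int_cst n%:R li) -IntD; [|exact: intgS ai ri (fi n)|exact: intg_cst].
  apply: le_Int; [exact: intgS ai ri wi|apply: intgD; [exact: intgS ai ri (fi n)|exact: intg_cst]|].
  by move=> t _; rewrite /f -lerBlDr le_max lexx.
rewrite big_split/= -mulr_sumr [e in _ < e]splitr ltr_leD//.
  exact: le_lt_trans (sumI _ (fi n) (f0 n) k (leqnn _)) fn.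
have s0 : 0 <= \sum_(i < k) (r i - l i).
  by apply: sumr_ge0 => i _; have [_ [+ _]] := lr i (ltn_ord i); rewrite subr_ge0.
apply: (@le_trans _ _ (n.+1%:R * (\sum_(i < k) (r i - l i)))).
  by rewrite ler_wpM2r// ler_nat.
by rewrite mulrC -ler_pdivlMr ?ltr0n// ltW.
Unshelve. all: by end_near. Qed.

Lemma acR_Int a b v : intg a b v -> acR a b (fun t => Int a t v).
Proof.
move=> vi e e0.
have [d d0 H] := Int_small (intg_norm vi) (fun t => normr_ge0 _) e0.
exists d => // k l r lr dis sm; apply: le_lt_trans (H k l r lr dis sm).
apply: ler_sum => i _; have [ai [li ri]] := lr i (ltn_ord i).
rewrite (Int_chasles ai li); last exact: intgS (lexx _) ri vi.
by rewrite addrC addrA addNr add0r le_norm_Int//; exact: intgS ai ri vi.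
Qed.

Lemma acRB a b F G : acR a b F -> acR a b G -> acR a b (fun t => F t - G t).
Proof.
move=> hF hG e e0; have e2 : 0 < e / 2 by rewrite divr_gt0.
have [d1 d10 H1] := hF _ e2; have [d2 d20 H2] := hG _ e2.
exists (Num.min d1 d2); first by rewrite lt_min d10.
move=> k l r lr dis; rewrite lt_min => /andP[s1 s2].
apply: (@le_lt_trans _ _ (\sum_(i < k) (`|F (r i) - F (l i)| + `|G (r i) - G (l i)|))).
  apply: ler_sum => i _; apply: le_trans (ler_normB _ _).
  by rewrite le_eqVlt; apply/orP; left; apply/eqP; congr Num.norm; ring.
by rewrite big_split/= [e]splitr ltrD// ?H1 ?H2.
Qed.

(** The supremum of the points of [[a, b]] satisfying [P] satisfies it by the left half of the
    hypothesis; the right half would push beyond it unless it is [b]. *)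
Lemma continuous_induction a b (P : R -> Prop) : a <= b -> P a ->
  (forall t, a <= t <= b -> exists2 d : R, 0 < d &
     (forall s, a <= s <= b -> t - d < s -> s <= t -> P s -> P t) /\
     (forall s, a <= s <= b -> t <= s -> s < t + d -> P t -> P s)) -> P b.
Proof.
move=> ab Pa H.
pose S := [set s | a <= s <= b /\ P s].
have Sa : S a by split; rewrite ?lexx.
have Sb : has_sup S by split; [exists a|exists b => s [/andP[]]].
have ubS : has_ubound S by have [] := Sb.
have aS : a <= sup S by exact: ub_le_sup.
have Sle : sup S <= b by apply: ge_sup; [exists a|move=> s [/andP[]]].
have [d d0 [Hl Hr]] := H (sup S) (introT andP (conj aS Sle)).
have [s [sab Ps] ls] := sup_adherent d0 Sb.
have PS : P (sup S).
  exact: (Hl s sab ls (ub_le_sup ubS (conj sab Ps)) Ps).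
have [<- //|nb] := eqVneq (sup S) b.
have Slt : sup S < b by rewrite lt_neqAle nb.
pose s' := Num.min b (sup S + d / 2).
have d2 : 0 < d / 2 by rewrite divr_gt0.
have s'S : sup S < s' by rewrite lt_min Slt ltrDl.
have s'ab : a <= s' <= b by rewrite (le_trans aS (ltW s'S)) ge_min lexx.
have : s' <= sup S.
  apply: ub_le_sup => //; split=> //; apply: Hr => //; first exact: ltW.
  by rewrite gt_min; apply/orP; right; rewrite ltrD2l ltr_pdivrMr// ltr_pMr// ltr1n.
by rewrite leNgt s'S.
Qed.

(* Cover the exceptional null set by an open set [U] of measure below the
   absolute-continuity threshold.  Going from [a] to [b] by small steps, each
   step either stays in [U] or has slope at most [e], by the derivative. *)
Lemma acR_derive0_cst a b F (N : set R) : a <= b -> acR a b F ->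
  (@Leb R).-negligible (N : set LebT) ->
  (forall t, a <= t <= b -> ~ N t -> derivable F t 1 /\ derive1 F t = 0) ->
  F b = F a.
Proof.
move=> ab acF /Leb_borel_cover[M [mM M0 NM]] dF.
apply/eqP; rewrite -subr_eq0 -normr_le0; apply/ler_addgt0Pl => e' e'0; rewrite addr0.
(* Steps inside [U] will contribute at most [e] in total, the others at most [e * (b - a)]. *)
pose e := e' / (1 + (b - a)).
have ba0 : 0 <= b - a by rewrite subr_ge0.
have e0 : 0 < e by rewrite divr_gt0// ltr_wpDr.
have [d d0 Hd] := acF e e0.
have [U [oU MU Ud]] : exists U : set R, [/\ open U, M `<=` U & (lebesgue_measure U < d%:E)%E].
  have Mfin : (lebesgue_measure M < +oo)%E by rewrite M0 ltry.
  have [U [oU MU Ud]] := lebesgue_regularity_outer mM Mfin d0.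
  exists U; split => //.
  have mU : measurable (U : set (measurableTypeR R)) by exact: open_measurable.
  have : (lebesgue_measure U <= lebesgue_measure M + lebesgue_measure (U `\` M))%E.
    rewrite -{1}(setDUK MU); apply: measureU2 => //; exact: measurableD.
  by move=> /le_lt_trans; apply; rewrite M0 add0e.
have mU : measurable (U : set (@LebT R)).
  by apply: borel_measurable_leb; exact: open_measurable.
pose I : R -> R := \1_U.
have mI D : leb_measurable D I by exact: measurable_indic.
have iI x y : intg x y I.
  apply: (intg_le (mI _) _ (intg_cst x y 1)) => t _.
  by rewrite /I indicE; case: (t \in U); rewrite ?normr1 ?normr0.
have IU : Int a b I < d.
  rewrite -lte_fin -IntE//; apply: le_lt_trans Ud.
  rewrite [X in (X <= _)%E]integral_indic//; last exact: measurable_itvL.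
  by apply: (le_outer_measure (wlength idfun)^*%mu) => t [].
(* Invariant of the walk: steps inside [U] are recorded as ordered intervals whose total length is
   at most the measure of [U] up to [s]; the remaining steps are charged to the slope [e]. *)
pose P s := exists (k : nat) (l r : nat -> R),
  [/\ forall i, (i < k)%N -> a <= l i /\ l i <= r i /\ r i <= s,
      forall i j, (i < j)%N -> (j < k)%N -> r i <= l j,
      \sum_(i < k) (r i - l i) <= Int a s I &
      `|F s - F a| <= \sum_(i < k) `|F (r i) - F (l i)| + e * (s - a)].
pose Q s s' := (forall t, s <= t <= s' -> U t) \/ `|F s' - F s| <= e * (s' - s).
have step s s' : a <= s -> s <= s' -> P s -> Q s s' -> P s'.
  move=> as_ ss' [k [l [r [H1 H2 H3 H4]]]] [UU|Fe]; last first.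
    exists k, l, r; split => //.
    - by move=> i /H1[? [? ?]]; split=> //; split=> //; exact: le_trans ss'.
    - apply: le_trans H3 _; rewrite (Int_chasles as_ ss')// lerDl.
      by apply: Int_ge0 => t _; rewrite /I indicE.
    - have -> : F s' - F a = (F s' - F s) + (F s - F a) by ring.
      apply: le_trans (ler_normD _ _) _; apply: le_trans (lerD Fe H4) _.
      by rewrite le_eqVlt; apply/orP; left; apply/eqP; ring.
  exists k.+1, (fun i => if (i < k)%N then l i else s), (fun i => if (i < k)%N then r i else s').
  split.
  - move=> i; rewrite ltnS; case: ifPn => [ik _|_ _]; last by [].
    by have [? [? ?]] := H1 i ik; split=> //; split=> //; exact: le_trans ss'.
  - move=> i j ij; rewrite ltnS => jk; have ik : (i < k)%N by exact: leq_trans ij jk.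
    rewrite ik; case: ifPn => [jk'|_]; first exact: H2.
    by have [? [? ?]] := H1 i ik.
  - rewrite big_ord_recr/= ltnn.
    rewrite (eq_bigr (fun i : 'I_k => r i - l i)); last by move=> i _; rewrite ltn_ord.
    rewrite (Int_chasles as_ ss')// lerD//.
    rewrite -[leLHS]mul1r -(Int_cst 1 ss'); apply: le_Int => //; first exact: intg_cst.
    by move=> t /UU Ut; rewrite /I indicE mem_set.
  - rewrite big_ord_recr/= ltnn.
    rewrite (eq_bigr (fun i : 'I_k => `|F (r i) - F (l i)|)); last by move=> i _; rewrite ltn_ord.
    have -> : F s' - F a = (F s' - F s) + (F s - F a) by ring.
    apply: le_trans (ler_normD _ _) _.
    have : e * (s - a) <= e * (s' - a) by rewrite ler_pM2l// lerB.
    lra.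
have Pb : P b.
  apply: (continuous_induction ab).
    exists 0%N, (fun=> 0), (fun=> 0); split => //.
      by rewrite big_ord0; apply: Int_ge0 => t _; rewrite /I indicE.
    by rewrite big_ord0 !subrr normr0 mulr0 addr0.
  move=> t tab.
  suff [d1 d10 [Hl Hr]] : exists2 d1 : R, 0 < d1 &
     (forall s, a <= s <= b -> t - d1 < s -> s <= t -> Q s t) /\
     (forall s, a <= s <= b -> t <= s -> s < t + d1 -> Q t s).
    have /andP[at_ _] := tab.
    exists d1 => //; split => s sab h1 h2 Ps; have /andP[as_ _] := sab.
    - by apply: step Ps _ => //; exact: Hl.
    - by apply: step Ps _ => //; exact: Hr.
  have [Ut|Ut] := pselect (U t).
    have /nbhs_ballP[d1 /= d10 H] : nbhs t U by exact: open_nbhs_nbhs.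
    exists d1 => //; split => s _ h1 h2; left => u /andP[su ut]; apply: H.
      by rewrite /ball/= ger0_norm ?subr_ge0//; lra.
    by rewrite /ball/= ler0_norm ?subr_le0//; lra.
  have [dFt dF0] := dF t tab (fun h => Ut (MU _ (NM _ h))).
  have cF : (fun h : R => h^-1 *: ((F \o shift t) (h *: (1 : R)) - F t)) @ (0 : R)^' --> 'D_1 F t.
    exact: dFt.
  rewrite -derive1E dF0 in cF.
  have /cvgrPdist_le cF' := cF.
  have := cF' _ e0; rewrite near_withinE => /nbhs_ballP[d1 /= d10 H].
  have slope s : `|s - t| < d1 -> `|F s - F t| <= e * `|s - t|.
    have [->|st] := eqVneq s t; first by rewrite !subrr normr0 mulr0.
    move=> std; have st0 : s - t != 0 by rewrite subr_eq0.
    have := H (s - t); rewrite /ball/= sub0r normrN => /(_ std st0).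
    rewrite sub0r normrN normrM normfV mulrC ler_pdivrMr ?normr_gt0//.
    by rewrite /GRing.scale/= mulr1 subrK.
  exists d1 => //; split => s _ h1 h2; right.
    by rewrite distrC -[t - s]ger0_norm ?subr_ge0// [X in e * X]distrC slope// ler0_norm ?subr_le0//; lra.
  by rewrite -[X in e * X]ger0_norm ?subr_ge0// slope// ger0_norm ?subr_ge0//; lra.
have [k [l [r [H1 H2 H3 H4]]]] := Pb.
have := Hd k l r H1 H2 (le_lt_trans H3 IU) => /ltW h.
apply: le_trans H4 _; apply: le_trans (lerD h (lexx _)) _.
rewrite -{1}(mulr1 e) -mulrDr /e -mulrA mulVf ?mulr1//.
by rewrite gt_eqF// ltr_wpDr.
Qed.

(** Subtracting the indefinite integral of [v] leaves an absolutely continuous function whose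
    derivative vanishes almost everywhere. *)
Lemma FTC2_leb a b F v (N : set R) : a <= b -> acR a b F ->
  (@Leb R).-negligible (N : set LebT) -> intg a b v ->
  (forall t, a <= t <= b -> ~ N t -> derivable F t 1 /\ derive1 F t = v t) ->
  F b - F a = Int a b v.
Proof.
move=> ab acF Nn vi dF.
pose v0 : R -> R := v \_ `[a, b]%classic.
have v0i : leb_integrable setT v0.
  have := (@integrable_mkcond _ _ _ (@Leb R) _ (fun t => (v t)%:E) (measurable_itvL `[a, b])).1 vi.
  by rewrite restrict_EFin.
have v0E t : a <= t <= b -> v0 t = v t.
  by move=> tab; rewrite /v0 patchE mem_set//= in_itv.
have [N1 [mN1 N10 N1v]] := FTC1_leb a v0i.
pose z t := F t - Int a t v0.
have : z b = z a.
  (* [FTC1_leb] differentiates only strictly to the right of [a], so [a] joins the exceptional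
     set. *)
  apply: (@acR_derive0_cst a b z (N `|` N1 `|` [set a]) ab).
  - apply: acRB => //; apply: acR_Int; apply: eq_intg vi => t /v0E //.
  - apply: negligibleU.
      apply: negligibleU => //; exists N1; split => //.
    exists [set a]; split => //; last exact: Leb_set1.
    by rewrite -[X in measurable X]set_itv1; exact: measurable_itvL.
  - move=> t tab nt.
    have [d1 e1] := dF t tab (fun h => nt (or_introl (or_introl h))).
    have /= : (~` N1) t by move=> h; apply: nt; left; right.
    move=> /(subsetCl N1v) /=; rewrite /mkset => -[].
      rewrite lt_neqAle; have /andP[-> _] := tab; rewrite andbT.
      by apply/eqP => ta; apply: nt; right; rewrite ta.
    move=> d2 e2; split; first exact: derivableB.
    by rewrite derive1E deriveB// -!derive1E e1 e2 v0E// subrr.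
rewrite /z => h.
have I0 : Int a a v0 = 0.
  have v0i' : intg a a v0 by apply: integrableS v0i => //; exact: measurable_itvL.
  by have := Int_chasles (lexx a) (lexx a) v0i'; lra.
rewrite -(eq_Int v0E); move: h; rewrite I0; lra.
Qed.

End AbsCont.

Global Opaque Int.

(** * Measurable selection by a rational Hahn-Banach extension *)

Section EuclideanNorm.
Context {R : realType} {m : nat}.
Implicit Types (u v w p q : 'rV[R]_m) (a b : R).

Lemma dotvC u v : dotv u v = dotv v u.
Proof. by apply: eq_bigr => j _; rewrite mulrC. Qed.

Lemma dotvDl u v w : dotv (u + v) w = dotv u w + dotv v w.
Proof. by rewrite -big_split; apply: eq_bigr => j _; rewrite mxE mulrDl. Qed.

Lemma dotvZl a u v : dotv (a *: u) v = a * dotv u v.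
Proof. by rewrite mulr_sumr; apply: eq_bigr => j _; rewrite mxE mulrA. Qed.

Lemma dotvNl u v : dotv (- u) v = - dotv u v.
Proof. by rewrite -scaleN1r dotvZl mulN1r. Qed.

Lemma dotvBl u v w : dotv (u - v) w = dotv u w - dotv v w.
Proof. by rewrite dotvDl dotvNl. Qed.

Lemma dotvDr u v w : dotv w (u + v) = dotv w u + dotv w v.
Proof. by rewrite dotvC dotvDl !(dotvC w). Qed.

Lemma dotvZr a u v : dotv u (a *: v) = a * dotv u v.
Proof. by rewrite dotvC dotvZl dotvC. Qed.

Lemma dotvNr u v : dotv u (- v) = - dotv u v.
Proof. by rewrite dotvC dotvNl dotvC. Qed.

Lemma dotvBr u v w : dotv w (u - v) = dotv w u - dotv w v.
Proof. by rewrite dotvDr dotvNr. Qed.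

Lemma dot0v u : dotv 0 u = 0.
Proof. by rewrite -(scale0r (0 : 'rV[R]_m)) dotvZl mul0r. Qed.

Lemma dotv0 u : dotv u 0 = 0.
Proof. by rewrite dotvC dot0v. Qed.

Lemma dotvv_ge0 u : 0 <= dotv u u.
Proof. by apply: sumr_ge0 => j _; rewrite -expr2 sqr_ge0. Qed.

Lemma dotvv_eq0 u : (dotv u u == 0) = (u == 0).
Proof.
apply/idP/eqP => [|->]; last by rewrite dot0v.
rewrite psumr_eq0; last by move=> j _; rewrite -expr2 sqr_ge0.
move=> /allP h; apply/rowP => j; rewrite mxE.
have := h j (mem_index_enum j); rewrite /= mulf_eq0 orbb => /eqP //.
Qed.

Lemma enorm_ge0 u : 0 <= enorm u.
Proof. exact: sqrtr_ge0. Qed.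

Lemma enorm_sqr u : enorm u ^+ 2 = dotv u u.
Proof. by rewrite sqr_sqrtr// dotvv_ge0. Qed.

Lemma enorm_eq0 u : (enorm u == 0) = (u == 0).
Proof. by rewrite -(sqrf_eq0 (enorm u)) enorm_sqr dotvv_eq0. Qed.

Lemma enorm0 : enorm (0 : 'rV[R]_m) = 0.
Proof. by apply/eqP; rewrite enorm_eq0. Qed.

Lemma enormZ a u : enorm (a *: u) = `|a| * enorm u.
Proof.
rewrite /enorm dotvZl dotvZr mulrA -expr2 sqrtrM ?sqr_ge0//.
by rewrite sqrtr_sqr.
Qed.

Lemma enormN u : enorm (- u) = enorm u.
Proof. by rewrite -scaleN1r enormZ normrN1 mul1r. Qed.

Lemma enormB u v : enorm (u - v) = enorm (v - u).
Proof. by rewrite -enormN opprB. Qed.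

Lemma ler_dotv u v : dotv u v <= enorm u * enorm v.
Proof.
have [->|v0] := eqVneq v 0; first by rewrite dotv0 enorm0 mulr0.
have vv : 0 < dotv v v by rewrite lt_neqAle eq_sym dotvv_eq0 v0 dotvv_ge0.
have [uv|uv] := leP (dotv u v) 0.
  by apply: le_trans uv _; rewrite mulr_ge0// enorm_ge0.
rewrite -(@ler_pXn2r _ 2)// ?nnegrE ?mulr_ge0 ?enorm_ge0 ?(ltW uv)//.
rewrite exprMn !enorm_sqr.
have := dotvv_ge0 (u - (dotv u v / dotv v v) *: v).
move=> /(ler_wpM2r (ltW vv)); rewrite mul0r dotvBl !dotvBr !dotvZl !dotvZr (dotvC v u).
have e : dotv u v / dotv v v * dotv v v = dotv u v by rewrite divfK// gt_eqF.
set x := dotv u v / dotv v v in e *; move: e.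
move: (dotv u v) (dotv v v) (dotv u u) => A B C e; nra.
Qed.

Lemma ler_norm_dotv u v : `|dotv u v| <= enorm u * enorm v.
Proof.
by rewrite ler_norml ler_dotv andbT lerNl -dotvNl (le_trans (ler_dotv _ _))// enormN.
Qed.

Lemma ler_enormD u v : enorm (u + v) <= enorm u + enorm v.
Proof.
rewrite -(@ler_pXn2r _ 2)// ?nnegrE ?addr_ge0 ?enorm_ge0//.
rewrite sqrrD !enorm_sqr dotvDl !dotvDr (dotvC v u).
have := ler_dotv u v; lra.
Qed.

Lemma ler_enorm_triangle u v w : enorm (u - w) <= enorm (u - v) + enorm (v - w).
Proof. by rewrite -(subrKA v) addrC; apply: le_trans (ler_enormD _ _) _; rewrite addrC. Qed.

Lemma ler_dist_enorm u v : `|enorm u - enorm v| <= enorm (u - v).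
Proof.
rewrite ler_norml; apply/andP; split.
  rewrite lerNl opprB lerBlDr -[X in enorm X <= _](subrK u).
  by rewrite (le_trans (ler_enormD _ _))// enormB.
by rewrite lerBlDr -[X in enorm X <= _](subrK v) ler_enormD.
Qed.

Lemma ler_coord_enorm u (j : 'I_m) : `|u 0 j| <= enorm u.
Proof.
rewrite -(@ler_pXn2r _ 2)// ?nnegrE ?enorm_ge0// enorm_sqr real_normK ?num_real//.
rewrite /dotv (bigD1 j)//= -expr2 lerDl.
by apply: sumr_ge0 => i _; rewrite -expr2 sqr_ge0.
Qed.

Lemma ler_enorm_sum u : enorm u <= \sum_(j < m) `|u 0 j|.
Proof.
have s0 : 0 <= \sum_(j < m) `|u 0 j| by apply: sumr_ge0.
rewrite -(@ler_pXn2r _ 2)// ?nnegrE ?enorm_ge0// enorm_sqr.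
rewrite expr2 mulr_suml; apply: ler_sum => i _.
apply: (@le_trans _ _ (`|u 0 i| * `|u 0 i|)); first by rewrite -normrM ler_norm.
by apply: ler_wpM2l => //; rewrite (bigD1 i)//= lerDl sumr_ge0.
Qed.

Lemma ler_norm_enorm u : `|u| <= enorm u.
Proof.
rewrite [leLHS]mx_normrE; apply: bigmax_le; first exact: enorm_ge0.
by move=> [i j] _ /=; rewrite ord1 ler_coord_enorm.
Qed.

Lemma ler_enorm_norm u : enorm u <= m%:R * `|u|.
Proof.
apply: le_trans (ler_enorm_sum u) _.
rewrite mulr_natl -[X in _ *+ X](card_ord m) -sumr_const; apply: ler_sum => j _.
by rewrite [leRHS]mx_normrE; apply: le_trans (le_bigmax _ _ (0, j)).
Qed.

Lemma continuous_enorm : continuous (@enorm R m).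
Proof.
move=> u; have nF := @nbhs_filter _ u.
apply/(@cvgrPdist_le _ _ _ (nbhs u) nF) => e e0.
have m0 : (0 : R) < m%:R + 1 by rewrite ltr_wpDl.
apply: filterS (nbhsx_ballx u _ (divr_gt0 e0 m0)) => v.
rewrite -ball_normE/= => uv.
apply: le_trans (ler_dist_enorm _ _) _; apply: le_trans (ler_enorm_norm _) _.
have h0 : 0 <= `|u - v| by [].
apply: (@le_trans _ _ ((m%:R + 1) * `|u - v|)); first by rewrite ler_wpM2r// lerDl.
by rewrite mulrC -ler_pdivlMr// ltW.
Qed.

Lemma continuous_dotv u : continuous (dotv u).
Proof.
move=> v; have nF := @nbhs_filter _ v.
apply/(@cvgrPdist_le _ _ _ (nbhs v) nF) => e e0.
have m0 : (0 : R) < (enorm u + 1) * (m%:R + 1) by rewrite mulr_gt0// ltr_wpDl// enorm_ge0.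
apply: filterS (nbhsx_ballx v _ (divr_gt0 e0 m0)) => w.
rewrite -ball_normE/= => uv; rewrite -dotvBr.
apply: le_trans (ler_norm_dotv _ _) _.
apply: (@le_trans _ _ ((enorm u + 1) * ((m%:R + 1) * `|v - w|))).
  apply: ler_pM => //; rewrite ?enorm_ge0 ?lerDl//.
  by apply: le_trans (ler_enorm_norm _) _; rewrite ler_wpM2r// lerDl.
by rewrite mulrA mulrC -ler_pdivlMr// ltW.
Qed.

End EuclideanNorm.

Section RationalVectors.
Context {R : realType} {n : nat}.
Implicit Types (q p : 'rV[rat]_n) (u v w : 'rV[R]_n).

Definition ratv q : 'rV[R]_n := map_mx ratr q.

Lemma ratvD q p : ratv (q + p) = ratv q + ratv p.
Proof. exact: map_mxD. Qed.

Lemma ratvB q p : ratv (q - p) = ratv q - ratv p.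
Proof. exact: map_mxB. Qed.

Lemma ratvN q : ratv (- q) = - ratv q.
Proof. exact: map_mxN. Qed.

Lemma ratvZ a q : ratv (a *: q) = ratr a *: ratv q.
Proof. exact: map_mxZ. Qed.

Lemma ratv0 : ratv 0 = 0.
Proof. exact: map_mx0. Qed.

Lemma ratv_dense u (e : R) : 0 < e -> exists q, enorm (u - ratv q) < e.
Proof.
move=> e0; have n0 : (0 : R) < n%:R + 1 by rewrite ltr_wpDl.
have d0 : 0 < e / (n%:R + 1) by rewrite divr_gt0.
have H j : {r : rat | `|u 0 j - ratr r| < e / (n%:R + 1)}.
  apply: cid; have : u 0 j - e / (n%:R + 1) < u 0 j + e / (n%:R + 1) by lra.
  move=> /rat_in_itvoo[r]; rewrite in_itv/= => /andP[h1 h2].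
  by exists r; rewrite ltr_norml; lra.
exists (\row_j sval (H j)).
apply: le_lt_trans (ler_enorm_sum _) _.
apply: (@le_lt_trans _ _ (\sum_(j < n) e / (n%:R + 1))).
  by apply: ler_sum => j _; rewrite !mxE; apply/ltW/(svalP (H j)).
rewrite sumr_const card_ord -[_ *+ n]mulr_natl mulrA ltr_pdivrMr// mulrC ltr_pM2l//.
by rewrite ltrDl.
Qed.

Lemma ratv_cvg u : exists q : nat -> 'rV[rat]_n, ratv (q k) @[k --> \oo] --> u.
Proof.
have H (k : nat) : {q | enorm (u - ratv q) < k.+1%:R^-1}.
  by apply: cid; apply: ratv_dense; rewrite invr_gt0 ltr0n.
exists (fun k => sval (H k)).
apply/cvgrPdist_lt => e e0.
near=> k; apply: le_lt_trans (ler_norm_enorm _) _; apply: lt_trans (svalP (H k)) _.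
near: k; exact: near_infty_natSinv_lt (PosNum e0).
Unshelve. all: by end_near. Qed.

Lemma dense_le (f g : 'rV[R]_n -> R) : continuous f -> continuous g ->
  (forall q, f (ratv q) <= g (ratv q)) -> forall u, f u <= g u.
Proof.
move=> cf cg fg u; have [q qu] := ratv_cvg u.
apply: (ler_cvg_to (cvg_comp _ _ qu (cf u)) (cvg_comp _ _ qu (cg u))).
by apply: nearW => k /=; exact: fg.
Qed.

End RationalVectors.

Section CountableInf.
Context {R : realType} {I : countType}.

(** Infima are taken over countable types only, so that they preserve measurability in a
    parameter. *)
Definition finf (F : I -> R) : R := inf (range F).

Lemma ge_finf (F : I -> R) (m : R) i : (forall i, m <= F i) -> finf F <= F i.
Proof. by move=> mF; apply: ge_inf; [exists m => _ [j _ <-]|exists i]. Qed.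

Lemma le_finf (F : I -> R) (m : R) : I -> (forall i, m <= F i) -> m <= finf F.
Proof.
move=> i0 mF; apply: lb_le_inf; first by exists (F i0), i0.
by move=> _ [j _ <-].
Qed.

Lemma measurable_finf d (T : measurableType d) (D : set T) (F : I -> T -> R) (i0 : I) :
  (forall t, D t -> exists m, forall i, m <= F i t) ->
  (forall i, measurable_fun D (F i)) ->
  measurable_fun D (fun t => finf (F ^~ t)).
Proof.
move=> lF mF.
(* Codes that decode to nothing are sent to [i0], so that the sequence has the same range as the
   family. *)
pose e k := odflt i0 (@unpickle I k).
have lb t : D t -> has_lbound (range (fun k => F (e k) t)).
  by move=> /lF[m mFt]; exists m => _ [k _ <-].
apply: eq_measurable_fun (measurable_fun_infs 0%N lb (fun k => mF (e k))) => t _.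
rewrite /finf /infs; congr inf; apply/seteqP; split => _ [i _ <-]/=.
  by exists (e i).
by exists (pickle i) => //; rewrite /e pickleK.
Qed.

End CountableInf.

Section RationalHahnBanach.
Context {R : realType} {n : nat}.
Implicit Types (q p : 'rV[rat]_n) (S : 'rV[rat]_n -> R) (j : 'I_n).

Definition qsublinear S :=
  (forall q p, S (q + p) <= S q + S p) /\
  (forall (a : rat) q, 0 < a -> S (a *: q) <= ratr a * S q).

Lemma qsublinearZ S : qsublinear S -> forall (a : rat) q, 0 < a -> S (a *: q) = ratr a * S q.
Proof.
move=> [_ SZ] a q a0; apply/eqP; rewrite eq_le SZ//=.
have ia0 : 0 < a^-1 by rewrite invr_gt0.
have := SZ a^-1 (a *: q) ia0; rewrite scalerA mulVf ?gt_eqF// scale1r fmorphV.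
by rewrite ler_pdivlMl ?ltr0q.
Qed.

Lemma qsublinear0 S : qsublinear S -> S 0 = 0.
Proof.
move=> sS; have := qsublinearZ sS 0 (ltr0Sn _ 1); rewrite scaler0 ratr_nat; lra.
Qed.

Lemma qsublinearZ0 S : qsublinear S -> forall (a : rat) q, 0 <= a -> S (a *: q) = ratr a * S q.
Proof.
move=> sS a q; rewrite le_eqVlt => /predU1P[<-|]; last exact: qsublinearZ.
by rewrite scale0r rmorph0 mul0r qsublinear0.
Qed.

Lemma qsublinearN S : qsublinear S -> forall q, - S (- q) <= S q.
Proof.
move=> sS q; have := sS.1 q (- q); rewrite subrr (qsublinear0 sS); lra.
Qed.

(* Replacing [S] by [linearize j S] keeps it sublinear and below [S], and makes
   it linear along the [j]-th axis. *)
Definition linearize j S q : R :=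
  finf (fun a : rat => S (q + `|a| *: delta_mx 0 j) - ratr `|a| * S (delta_mx 0 j)).

(** This lower bound is independent of [a]; it is what makes the infimum in [linearize] a genuine
    one. *)
Lemma linearize_lb j S : qsublinear S -> forall q (a : rat),
  - S (- q) <= S (q + `|a| *: delta_mx 0 j) - ratr `|a| * S (delta_mx 0 j).
Proof.
move=> sS q a; rewrite -qsublinearZ0//.
have := sS.1 (q + `|a| *: delta_mx 0 j) (- q).
rewrite addrAC subrr add0r; lra.
Qed.

Lemma linearize_le j S (a : rat) q : qsublinear S ->
  linearize j S q <= S (q + `|a| *: delta_mx 0 j) - ratr `|a| * S (delta_mx 0 j).
Proof. by move=> sS; have := ge_finf a (linearize_lb j sS q). Qed.

Lemma linearize_le0 j S q : qsublinear S -> linearize j S q <= S q.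
Proof.
move=> sS; have := linearize_le j 0 q sS.
by rewrite normr0 scale0r addr0 rmorph0 mul0r subr0.
Qed.

Lemma linearize_sublinear j S : qsublinear S -> qsublinear (linearize j S).
Proof.
move=> sS; split.
  move=> q p; rewrite -lerBlDr; apply: le_finf => [|a]; first exact: 0.
  rewrite lerBlDl -lerBlDr; apply: le_finf => [|b]; first exact: 0.
  have := linearize_le j (`|a| + `|b|) (q + p) sS.
  rewrite ger0_norm ?addr_ge0// rmorphD/= scalerDl addrACA.
  have := sS.1 (q + `|a| *: delta_mx 0 j) (p + `|b| *: delta_mx 0 j); lra.
move=> a q a0; have ra0 : 0 < ratr a :> R by rewrite ltr0q.
rewrite mulrC -ler_pdivrMr//; apply: le_finf => [|b]; first exact: 0.
rewrite ler_pdivrMr//; have := linearize_le j (a * `|b|) (a *: q) sS.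
rewrite (ger0_norm (mulr_ge0 (ltW a0) (normr_ge0 b))) -scalerA -scalerDr rmorphM/= (qsublinearZ sS _ a0); lra.
Qed.

(** The choice [a = 1] moves [- delta_mx 0 j] to the origin, where [S] vanishes. *)
Lemma linearize_axis j S : qsublinear S ->
  linearize j S (- delta_mx 0 j) <= - linearize j S (delta_mx 0 j).
Proof.
move=> sS; have := linearize_le j 1 (- delta_mx 0 j) sS.
rewrite normr1 scale1r addNr rmorph1 mul1r qsublinear0//.
have := linearize_le0 j (delta_mx 0 j) sS; lra.
Qed.

Definition linearize_all S := foldr linearize S (enum 'I_n).

(** Linearity along an axis amounts to [L (- e) <= - L e], an inequality that survives any further
    decrease of [L] at [e] and [- e]; hence the axes can be treated one after another. *)
Lemma linearize_allP S : qsublinear S ->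
  let L := linearize_all S in
  [/\ qsublinear L, forall q, L q <= S q & forall j, L (- delta_mx 0 j) <= - L (delta_mx 0 j)].
Proof.
move=> sS /=; suff H (s : seq 'I_n) : [/\ qsublinear (foldr linearize S s),
    forall q, foldr linearize S s q <= S q &
    forall j, j \in s -> foldr linearize S s (- delta_mx 0 j) <= - foldr linearize S s (delta_mx 0 j)].
  by have [h1 h2 h3] := H (enum 'I_n); split => // j; apply: h3; rewrite mem_enum.
elim: s => [|i s [IH1 IH2 IH3]]; first by split.
split => /=; first exact: linearize_sublinear.
- by move=> q; apply: le_trans (linearize_le0 _ _ IH1) (IH2 q).
- move=> j; rewrite inE => /predU1P[->|/IH3 h]; first exact: linearize_axis.
  have := linearize_le0 i (- delta_mx 0 j) IH1; have := linearize_le0 i (delta_mx 0 j) IH1; lra.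
Qed.

Definition hb_row S : 'rV[R]_n := \row_j linearize_all S (delta_mx 0 j).

(** Splitting [q] along the axes bounds [L q] from above by the linear form; the same bound at
    [- q], together with [- L (- q) <= L q], reverses the inequality. *)
Lemma hb_row_le S : qsublinear S -> forall q, dotv (hb_row S) (ratv q) <= S q.
Proof.
move=> sS; have [sL LS Lax] := linearize_allP sS.
set L := linearize_all S in sL LS Lax *.
have Lle q : L q <= dotv (hb_row S) (ratv q).
  have -> : dotv (hb_row S) (ratv q) = \sum_j ratr (q 0 j) * L (delta_mx 0 j).
    by apply: eq_bigr => j _; rewrite !mxE mulrC.
  rewrite {1}(matrix_sum_delta q) big_ord1.
  elim/big_ind2 : _ => [|x1 x2 y1 y2 h1 h2|j _]; first by rewrite qsublinear0.
    by apply: le_trans (sL.1 _ _) _; exact: lerD.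
  have [q0|q0] := leP 0 (q 0 j); first by rewrite qsublinearZ0.
  rewrite -[q 0 j]opprK scaleNr -scalerN qsublinearZ ?oppr_gt0//.
  rewrite [ratr (- - _)]rmorphN/= mulNr -mulrN ler_pM2l ?ltr0q ?oppr_gt0//.
move=> q; apply: le_trans (LS q); apply: le_trans (qsublinearN sL q).
by rewrite lerNr -dotvNr -ratvN.
Qed.

Lemma measurable_linearize_all d (T : measurableType d) (D : set T) (S : T -> 'rV[rat]_n -> R) :
  (forall t, D t -> qsublinear (S t)) ->
  (forall q, measurable_fun D (S ^~ q)) ->
  forall q, measurable_fun D (fun t => linearize_all (S t) q).
Proof.
move=> sS mS; rewrite /linearize_all.
have [h1 h2] : (forall t, D t -> qsublinear (foldr linearize (S t) (enum 'I_n))) /\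
  forall q, measurable_fun D (fun t => foldr linearize (S t) (enum 'I_n) q).
  elim: (enum 'I_n) => [//|j s [IH1 IH2]]; split => [t Dt|q] /=.
    by apply: linearize_sublinear; exact: IH1.
  apply: measurable_finf; first exact: 0.
    by move=> t Dt; exists (- foldr linearize (S t) s (- q)) => a; exact: linearize_lb (IH1 t Dt) _ _.
  move=> a; apply: measurable_funB; first exact: IH2.
  by apply: measurable_funM => //; exact: IH2.
exact: h2.
Qed.

End RationalHahnBanach.

Section Selection.
Context {R : realType} {n : nat}.
Implicit Types (q p : 'rV[rat]_n) (g : 'rV[rat]_n -> R) (v : 'rV[R]_n) (rho : R).

(** A total stand-in for the positive rationals, so that the infimum of [sublinear_hull] ranges over
    a plain countable type. *)
Definition posq (a : rat) : rat := if 0 < a then a else 1.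

Lemma posq_gt0 a : 0 < posq a. Proof. by rewrite /posq; case: ifP. Qed.

Lemma posqE a : 0 < a -> posq a = a. Proof. by rewrite /posq => ->. Qed.

(** The price of splitting [q] into [a *: p] and a remainder: the first part is charged to the
    perspective of [g], the second to the cone around [v]. *)
Let body g v rho q (a : rat) p : R :=
  ratr a * g p + dotv (ratv (q - a *: p)) v + rho * enorm (ratv (q - a *: p) : 'rV[R]_n).

(* The largest sublinear function below both [g] and [q |-> <q,v> + rho |q|]. *)
Definition sublinear_hull g v rho q : R :=
  finf (fun i : rat * 'rV[rat]_n => body g v rho q (posq i.1) i.2).

Section Properties.
Variables (g : 'rV[rat]_n -> R) (v : 'rV[R]_n) (rho : R).
Hypothesis rho0 : 0 <= rho.
Hypothesis gv : forall p, dotv (ratv p) v - rho * enorm (ratv p : 'rV[R]_n) <= g p.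
Hypothesis gconv : forall (a b : rat) p q, 0 < a -> 0 < b ->
  ratr (a + b) * g ((a + b)^-1 *: (a *: p + b *: q)) <= ratr a * g p + ratr b * g q.

Lemma body_lb q a p : 0 < a -> dotv (ratv q) v - rho * enorm (ratv q : 'rV[R]_n) <= body g v rho q a p.
Proof.
move=> a0; have ra0 : 0 < ratr a :> R by rewrite ltr0q.
have h1 := ler_wpM2l (ltW ra0) (gv p).
rewrite /body !ratvB !ratvZ dotvBl dotvZl.
have := ler_enorm_triangle (ratr a *: ratv p) (ratv q : 'rV[R]_n) 0.
rewrite !subr0 enormZ gtr0_norm// (enormB _ (ratv q)) => /(ler_wpM2l rho0) h2.
lra.
Qed.

Lemma hull_le q a p : 0 < a -> sublinear_hull g v rho q <= body g v rho q a p.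
Proof.
move=> a0; rewrite -[a in leRHS](posqE a0).
by apply: (@ge_finf R _ _ _ (a, p)) => i; exact: body_lb (posq_gt0 _).
Qed.

Lemma hull_sublinear : qsublinear (sublinear_hull g v rho).
Proof.
have gt0r (a : rat) : 0 < a -> 0 < ratr a :> R by rewrite ltr0q.
split.
  move=> q p; rewrite -lerBlDr; apply: le_finf => [|[a x] /=]; first exact: (0, 0).
  rewrite lerBlDl -lerBlDr; apply: le_finf => [|[b y] /=]; first exact: (0, 0).
  move: (posq_gt0 a) (posq_gt0 b); move: (posq a) (posq b) => {}a {}b a0 b0.
  have ab0 : 0 < a + b by rewrite addr_gt0.
  have := hull_le (q + p) ((a + b)^-1 *: (a *: x + b *: y)) ab0.
  rewrite /body scalerA mulfV ?gt_eqF// scale1r => h.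
  have := gconv x y a0 b0 => h1.
  have e : q + p - (a *: x + b *: y) = (q - a *: x) + (p - b *: y) by rewrite opprD addrACA.
  rewrite e ratvD dotvDl in h.
  have h2 := ler_wpM2l rho0 (ler_enormD (ratv (q - a *: x) : 'rV[R]_n) (ratv (p - b *: y))).
  lra.
move=> a q a0; have ra0 : 0 < ratr a :> R by rewrite ltr0q.
rewrite mulrC -ler_pdivrMr//; apply: le_finf => [|[b y] /=]; first exact: (0, 0).
rewrite ler_pdivrMr//; move: (posq_gt0 b); move: (posq b) => {}b b0.
have ab0 : 0 < a * b by rewrite mulr_gt0.
have := hull_le (a *: q) y ab0.
rewrite /body -scalerA -scalerBr ratvZ dotvZl enormZ gtr0_norm// rmorphM/=; lra.
Qed.

Lemma hull_le_fun q : sublinear_hull g v rho q <= g q.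
Proof.
have := hull_le q q (ltr0Sn _ 0).
by rewrite /body scale1r subrr ratv0 dot0v enorm0 rmorph1; lra.
Qed.

(** Take [p = 0] and let [a] tend to 0; as [a] stays positive, a term [a * g 0] is left over and
    absorbed in [e]. *)
Lemma hull_le_cone q : sublinear_hull g v rho q <= dotv (ratv q) v + rho * enorm (ratv q : 'rV[R]_n).
Proof.
apply/ler_addgt0Pr => e e0.
have [a [a0 ae]] : exists a : rat, 0 < a /\ ratr a * `|g 0| < e.
  have d0 : 0 < e / (`|g 0| + 1) by rewrite divr_gt0// ltr_wpDl.
  have [a] := rat_in_itvoo d0; rewrite in_itv/= => /andP[a0 ae].
  exists a; split; first by rewrite -(ltr0q R).
  move: ae; rewrite ltr_pdivlMr ?ltr_wpDl//.
  rewrite mulrDr mulr1; lra.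
apply: le_trans (hull_le q 0 a0) _; rewrite /body scaler0 subr0.
have ra0 : 0 < ratr a :> R by rewrite ltr0q.
have := ler_wpM2l (ltW ra0) (ler_norm (g 0)); lra.
Qed.

Lemma select_le q : dotv (hb_row (sublinear_hull g v rho)) (ratv q) <= g q.
Proof. exact: le_trans (hb_row_le hull_sublinear q) (hull_le_fun q). Qed.

(** The functional lies below the cone, so [<w - v, u> <= rho |u|] for every [u] by density; the
    decisive test vector is [w - v] itself. *)
Lemma select_near : enorm (hb_row (sublinear_hull g v rho) - v) <= rho.
Proof.
set w := hb_row _.
have H : forall u, dotv (w - v) u <= rho * enorm u.
  apply: (@dense_le R n (dotv (w - v)) (fun u => rho * enorm u)).
  - exact: continuous_dotv.
  - by move=> u; apply: (@continuousM R 'rV[R]_n (fun=> rho) enorm u); [exact: cst_continuous|exact: continuous_enorm].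
  - move=> q; rewrite dotvBl (dotvC v).
    have := le_trans (hb_row_le hull_sublinear q) (hull_le_cone q); rewrite -/w; lra.
have := H (w - v); rewrite -enorm_sqr expr2.
have [->|wv] := eqVneq (enorm (w - v)) 0; first by [].
by rewrite ler_pM2r// lt_neqAle eq_sym wv enorm_ge0.
Qed.

End Properties.

Lemma convex_perspective (h : 'rV[R]_n -> R) :
  (forall x y (l : R), 0 <= l <= 1 -> h (l *: x + (1 - l) *: y) <= l * h x + (1 - l) * h y) ->
  forall (a b : rat) p q, 0 < a -> 0 < b ->
  ratr (a + b) * h (ratv ((a + b)^-1 *: (a *: p + b *: q))) <= ratr a * h (ratv p) + ratr b * h (ratv q).
Proof.
move=> hc a b p q a0 b0.
have ra0 : 0 < ratr a :> R by rewrite ltr0q.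
have rb0 : 0 < ratr b :> R by rewrite ltr0q.
have ab0 : 0 < ratr a + ratr b :> R by rewrite addr_gt0.
have e2 : ratr (a + b) = ratr a + ratr b :> R by rewrite rmorphD.
rewrite ratvZ ratvD !ratvZ fmorphV/= !e2 scalerDr !scalerA.
have e : 1 - ((ratr a + ratr b)^-1 * ratr a) = (ratr a + ratr b)^-1 * ratr b :> R.
  by field; rewrite gt_eqF.
have := hc (ratv p) (ratv q) ((ratr a + ratr b)^-1 * ratr a).
rewrite e => hh.
have l01 : 0 <= (ratr a + ratr b)^-1 * (ratr a : R) <= 1.
  by rewrite mulrC; apply/andP; split; [rewrite divr_ge0// ltW|rewrite ler_pdivrMr// mul1r lerDl ltW].
have := ler_wpM2l (ltW ab0) (hh l01).
rewrite mulrDr !mulrA mulfV ?gt_eqF// !mul1r; apply.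
Qed.

(** Hypothesis [hv] is the dual form of: [v t] is within [rho t] of the convex set of all [w] with
    [<p, w> <= h t p + s t]. The explicit [hb_row] of the hull provides such a point, measurably in
    [t]. *)
Lemma measurable_selection d (T : measurableType d) (D : set T)
  (h : T -> 'rV[R]_n -> R) (v : T -> 'rV[R]_n) (s rho : T -> R) :
  (forall t, D t -> 0 <= rho t) ->
  (forall t, D t -> continuous (h t)) ->
  (forall t, D t -> forall x y (l : R), 0 <= l <= 1 ->
     h t (l *: x + (1 - l) *: y) <= l * h t x + (1 - l) * h t y) ->
  (forall t, D t -> forall p : 'rV[R]_n, dotv p (v t) - rho t * enorm p <= h t p + s t) ->
  (forall p : 'rV[R]_n, measurable_fun D (h ^~ p)) ->
  (forall j, measurable_fun D (fun t => v t 0 j)) ->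
  measurable_fun D s -> measurable_fun D rho ->
  exists w : T -> 'rV[R]_n, [/\ forall j, measurable_fun D (fun t => w t 0 j),
    forall t, D t -> enorm (w t - v t) <= rho t &
    forall t, D t -> forall p : 'rV[R]_n, dotv p (w t) <= h t p + s t].
Proof.
move=> r0 hc hconv hv mh mv ms mr.
pose g t q := h t (ratv q) + s t.
have gv t (Dt : D t) q : dotv (ratv q) (v t) - rho t * enorm (ratv q : 'rV[R]_n) <= g t q.
  exact: hv.
have gconv t (Dt : D t) (a b : rat) p q : 0 < a -> 0 < b ->
    ratr (a + b) * g t ((a + b)^-1 *: (a *: p + b *: q)) <= ratr a * g t p + ratr b * g t q.
  move=> a0 b0; have := convex_perspective (hconv t Dt) p q a0 b0.
  by rewrite /g rmorphD/=; lra.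
exists (fun t => hb_row (sublinear_hull (g t) (v t) (rho t))); split.
- move=> j; apply: (@eq_measurable_fun _ _ _ _ D (fun t => linearize_all (sublinear_hull (g t) (v t) (rho t)) (delta_mx 0 j))).
    by move=> t _; rewrite mxE.
  apply: measurable_linearize_all => [t Dt|q].
    by apply: hull_sublinear; [exact: r0|exact: gv|exact: gconv].
  apply: measurable_finf; first exact: (0, 0).
    move=> t Dt; eexists => i; apply: body_lb; [exact: r0|exact: gv|exact: posq_gt0].
  move=> [a p] /=; rewrite /body; apply: measurable_funD; first apply: measurable_funD.
  - apply: measurable_funM => //; apply: measurable_funD; [exact: mh|exact: ms].
  - apply: measurable_sum => i; apply: measurable_funM => //; exact: mv.
  - exact: measurable_funM.
- by move=> t Dt; apply: select_near; [exact: r0|exact: gv|exact: gconv].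
- move=> t Dt; move=> p; rewrite dotvC; move: p.
  set w := hb_row _; have dl := @dense_le R n (dotv w) (fun p : 'rV[R]_n => h t p + s t).
  apply: dl.
  + exact: continuous_dotv.
  + by move=> p; apply: (@continuousD R R 'rV[R]_n (h t) (fun=> s t) p); [exact: hc|exact: cst_continuous].
  + move=> q; apply: select_le; [exact: r0|exact: gv|exact: gconv].
Qed.

End Selection.

(** * Arcs and exponential weights *)

Section Arcs.
Context {R : realType} {n : nat}.
Implicit Types (a b t : R) (v w : R -> 'rV[R]_n) (x : 'rV[R]_n).

Definition vintg a b v := forall j : 'I_n, intg a b (fun t => v t 0 j).

Definition vInt a b v : 'rV[R]_n := \row_j Int a b (fun t => v t 0 j).

Lemma vintgS a b c d v : a <= c -> d <= b -> vintg a b v -> vintg c d v.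
Proof. by move=> ac db vi j; exact: intgS (vi j). Qed.

Lemma vintgB a b v w : vintg a b v -> vintg a b w -> vintg a b (fun t => v t - w t).
Proof.
by move=> vi wi j; apply: eq_intg (intgB (vi j) (wi j)) => t _; rewrite !mxE.
Qed.

Lemma measurable_enorm d (U : measurableType d) (D : set U) (v : U -> 'rV[R]_n) :
  (forall j, measurable_fun D (fun u : U => v u 0 j)) -> measurable_fun D (fun u : U => enorm (v u)).
Proof.
move=> mv; rewrite /enorm /dotv.
apply: (measurableT_comp (f := @Num.sqrt R)).
  by apply: continuous_measurable_fun; exact: sqrt_continuous.
by apply: measurable_sum => j; exact: measurable_funM.
Qed.

Lemma intg_enorm a b v : vintg a b v -> intg a b (fun t => enorm (v t)).
Proof.
move=> vi; apply: (@intg_le _ _ _ _ (fun t => \sum_(j < n) `|v t 0 j|)).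
- by apply: measurable_enorm => j; exact: intg_meas (vi j).
- by move=> t _; rewrite ger0_norm ?enorm_ge0// ler_enorm_sum.
- by apply: intg_sum => j; exact: intg_norm.
Qed.

Lemma intg_dotv a b x v : vintg a b v -> intg a b (fun t => dotv x (v t)).
Proof. by move=> vi; apply: intg_sum => j; apply: intgZ; exact: vi. Qed.

(** Pair the integral with itself and apply Cauchy-Schwarz under the integral sign. *)
Lemma vInt_enorm a b v : vintg a b v -> enorm (vInt a b v) <= Int a b (fun t => enorm (v t)).
Proof.
move=> vi; set x := vInt a b v.
have [->|x0] := eqVneq (enorm x) 0; first by apply: Int_ge0 => t _; exact: enorm_ge0.
have xp : 0 < enorm x by rewrite lt_neqAle eq_sym x0 enorm_ge0.
rewrite -(ler_pM2l xp) -expr2 enorm_sqr.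
have -> : dotv x x = Int a b (fun t => dotv x (v t)).
  rewrite [RHS]Int_sum; last by move=> j; apply: intgZ; exact: vi.
  by apply: eq_bigr => j _; rewrite IntZ ?mxE.
rewrite -IntZ; last exact: intg_enorm.
apply: le_Int; [exact: intg_dotv|apply: intgZ; exact: intg_enorm|].
by move=> t _; exact: ler_dotv.
Qed.

Lemma vInt_chasles a b c v : a <= b -> b <= c -> vintg a c v ->
  vInt a c v = vInt a b v + vInt b c v.
Proof.
by move=> ab bc vi; apply/rowP => j; rewrite !mxE; exact: Int_chasles (vi j).
Qed.

Lemma vIntE a b v j : vInt a b v 0 j = Int a b (fun t => v t 0 j).
Proof. by rewrite mxE. Qed.

Lemma vIntB a b v w : vintg a b v -> vintg a b w ->
  vInt a b v - vInt a b w = vInt a b (fun t => v t - w t).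
Proof.
move=> vi wi; apply/rowP => j; rewrite !mxE -IntB//.
by apply: eq_Int => t _; rewrite !mxE.
Qed.

Definition clamp a b t := Num.max a (Num.min b t).

Lemma clampE a b t : a <= t <= b -> clamp a b t = t.
Proof. by move=> /andP[at_ tb]; rewrite /clamp (min_idPr tb) (max_idPr at_). Qed.

Lemma clamp_itv a b t : a <= b -> a <= clamp a b t <= b.
Proof. by move=> ab; rewrite /clamp le_max lexx/= ge_max ab ge_min lexx. Qed.

Lemma clamp_lip a b s t : `|clamp a b s - clamp a b t| <= `|s - t|.
Proof.
wlog st : s t / s <= t.
  move=> W; have [st|ts] := leP s t; first exact: W.
  by rewrite distrC (distrC s); apply: W; exact: ltW.
rewrite (ler0_norm (x := s - t)) ?subr_le0// ler_norml /clamp.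
have [bs|bs] := leP b s; have [bt|bt] := leP b t.
- by rewrite subrr; apply/andP; split; lra.
- by exfalso; lra.
- by have [as_|as_] := leP a s; have [ab|ab] := leP a b; apply/andP; split; lra.
- by have [as_|as_] := leP a s; have [ab|ab] := leP a t; apply/andP; split; lra.
Qed.

(* Extended by constants outside [a, b], so that arcs are continuous on the
   whole line. *)
Definition arc a b x v t : 'rV[R]_n := x + vInt a (clamp a b t) v.

Lemma arcE a b x v t : a <= t <= b -> arc a b x v t = x + vInt a t v.
Proof. by move=> tab; rewrite /arc clampE. Qed.

Lemma arcB a b x v s t : a <= s -> s <= t -> t <= b -> vintg a b v ->
  arc a b x v t - arc a b x v s = vInt s t v.
Proof.
move=> as_ st tb vi.
rewrite !arcE ?as_ ?tb ?(le_trans st) ?(le_trans as_)//.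
rewrite (vInt_chasles as_ st (vintgS (lexx _) tb vi)) opprD addrACA subrr add0r.
by rewrite addrC addKr.
Qed.

Lemma arc_abs_cont a b x v : vintg a b v -> abs_cont_on a b (arc a b x v).
Proof.
move=> vi e e0.
have [d d0 H] := Int_small (intg_enorm vi) (fun t => enorm_ge0 _) e0.
exists d => // k l r lr dis sm; apply: le_lt_trans (H k l r lr dis sm).
apply: ler_sum => i _; have [ai [li ri]] := lr i (ltn_ord i).
by rewrite arcB//; apply: vInt_enorm; exact: vintgS vi.
Qed.

Lemma abs_cont_clamp_continuous a b (f : R -> 'rV[R]_n) : a <= b -> abs_cont_on a b f ->
  continuous (fun t => f (clamp a b t)).
Proof.
move=> ab acf t; apply/cvgrPdist_lt => e e0.
have [d d0 H] := acf e e0.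
have H2 s u : a <= s -> s <= u -> u <= b -> u - s < d -> enorm (f u - f s) < e.
  move=> as_ su ub usd.
  have := H 1%N (fun=> s) (fun=> u); rewrite !big_ord1; apply=> //.
  by move=> i j ij; rewrite ltnS leqn0 => /eqP j0; rewrite j0 in ij.
near=> s.
have std : `|clamp a b t - clamp a b s| < d.
  apply: le_lt_trans (clamp_lip _ _ _ _) _; near: s.
  exact: (@cvgr_dist_lt _ R^o _ _ _ id t).
apply: le_lt_trans (ler_norm_enorm _) _.
have /andP[at_ tb] := clamp_itv t ab; have /andP[as_ sb] := clamp_itv s ab.
have [ts|st] := leP (clamp a b t) (clamp a b s).
  by rewrite enormB; apply: H2 => //; rewrite distrC ger0_norm ?subr_ge0 in std.
by apply: H2 => //; [exact: ltW|rewrite ger0_norm ?subr_ge0 ?ltW in std].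
Unshelve. all: by end_near. Qed.

Lemma arc_continuous a b x v : a <= b -> vintg a b v -> continuous (arc a b x v).
Proof.
move=> ab vi; have := abs_cont_clamp_continuous ab (arc_abs_cont x vi).
rewrite (_ : (fun t => arc a b x v (clamp a b t)) = arc a b x v)//.
by apply/funext => s; rewrite /arc [clamp a b (clamp _ _ _)]clampE// clamp_itv.
Qed.

Lemma arc_dist a b x v w t : a <= t <= b -> vintg a b v -> vintg a b w ->
  enorm (arc a b x v t - arc a b x w t) <= Int a t (fun s => enorm (v s - w s)).
Proof.
move=> tab vi wi; have /andP[_ tb] := tab.
have vi' := vintgS (lexx a) tb vi; have wi' := vintgS (lexx a) tb wi.
rewrite !arcE// opprD addrACA subrr add0r vIntB//.
by apply: vInt_enorm; exact: vintgB.
Qed.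

Lemma arc_growth a b x v t : a <= t <= b -> vintg a b v ->
  enorm (arc a b x v t) <= enorm x + Int a t (fun s => enorm (v s)).
Proof.
move=> tab vi; have /andP[_ tb] := tab; rewrite arcE//.
apply: le_trans (ler_enormD _ _) _; rewrite lerD2l.
by apply: vInt_enorm; exact: vintgS vi.
Qed.

End Arcs.

Section Derivation.
Context {R : realType}.
Implicit Types (a b t : R).

(** Both end points go into the null set, so that the derivative is taken at interior points, near
    which [f] and its extension by 0 have the same indefinite integral. *)
Lemma FTC1_on a b (f : R -> R) : intg a b f ->
  exists2 N : set R, (@Leb R).-negligible (N : set LebT) &
  forall t, a <= t <= b -> ~ N t -> a < t < b /\ 
    derivable (fun s => Int a s f) t 1 /\ derive1 (fun s => Int a s f) t = f t.
Proof.
move=> fi.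
pose f0 : R -> R := f \_ `[a, b]%classic.
have f0i : leb_integrable setT f0.
  have := (@integrable_mkcond _ _ _ (@Leb R) _ (fun t => (f t)%:E) (measurable_itvL `[a, b])).1 fi.
  by rewrite restrict_EFin.
have f0E t : a <= t <= b -> f0 t = f t.
  by move=> tab; rewrite /f0 patchE mem_set//= in_itv.
have [N1 [mN1 N10 N1f]] := FTC1_leb a f0i.
have n1 t : (@Leb R).-negligible ([set t] : set LebT).
  exists [set t]; split => //; last exact: Leb_set1.
  by rewrite -[X in measurable X]set_itv1; exact: measurable_itvL.
exists (N1 `|` [set a] `|` [set b]).
  by apply: negligibleU; [apply: negligibleU; [exists N1; split|exact: n1]|exact: n1].
move=> t /andP[at_ tb] nt.
have at' : a < t.
  by rewrite lt_neqAle at_ andbT; apply/eqP => ta; apply: nt; left; right; rewrite ta.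
have tb' : t < b.
  by rewrite lt_neqAle tb andbT; apply/eqP => ta; apply: nt; right; rewrite ta.
split; first by rewrite at'.
have /= : (~` N1) t by move=> h; apply: nt; left; left.
move=> /(subsetCl N1f) /=; rewrite /mkset => -[//|d1 e1].
have nb : \forall s \near t, s < b by exact: (open_nbhs_nbhs (conj (@open_lt R b) tb')).
have ne : {near t, (fun s => Int a s f0) =1 (fun s => Int a s f)}.
  near=> s; apply: eq_Int => u /andP[au us]; apply: f0E; rewrite au/=.
  apply: le_trans us _; apply: ltW; near: s; exact: nb.
split; first exact: near_eq_derivable d1.
by rewrite derive1E -(near_eq_derive _ ne) -derive1E e1 f0E// at_.
Unshelve. all: by end_near. Qed.

Lemma expR_lip A (x y : R) : x <= A -> y <= A -> `|expR x - expR y| <= expR A * `|x - y|.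
Proof.
move=> xA yA.
wlog xy : x y xA yA / y <= x.
  move=> W; have [yx|xy] := leP y x; first exact: W.
  by rewrite distrC (distrC x); apply: W => //; exact: ltW.
rewrite !ger0_norm ?subr_ge0 ?ler_expR//.
have h := expR_ge1Dx (y - x).
have e1 : expR y = expR x * expR (y - x) by rewrite -expRD addrC subrK.
have h2 : expR x <= expR A by rewrite ler_expR.
have h3 := ler_wpM2l (ltW (expR_gt0 x)) h.
have h4 : expR x * (x - y) <= expR A * (x - y) by rewrite ler_wpM2r// subr_ge0.
rewrite e1; lra.
Qed.

Lemma acR_lip a b (F G : R -> R) L : 0 <= L -> acR a b G ->
  (forall s t, a <= s <= b -> a <= t <= b -> `|F s - F t| <= L * `|G s - G t|) ->
  acR a b F.
Proof.
move=> L0 acG FG e e0.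
have L1 : 0 < L + 1 by rewrite ltr_wpDl.
have [d d0 H] := acG _ (divr_gt0 e0 L1).
exists d => // k l r lr dis sm.
have := H k l r lr dis sm; rewrite ltr_pdivlMr// mulrC => h.
apply: le_lt_trans h; rewrite mulr_sumr; apply: ler_sum => i _.
have [ai [li ri]] := lr i (ltn_ord i).
apply: (@le_trans _ _ (L * `|G (r i) - G (l i)|)).
  by apply: FG; rewrite ?ai ?ri ?(le_trans ai) ?(le_trans li).
by rewrite ler_wpM2r// lerDl.
Qed.

Lemma Int_mono a b t (f : R -> R) : intg a b f -> (forall t, 0 <= f t) ->
  a <= t <= b -> Int a t f <= Int a b f.
Proof.
move=> fi f0 /andP[at_ tb]; rewrite (Int_chasles at_ tb fi) lerDl.
by apply: Int_ge0 => s _.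
Qed.

Lemma meas_Int a b (f : R -> R) : intg a b f -> (forall t, 0 <= f t) ->
  leb_measurable `[a, b]%classic (fun t => Int a t f).
Proof.
move=> fi f0; suff mI : leb_measurable `[a, b]%classic (fun t => Int a (clamp a b t) f).
  by apply: eq_measurable_fun mI => t; rewrite inE/= in_itv/= => tab; rewrite clampE.
apply: borel_fun_leb; first exact: measurable_itvL.
have [ab|ba] := leP a b; last first.
  rewrite (_ : (fun _ => _) = (fun=> Int a a f)); first exact: measurable_cst.
  apply/funext => t; rewrite /clamp; congr Int; apply/max_idPl.
  by rewrite (le_trans _ (ltW ba))// ge_min lexx.
apply: nondecreasing_measurable => // s t st.
have /andP[as_ sb] := clamp_itv s ab; have /andP[at_ tb] := clamp_itv t ab.
apply: Int_mono; [exact: intgS fi|exact: f0|rewrite as_/=].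
rewrite /clamp ge_max le_max lexx/= le_max; apply/orP; right.
by rewrite le_min !ge_min lexx st orbT.
Qed.

(** Since [W' = 2 k W], the integral of [k W] is half the increase of [W], and [W a] is
    nonnegative. *)
Lemma Int_weight a b (k W : R -> R) (A : R) (N : set R) : intg a b k -> (forall t, 0 <= k t) ->
  (forall t, a <= t <= b -> 0 <= W t <= A) -> leb_measurable `[a, b]%classic W ->
  acR a b W -> (@Leb R).-negligible (N : set LebT) ->
  (forall t, a <= t <= b -> ~ N t -> derivable W t 1 /\ derive1 W t = 2 * (k t * W t)) ->
  intg a b (fun t => k t * W t) /\
  forall t, a <= t <= b -> Int a t (fun s => k s * W s) <= W t / 2.
Proof.
move=> ki k0 W0 mW acW Nn dW.
have wi : intg a b (fun t => k t * W t).
  apply: (@intg_le _ _ _ _ (fun t => A * k t)).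
  - by apply: measurable_funM => //; exact: intg_meas ki.
  - move=> t /W0/andP[w0 wA]; rewrite ger0_norm ?mulr_ge0// mulrC.
    by apply: ler_wpM2r.
  - exact: intgZ.
split=> // t /andP[at_ tb].
have wi' := intgS (lexx a) tb wi.
have : W t - W a = Int a t (fun s => 2 * (k s * W s)).
  apply: (@FTC2_leb R a t W _ N) => //.
  - move=> e /acW[d d0 H]; exists d => // m l r lr; apply: H => i /lr[? [? ?]].
    by split=> //; split=> //; exact: le_trans tb.
  - exact: intgZ.
  - by move=> s /andP[as_ st]; apply: dW; rewrite as_ (le_trans st).
have aab : a <= a <= b by rewrite lexx (le_trans at_).
have /andP[Wa0 _] := W0 a aab.
rewrite IntZ// => h; lra.
Qed.

Lemma exp_weight a b (k : R -> R) : intg a b k -> (forall t, 0 <= k t) ->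
  exists (K : R -> R) (N : set R), [/\ K = (fun s => Int a s k), (@Leb R).-negligible (N : set LebT) &
  forall t, a <= t <= b -> ~ N t -> derivable K t 1 /\ derive1 K t = k t].
Proof.
move=> ki k0; have [N Nn HN] := FTC1_on ki.
by exists (fun s => Int a s k), N; split => // t tab /(HN t tab)[_ []].
Qed.

Lemma derive_exp2 (K : R -> R) t : derivable K t 1 ->
  derivable (fun s => expR (2 * K s)) t 1 /\
  derive1 (fun s => expR (2 * K s)) t = 2 * (derive1 K t * expR (2 * K t)).
Proof.
move=> dK.
have dK2 : derivable (fun s => 2 * K s) t 1 by apply: derivableM => //; exact: derivable_cst.
have e2 : derive1 (fun s => 2 * K s) t = 2 * derive1 K t.
  by rewrite derive1E deriveZ// -derive1E.
have dE := @derivable_expR R (2 * K t).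
split.
  apply/derivable1_diffP; apply: (differentiable_comp (f := fun s => 2 * K s) (g := expR)).
    exact/derivable1_diffP.
  exact/derivable1_diffP.
rewrite (@derive1_comp _ (fun s => 2 * K s) expR)//.
have eE : derive1 (@expR R) (2 * K t) = expR (2 * K t) by rewrite derive1E derive_val.
by rewrite e2 eE; ring.
Qed.

(* The weight [expR (2 K)] makes one Picard step a contraction of factor 1/2. *)
Lemma Int_exp_weight a b (k : R -> R) : intg a b k -> (forall t, 0 <= k t) ->
  intg a b (fun t => k t * expR (2 * Int a t k)) /\
  forall t, a <= t <= b -> Int a t (fun s => k s * expR (2 * Int a s k)) <= expR (2 * Int a t k) / 2.
Proof.
move=> ki k0; have [K [N [KE Nn HN]]] := exp_weight ki k0.
have KA t : a <= t <= b -> K t <= K b by rewrite KE; exact: Int_mono.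
have K0 t : 0 <= K t by rewrite KE; apply: Int_ge0.
have acK : acR a b K by rewrite KE; exact: acR_Int.
have mK : leb_measurable `[a, b]%classic K by rewrite KE; exact: meas_Int.
rewrite (_ : (fun t => k t * expR (2 * Int a t k)) = (fun t => k t * expR (2 * K t))); last by rewrite KE.
suff [h1 h2] : intg a b (fun t => k t * expR (2 * K t)) /\
  forall t, a <= t <= b -> Int a t (fun s => k s * expR (2 * K s)) <= expR (2 * K t) / 2.
  by split=> // t /h2; rewrite KE.
apply: (@Int_weight a b k (fun t => expR (2 * K t)) (expR (2 * K b)) N) => //.
- by move=> t tab; rewrite expR_ge0 ler_expR ler_pM2l// KA.
- apply: (measurableT_comp (@measurable_expR R)).
  by apply: measurable_funM => //; exact: measurable_cst.
- apply: (@acR_lip _ _ _ K (expR (2 * K b) * 2)) => //.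
  move=> s u sab uab.
  have := @expR_lip (2 * K b) (2 * K s) (2 * K u).
  by rewrite -mulrBr normrM ger0_norm// mulrA; apply; rewrite ler_pM2l// KA.
- by move=> t tab Nt; have [d e] := HN t tab Nt; have [] := derive_exp2 d; rewrite e.
Qed.

End Derivation.

Global Opaque vInt arc.

(** * Superposition of Caratheodory functions, and geometric limits *)

Section Caratheodory.
Context {R : realType} {n : nat}.

(** Freezing [x] at the last node of a grid of mesh [1/(k+1)] gives a function that is measurable on
    each cell; as [k] grows it converges pointwise by continuity. *)
Lemma caratheodory_measurable (a b : R) (h : R -> 'rV[R]_n -> R) (x : R -> 'rV[R]_n) :
  (forall u, leb_measurable `[a, b]%classic (fun t => h t u)) ->
  (forall t, a <= t <= b -> continuous (h t)) -> continuous x ->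
  leb_measurable `[a, b]%classic (fun t => h t (x t)).
Proof.
move=> mh ch cx.
pose node k m : R := a + m%:R / k.+1%:R.
pose step (k : nat) t : R := node k (Num.truncn ((t - a) * k.+1%:R)).
have k0 (k : nat) : 0 < k.+1%:R :> R by rewrite ltr0n.
have stepP k t : a <= t -> `|t - step k t| < k.+1%:R^-1.
  move=> at_; have h0 : 0 <= (t - a) * k.+1%:R by rewrite mulr_ge0 ?subr_ge0.
  have /andP[h1 h2] := truncn_itv h0.
  rewrite /step /node; set m := Num.truncn _ in h1 h2 *.
  have e : t - a = (t - a) * k.+1%:R / k.+1%:R by rewrite mulfK// gt_eqF.
  have h1' : m%:R / k.+1%:R <= t - a by rewrite ler_pdivrMr.
  have h2' : t - a < (m%:R + 1) / k.+1%:R by rewrite ltr_pdivlMr// natr1.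
  move: h2'; rewrite mulrDl mul1r => h2'.
  clear h1 h2 e; move: h1' h2'; set A := _ / _; set B := k.+1%:R^-1.
  move: A B => A B h1 h2.
  have h3 : 0 <= t - (a + A) by lra.
  by rewrite (ger0_norm h3); lra.
have mhs k : leb_measurable `[a, b]%classic (fun t => h t (x (step k t))).
  move=> _ B mB.
  pose D := `[a, b]%classic : set R.
  pose I m : set R := [set` `[node k m, node k m.+1[].
  rewrite (_ : _ `&` _ = \bigcup_m (I m `&` (D `&` (fun t => h t (x (node k m))) @^-1` B))).
    apply: bigcupT_measurable => m; apply: measurableI; first exact: measurable_itvL.
    by apply: mh => //; exact: measurable_itvL.
  have stepI t m : a <= t -> (I m t <-> Num.truncn ((t - a) * k.+1%:R) = m).
    move=> at_; have h0 : 0 <= (t - a) * k.+1%:R by rewrite mulr_ge0 ?subr_ge0.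
    rewrite (rwP eqP) truncn_eq// /I /= in_itv/= /node -lerBrDl -ltrBlDl.
    by rewrite ler_pdivrMr// ltr_pdivlMr.
  apply/seteqP; split => t /=.
    move=> [Dt Bt]; have at_ : a <= t by move: Dt; rewrite /D /= in_itv/= => /andP[].
    exists (Num.truncn ((t - a) * k.+1%:R)) => //; split=> //; exact/stepI.
  move=> [m _ [Imt [Dt Bt]]]; split=> //.
  have at_ : a <= t by move: Dt; rewrite /D /= in_itv/= => /andP[].
  by move/(stepI t m at_) : Imt => e; rewrite /step e.
apply: (measurable_fun_cvg mhs).
move=> t /=; rewrite in_itv/= => tab; have /andP[at_ tb] := tab.
  have cs : step k t @[k --> \oo] --> t.
    apply/cvgrPdist_lt => e e0; near=> k.
    apply: lt_trans (stepP k t at_) _; near: k; exact: near_infty_natSinv_lt (PosNum e0).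
  have cx' : x (step k t) @[k --> \oo] --> x t by exact: (cvg_comp _ _ cs (cx t)).
  exact: (cvg_comp _ _ cx' (ch t tab (x t))).
Unshelve. all: by end_near. Qed.

End Caratheodory.

Section GeometricLimit.
Context {R : realType}.

Lemma geom_sum_lt2 (j : nat) : \sum_(i < j) 2^-1 ^+ i < 2 :> R.
Proof.
have e : \sum_(i < j) 2^-1 ^+ i = 2 - 2 * 2^-1 ^+ j :> R.
  elim: j => [|j IH]; first by rewrite big_ord0 expr0; lra.
  by rewrite big_ord_recr/= IH exprS; lra.
by rewrite e ltrBlDr ltrDl mulr_gt0// exprn_gt0// invr_gt0.
Qed.

Lemma geometric_limit (u : nat -> R) (c : R) : 0 <= c ->
  (forall j, `|u j.+1 - u j| <= c * 2^-1 ^+ j) ->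
  u @ \oo --> limn u /\ forall j, `|u j - limn u| <= 2 * c * 2^-1 ^+ j.
Proof.
move=> c0 uc.
have H j m : `|u (j + m)%N - u j| <= 2 * c * 2^-1 ^+ j.
  apply: (@le_trans _ _ (c * 2^-1 ^+ j * \sum_(i < m) 2^-1 ^+ i)); last first.
    rewrite [leRHS](_ : _ = c * 2^-1 ^+ j * 2); last by ring.
    by apply: ler_wpM2l; [rewrite mulr_ge0// exprn_ge0// invr_ge0|exact/ltW/geom_sum_lt2].
  elim: m => [|m IH]; first by rewrite addn0 subrr normr0 big_ord0 mulr0.
  rewrite big_ord_recr/= mulrDr [leRHS]addrC.
  rewrite addnS; have := ler_normD (u (j + m).+1 - u (j + m)%N) (u (j + m)%N - u j).
  rewrite addrA subrK => /le_trans; apply; apply: lerD => //.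
  by rewrite -mulrA -exprD.
have cvg_u : cvgn u.
  apply/cauchy_cvgP; apply: cauchy_exP => e e0.
  have c1 : 0 < 2 * c + 1 by rewrite ltr_wpDl// mulr_ge0.
  have h2 : `|2^-1 : R| < 1 by rewrite ger0_norm ?invr_ge0// invf_lt1// ltr1n.
  have /cvgrPdist_lt /(_ _ (divr_gt0 e0 c1)) [N _ /(_ N (leqnn _))] := cvg_expr h2.
  rewrite /= sub0r normrN ger0_norm ?exprn_ge0 ?invr_ge0// ltr_pdivlMr// => hN.
  exists (u N); exists N => // m /= Nm; rewrite /ball/= distrC -(subnKC Nm).
  apply: le_lt_trans (H _ _) _; apply: le_lt_trans hN; rewrite mulrC.
  by apply: ler_wpM2l; [rewrite exprn_ge0// invr_ge0|rewrite lerDl].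
split; first exact: cvg_u.
move=> j; have : (fun m => `|u (j + m)%N - u j|) @ \oo --> `|limn u - u j|.
  apply: cvg_norm; apply: cvgB; last exact: cvg_cst.
  rewrite (_ : (fun m => u (j + m)%N) = (fun m => u (m + j)%N)); last by apply/funext=> m; rewrite addnC.
  by rewrite cvg_shiftn; exact: cvg_u.
move=> /(cvgr_to_le) h; rewrite distrC; apply: h; apply: nearW => m; exact: H.
Qed.

End GeometricLimit.

Section PartialContinuity.
Variables (A B C : topologicalType) (f : A -> B -> C).

Lemma continuous_snd : continuous (fun ab : A * B => f ab.1 ab.2) -> forall a, continuous (f a).
Proof.
move=> cf a b.
have cp : (a, b') @[b' --> b] --> (a, b) by apply: cvg_pair; [exact: cvg_cst|exact: cvg_id].
exact: (cvg_comp _ _ cp (cf (a, b))).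
Qed.

Lemma continuous_fst : continuous (fun ab : A * B => f ab.1 ab.2) -> forall b, continuous (f ^~ b).
Proof.
move=> cf b a.
have cp : (a', b) @[a' --> a] --> (a, b) by apply: cvg_pair; [exact: cvg_id|exact: cvg_cst].
exact: (cvg_comp _ _ cp (cf (a, b))).
Qed.

End PartialContinuity.

(** The loss [rho * (1 + q)] caused by moving the arc splits into a velocity tolerance [rho * q] and
    an extra cost [rho], the form required by [steers]. *)
Lemma absorb_slack (R : realFieldType) (A B B' s rho q : R) :
  A <= B + s -> B - B' <= rho * (1 + q) -> A - rho * q <= B' + (s + rho).
Proof. lra. Qed.

(** * Filippov's theorem *)

Section Filippov.
Context {R : realType} {n : nat}.
(** [E] and [W] are weights adapted to [c] and [k]: through [cE] and [EM] the first keeps every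
    iterate in the ball of radius [M], and through [kW] the second makes the iteration contract. *)
Variables (H : @Ham R n) (t0 T : R) (c k : R -> R) (M : R) (E W : R -> R) (Wb : R).
Hypothesis t0T : t0 <= T.
Hypothesis mH : forall x p, leb_measurable `[t0, T]%classic (fun t => H t x p).
Hypothesis cH : forall t, t0 <= t <= T -> continuous (fun xp : 'rV[R]_n * 'rV[R]_n => H t xp.1 xp.2).
Hypothesis convH : forall t, t0 <= t <= T -> forall x p q (lam : R), 0 <= lam <= 1 ->
  H t x (lam *: p + (1 - lam) *: q) <= lam * H t x p + (1 - lam) * H t x q.
Hypothesis lipH : forall t, t0 <= t <= T -> forall x p q,
  `|H t x p - H t x q| <= c t * (1 + enorm x) * enorm (p - q).
Hypothesis lcH : forall t, t0 <= t <= T -> forall x y p, enorm x <= M -> enorm y <= M ->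
  `|H t x p - H t y p| <= k t * (1 + enorm p) * enorm (x - y).
Hypothesis c0 : forall t, 0 <= c t.
Hypothesis k0 : forall t, 0 <= k t.
Hypothesis ci : intg t0 T c.
Hypothesis ki : intg t0 T k.
Hypothesis W1 : forall t, t0 <= t <= T -> 1 <= W t <= Wb.
Hypothesis kWi : intg t0 T (fun t => k t * W t).
Hypothesis kW : forall t, t0 <= t <= T -> Int t0 t (fun s => k s * W s) <= W t / 2.
Hypothesis E1 : forall t, t0 <= t <= T -> 1 <= E t.
Hypothesis cEi : intg t0 T (fun t => c t * E t).
Hypothesis cE : forall t, t0 <= t <= T -> Int t0 t (fun s => c s * E s) <= E t / 2.

Variable x0 : 'rV[R]_n.
Hypothesis EM : forall t, t0 <= t <= T -> 2 * (1 + enorm x0) * E t <= 1 + M.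
Notation y := (arc t0 T x0).
Implicit Types (v w : R -> 'rV[R]_n) (t : R) (p : 'rV[R]_n).

(** Test with [a *: w]: the left side grows like [a |w|^2], the right side only like [a L |w|]. The
    value of [a] makes the difference equal to [1 + |h 0 + s|]. *)
Lemma Hamiltonian_dom (h : 'rV[R]_n -> R) L (w : 'rV[R]_n) s : 0 <= L ->
  (forall p q : 'rV[R]_n, `|h p - h q| <= L * enorm (p - q)) ->
  (forall p, dotv p w <= h p + s) -> enorm w <= L.
Proof.
move=> L0 hL hw; rewrite leNgt; apply/negP => Lw.
have w0 : 0 <= enorm w := enorm_ge0 w.
have wp : 0 < enorm w by exact: le_lt_trans Lw.
pose a := (1 + `|h 0 + s|) / (enorm w * (enorm w - L)).
have d0 : 0 < enorm w * (enorm w - L) by rewrite mulr_gt0// subr_gt0.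
have a0 : 0 < a by rewrite divr_gt0// ltr_pwDl.
have := hw (a *: w); have := hL (a *: w) 0.
rewrite dotvZl -enorm_sqr subr0 enormZ (gtr0_norm a0).
have := ler_norm (h 0 + s).
have : a * (enorm w * (enorm w - L)) = 1 + `|h 0 + s| by rewrite /a divfK// gt_eqF.
have := ler_norm (h (a *: w) - h 0); nra.
Qed.

(** The slack hypothesis of [measurable_selection] along the arc of [v], with cost [r + rho] and
    distance [rho]. *)
Definition steers v (r rho : R -> R) :=
  forall t, t0 <= t <= T -> forall p, dotv p (v t) - rho t * enorm p <= H t (y v t) p + (r t + rho t).

(** The new velocity satisfies the constraint at the old arc, hence is at most [c * (1 + |y v|)].
    Integrating with [cE] returns the growth bound with the same factor 2, so it survives every
    iteration. *)
Lemma filippov_step v (r rho : R -> R) :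
  vintg t0 T v -> intg t0 T r -> intg t0 T rho -> (forall t, t0 <= t <= T -> 0 <= rho t) ->
  (forall t, t0 <= t <= T -> 1 + enorm (y v t) <= 2 * (1 + enorm x0) * E t) ->
  steers v r rho ->
  exists w, [/\ vintg t0 T w,
    forall t, t0 <= t <= T -> enorm (w t - v t) <= rho t,
    forall t, t0 <= t <= T -> forall p, dotv p (w t) <= H t (y v t) p + (r t + rho t) &
    forall t, t0 <= t <= T -> 1 + enorm (y w t) <= 2 * (1 + enorm x0) * E t].
Proof.
move=> vi ri rhoi rho0 yE sv.
have cHp t (tT : t0 <= t <= T) x : continuous (H t x) by apply: (@continuous_snd _ _ _ (H t)); exact: cH.
have cHx t (tT : t0 <= t <= T) p : continuous (fun x => H t x p) by apply: (@continuous_fst _ _ _ (H t)); exact: cH.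
have DT t : `[t0, T]%classic t -> t0 <= t <= T by rewrite /= in_itv.
have [w [mw wv wH]] := @measurable_selection R n _ (@LebT R) `[t0, T]%classic
  (fun t => H t (y v t)) v (fun t => r t + rho t) rho
  (fun t Dt => rho0 t (DT t Dt))
  (fun t Dt => cHp t (DT t Dt) (y v t))
  (fun t Dt => convH (DT t Dt) (y v t))
  (fun t Dt => sv t (DT t Dt))
  (fun p => caratheodory_measurable (fun x => mH x p) (fun t Dt => cHx t Dt p) (arc_continuous (x:=x0) t0T vi))
  (fun j => intg_meas (vi j))
  (measurable_funD (intg_meas ri) (intg_meas rhoi)) (intg_meas rhoi).
have DT' t : t0 <= t <= T -> `[t0, T]%classic t by rewrite /= in_itv.
have wi : vintg t0 T w.
  move=> j; apply: (@intg_le _ _ _ _ (fun t => enorm (v t) + rho t)).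
  - exact: mw.
  - move=> t tT; apply: le_trans (ler_coord_enorm _ _) _.
    by rewrite -lerBlDl (le_trans _ (wv t (DT' t tT)))// -[X in enorm X - _](subrK (v t)) lerBlDr ler_enormD.
  - by apply: intgD => //; exact: intg_enorm.
have wc t : t0 <= t <= T -> enorm (w t) <= c t * (1 + enorm (y v t)).
  move=> tT; apply: (@Hamiltonian_dom (H t (y v t)) _ _ (r t + rho t)).
  - by rewrite mulr_ge0// addr_ge0// enorm_ge0.
  - by move=> p q; exact: lipH.
  - exact: wH (DT' t tT).
exists w; split; first exact: wi.
  by move=> t tT; exact: wv (DT' t tT).
  by move=> t tT; exact: wH (DT' t tT).
move=> t tT; have /andP[at_ tb] := tT.
  have h1 := arc_growth x0 tT wi.
  have h2 : Int t0 t (fun s => enorm (w s)) <= 2 * (1 + enorm x0) * Int t0 t (fun s => c s * E s).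
    rewrite -IntZ; last exact: intgS cEi.
    apply: le_Int; [by apply: intg_enorm; exact: vintgS wi|by apply: intgZ; exact: intgS cEi|].
    move=> s /andP[as_ st]; have sT : t0 <= s <= T by rewrite as_ (le_trans st).
    by apply: le_trans (wc s sT) _; rewrite mulrCA ler_wpM2l// yE.
  have h3 := cE tT; have h4 := E1 tT; have h5 := enorm_ge0 x0.
  nra.
Qed.

Lemma le_of_geometric (a b C : R) : (forall j, a <= b + C * 2^-1 ^+ j) -> a <= b.
Proof.
move=> ab; have h2 : `|2^-1 : R| < 1 by rewrite ger0_norm ?invr_ge0// invf_lt1// ltr1n.
have c1 : b + C * 2^-1 ^+ j @[j --> \oo] --> b + C * 0.
  by apply: cvgD; [exact: cvg_cst|apply: cvgM; [exact: cvg_cst|exact: cvg_expr]].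
rewrite mulr0 addr0 in c1.
by apply: (cvgr_to_ge c1); apply: nearW.
Qed.

(* Filippov's theorem: Picard iteration, projecting at each step the previous
   velocity onto the admissible set at the previous arc.  The [j]-th correction is
   at most [rho j], and since [r] only bounds the cost from above it can be
   increased by exactly that amount. *)
Lemma filippov v0 (r0 rho0 : R -> R) :
  vintg t0 T v0 -> intg t0 T r0 -> intg t0 T rho0 -> (forall t, t0 <= t <= T -> 0 <= rho0 t) ->
  (forall t, t0 <= t <= T -> 1 + enorm (y v0 t) <= 2 * (1 + enorm x0) * E t) ->
  steers v0 r0 rho0 ->
  exists v r, [/\ vintg t0 T v, intg t0 T r,
    forall t, t0 <= t <= T -> forall p, dotv p (v t) <= H t (y v t) p + r t,
    forall t, t0 <= t <= T -> enorm (y v t - y v0 t) <= 2 * Wb * Int t0 T rho0 &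
    Int t0 T r <= Int t0 T r0 + (1 + Wb) * Int t0 T rho0].
Proof.
move=> v0i r0i rho0i rho00 v0E sv0.
set e := Int t0 T rho0.
have TT : t0 <= T <= T by rewrite t0T lexx.
have e0 : 0 <= e by apply: Int_ge0.
have hp j : 0 <= 2^-1 ^+ j :> R by rewrite exprn_ge0// invr_ge0.
(* The [j]-th correction moves the arc by at most [e * 2^-j * W]; multiplied by the Lipschitz bound
   [k], this displacement is the next defect. *)
pose rho j : R -> R := if j is j'.+1 then fun t => e * 2^-1 ^+ j' * (k t * W t) else rho0.
pose rr j t := r0 t + \sum_(i < j) rho i t.
have kW0 t : t0 <= t <= T -> 0 <= k t * W t.
  by move=> /W1/andP[w1 _]; rewrite mulr_ge0// (le_trans _ w1).
have rhoi j : intg t0 T (rho j) by case: j => [//|j]; exact: intgZ.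
have rho_ge0 j t : t0 <= t <= T -> 0 <= rho j t.
  by case: j => [|j] tT; [exact: rho00|apply: mulr_ge0; [exact: mulr_ge0|exact: kW0]].
have rri j : intg t0 T (rr j) by apply: intgD => //; exact: intg_sum.
have rhoI j t : t0 <= t <= T -> Int t0 t (rho j) <= e * 2^-1 ^+ j * W t.
  move=> tT; have /andP[at_ tb] := tT; have /andP[w1 _] := W1 tT.
  case: j => [|j] /=.
    rewrite expr0 mulr1; apply: (@le_trans _ _ e).
      by rewrite /e (Int_chasles at_ tb rho0i) lerDl; apply: Int_ge0 => s /andP[ts sT]; apply: rho00; rewrite sT (le_trans at_).
    by rewrite ler_peMr.
  rewrite IntZ; last exact: intgS kWi.
  rewrite exprS; have := kW tT => /(ler_wpM2l (mulr_ge0 e0 (hp j))); lra.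
pose P j v := [/\ vintg t0 T v,
  forall t, t0 <= t <= T -> 1 + enorm (y v t) <= 2 * (1 + enorm x0) * E t & steers v (rr j) (rho j)].
pose Q j v w := (forall t, t0 <= t <= T -> enorm (w t - v t) <= rho j t) /\
  (forall t, t0 <= t <= T -> forall p, dotv p (w t) <= H t (y v t) p + rr j.+1 t).
have yM v t : t0 <= t <= T -> 1 + enorm (y v t) <= 2 * (1 + enorm x0) * E t -> enorm (y v t) <= M.
  by move=> tT /le_trans /(_ (EM tT)); rewrite lerD2l.
have rrS j t : rr j.+1 t = rr j t + rho j t by rewrite /rr big_ord_recr/= addrA.
have yQ j v w t : vintg t0 T v -> vintg t0 T w -> Q j v w -> t0 <= t <= T ->
    enorm (y w t - y v t) <= e * 2^-1 ^+ j * W t.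
  move=> vi wi [wv _] tT; have /andP[at_ tb] := tT.
  apply: le_trans (arc_dist x0 tT wi vi) _; apply: le_trans _ (rhoI j t tT).
  apply: le_Int; [by apply: intg_enorm; apply: vintgB; apply: vintgS; try eassumption|exact: intgS (rhoi j)|].
  by move=> s /andP[as_ st]; apply: wv; rewrite as_ (le_trans st).
have step j v : P j v -> exists w, P j.+1 w /\ Q j v w.
  move=> [vi vE sv].
  have [w [wi wv wH wE]] := filippov_step vi (rri j) (rhoi j) (rho_ge0 j) vE sv.
  have Qw : Q j v w by split=> // t tT p; rewrite rrS; exact: wH.
  exists w; split => //; split => // t tT p.
  have h0 := wH t tT p; rewrite -rrS in h0.
  have h1 := lcH tT p (yM v t tT (vE t tT)) (yM w t tT (wE t tT)).
  have h2 := yQ j v w t vi wi Qw tT.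
  have h3 : k t * (1 + enorm p) * enorm (y v t - y w t) <= rho j.+1 t * (1 + enorm p).
    rewrite enormB /rho mulrAC; apply: ler_wpM2r; first by rewrite addr_ge0// enorm_ge0.
    by rewrite [leRHS]mulrCA; exact: ler_wpM2l.
  exact: absorb_slack h0 (le_trans (ler_norm _) (le_trans h1 h3)).
have P0 : P 0%N v0.
  by split=> // t tT p; have := sv0 t tT p; rewrite /rr big_ord0 addr0.
(* Dependent choice: each iterate travels with its invariant, which licenses the choice of the next
   one. *)
pose F j (v : {v | P j v}) := cid (step j (sval v) (svalP v)).
pose U := nat_rect (fun j => {v | P j v}) (exist _ v0 P0)
  (fun j s => exist _ (sval (F j s)) (proj1 (svalP (F j s)))).
pose u j := sval (U j).
have uP j : P j (u j) := svalP (U j).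
have uQ j : Q j (u j) (u j.+1) := proj2 (svalP (F j (U j))).
have u0 : u 0%N = v0 by [].
clearbody u; clear U F.
(* An integrable function with [rho j <= ct * 2^-j] for all [j]; the factor 2 makes up for the index
   shift in [rho]. *)
pose ct t := rho0 t + 2 * e * (k t * W t).
have cti : intg t0 T ct by apply: intgD => //; exact: intgZ.
have ct0 t : t0 <= t <= T -> 0 <= ct t.
  by move=> tT; rewrite addr_ge0 ?rho00// mulr_ge0 ?kW0// mulr_ge0.
have rhoct j t : t0 <= t <= T -> rho j t <= ct t * 2^-1 ^+ j.
  move=> tT; have h1 := kW0 t tT; have h2 := rho00 t tT; rewrite /ct.
  case: j => [|j] /=; first by rewrite expr0 mulr1 lerDl mulr_ge0// mulr_ge0.
  rewrite exprS; have := mulr_ge0 h2 (hp j); lra.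
pose v t : 'rV[R]_n := \row_i limn (fun j => u j t 0 i).
have lim t i : t0 <= t <= T -> (fun j => u j t 0 i) @ \oo --> v t 0 i /\
    forall j, `|u j t 0 i - v t 0 i| <= 2 * ct t * 2^-1 ^+ j.
  move=> tT; rewrite mxE; apply: geometric_limit; first exact: ct0.
  move=> j; apply: le_trans (rhoct j t tT); apply: le_trans ((uQ j).1 t tT).
  by have := ler_coord_enorm (u j.+1 t - u j t) i; rewrite !mxE.
have uv j t : t0 <= t <= T -> enorm (u j t - v t) <= n%:R * (2 * ct t) * 2^-1 ^+ j.
  move=> tT; apply: le_trans (ler_enorm_sum _) _.
  apply: (@le_trans _ _ (\sum_(i < n) 2 * ct t * 2^-1 ^+ j)).
    by apply: ler_sum => i _; rewrite mxE [(- v t) _ _]mxE; have [_] := lim t i tT.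
  by rewrite sumr_const card_ord -[_ *+ n]mulr_natl mulrA.
clearbody v; have ui j : vintg t0 T (u j) by have [] := uP j.
have vi : vintg t0 T v.
  move=> i; apply: (@intg_le _ _ _ _ (fun t => `|u 0%N t 0 i| + 2 * ct t)).
  - apply: (measurable_fun_cvg (fun j => intg_meas (ui j i))) => t /=; rewrite in_itv/= => tT.
    by have [] := lim t i tT.
  - move=> t tT; have [_ /(_ 0%N)] := lim t i tT; rewrite expr0 mulr1 distrC => h.
    by rewrite -lerBlDl (le_trans (lerB_dist _ _))// h.
  - by apply: intgD; [apply: intg_norm; exact: ui|exact: intgZ].
pose C := Int t0 T (fun t => n%:R * (2 * ct t)).
have yuv j t : t0 <= t <= T -> enorm (y (u j) t - y v t) <= C * 2^-1 ^+ j.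
  move=> tT; have /andP[at_ tb] := tT; apply: le_trans (arc_dist x0 tT (ui j) vi) _.
  have i1 : intg t0 T (fun t => n%:R * (2 * ct t)) by apply: intgZ; exact: intgZ.
  have i2 : intg t0 T (fun s => enorm (u j s - v s)) by apply: intg_enorm; exact: vintgB.
  apply: (@le_trans _ _ (Int t0 T (fun s => enorm (u j s - v s)))).
    by apply: Int_mono => // s; exact: enorm_ge0.
  rewrite mulrC -IntZ//; apply: le_Int => //; first exact: intgZ.
  by move=> s sT; rewrite mulrC; exact: uv.
have vE t : t0 <= t <= T -> 1 + enorm (y v t) <= 2 * (1 + enorm x0) * E t.
  move=> tT; apply: (@le_of_geometric _ _ C) => j.
  have [_ /(_ t tT) uE _] := uP j; have h := yuv j t tT.
  have := ler_enormD (y v t - y (u j) t) (y (u j) t); rewrite subrK enormB => h'.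
  rewrite [leRHS]addrC; apply: le_trans (lerD h uE).
  by rewrite addrCA lerD2l.
(* The limit cost collects all corrections, the factor 2 being the sum of the geometric series; by
   [kW] its integral exceeds that of [r0] by at most [(1 + Wb) * e]. *)
exists v, (fun t => r0 t + rho0 t + 2 * e * (k t * W t)); split.
- exact: vi.
- by apply: intgD; [exact: intgD|exact: intgZ].
- move=> t tT p.
  have p0 := enorm_ge0 p.
  apply: (@le_of_geometric _ _ (enorm p * (n%:R * (2 * ct t)) + k t * (1 + enorm p) * C)) => j.
  have h1 := (uQ j).2 t tT p.
  have h2 : rr j.+1 t <= r0 t + rho0 t + 2 * e * (k t * W t).
    rewrite /rr big_ord_recl/= addrA lerD2l.
    have -> : \sum_(i < j) e * 2^-1 ^+ i * (k t * W t) = (\sum_(i < j) 2^-1 ^+ i) * (e * (k t * W t)).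
      by rewrite mulr_suml; apply: eq_bigr => i _; ring.
    rewrite -mulrA; apply: ler_wpM2r; first by rewrite mulr_ge0// kW0.
    exact/ltW/geom_sum_lt2.
  have [_ uE _] := uP j.
  have h3 := lcH tT p (yM _ t tT (uE t tT)) (yM _ t tT (vE t tT)).
  have h4 := ler_wpM2l (mulr_ge0 (k0 t) (addr_ge0 ler01 p0)) (yuv j t tT).
  have h5 := ler_norm (H t (y (u j) t) p - H t (y v t) p).
  have h6 : dotv p (v t) - dotv p (u j.+1 t) <= enorm p * (n%:R * (2 * ct t)) * 2^-1 ^+ j.
    rewrite -dotvBr; apply: le_trans (ler_dotv _ _) _; rewrite -mulrA; apply: ler_wpM2l => //.
    rewrite enormB; apply: le_trans (uv j.+1 t tT) _.
    apply: ler_wpM2l; first by rewrite mulr_ge0// mulr_ge0// ct0.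
    by rewrite exprS ler_piMl// invf_le1// ler1n.
  lra.
- move=> t tT; have /andP[w1 wb] := W1 tT.
  have H1 j : enorm (y (u j) t - y v0 t) <= e * W t * \sum_(i < j) 2^-1 ^+ i.
    elim: j => [|j IH]; first by rewrite u0 subrr enorm0 big_ord0 mulr0.
    rewrite big_ord_recr/= mulrDr [leRHS]addrC.
    apply: le_trans (ler_enorm_triangle _ (y (u j) t) _) (lerD _ IH).
    by rewrite mulrAC; exact: yQ (uQ j) tT.
  apply: (@le_of_geometric _ _ C) => j.
  have w0 : 0 <= W t by exact: le_trans w1.
  apply: le_trans (ler_enorm_triangle _ (y (u j) t) _) _.
  rewrite addrC; apply: lerD; last by rewrite enormB; exact: yuv.
  apply: le_trans (H1 j) _.
  apply: le_trans (ler_wpM2l (mulr_ge0 e0 w0) (ltW (@geom_sum_lt2 R j))) _.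
  by rewrite mulrC -mulrA; apply: ler_wpM2l => //; rewrite mulrC; exact: ler_wpM2r.
- rewrite IntD; [|exact: intgD|exact: intgZ]; rewrite IntD// IntZ//.
  have := ler_wpM2l e0 (kW TT); have /andP[_ wb] := W1 TT; have := ler_wpM2l e0 wb.
  rewrite -/e; lra.
Qed.

End Filippov.

(** * Steiner points *)

Section SphereMeasure.
Context {R : realType} {m : nat}.
Variable mu : {measure set (@RvB R m) -> \bar R}.
Hypothesis muS : is_sphere_measure mu.
Local Notation S := (@usphere R m : set (RvB m)).
Implicit Types (f g : 'rV[R]_m -> R) (p q : 'rV[R]_m).

Lemma continuous_RvB (D : set (@RvB R m)) f : measurable D -> continuous f ->
  measurable_fun D (f : RvB m -> R).
Proof.
move=> mD /continuousP cf; apply: (measurability _ (RGenOInfty.measurableE R)).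
move=> _ [_ [r ->] <-]; apply: measurableI => //.
by apply: sub_sigma_algebra; apply: cf; exact: interval_open.
Qed.

Lemma measurable_usphere : measurable S.
Proof.
have := @continuous_RvB setT (@enorm R m) measurableT (@continuous_enorm R m) measurableT _ (measurable_set1 1).
by rewrite setTI.
Qed.

Lemma mu_usphere : mu S = 1%E.
Proof.
have [mu1 mu0 _] := muS; rewrite -mu1 -(setvU S) measureU//.
- by rewrite [X in (X + _)%E](_ : _ = 0%E) ?add0e//; exact: mu0.
- by apply: measurableC; exact: measurable_usphere.
- exact: measurable_usphere.
- by rewrite setICl.
Qed.

Definition SInt f : R := fine (\int[mu]_(p in S) (f p)%:E)%E.

Lemma sphere_integrable f : continuous f -> (exists M, forall p, enorm p = 1 -> `|f p| <= M) ->
  mu.-integrable S (fun p : RvB m => (f p)%:E).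
Proof.
move=> cf [M fM]; apply: measurable_bounded_integrable.
- exact: measurable_usphere.
- by rewrite mu_usphere ltry.
- by apply: continuous_RvB => //; exact: measurable_usphere.
- exists M; split; first exact: num_real.
  by move=> x Mx p Sp /=; rewrite (le_trans (fM p Sp))// ltW.
Qed.

Lemma SIntD f g : mu.-integrable S (fun p : RvB m => (f p)%:E) ->
  mu.-integrable S (fun p : RvB m => (g p)%:E) ->
  SInt (fun p => f p + g p) = SInt f + SInt g.
Proof. by move=> fi gi; exact: (RintegralD measurable_usphere fi gi). Qed.

Lemma SIntZ a f : mu.-integrable S (fun p : RvB m => (f p)%:E) ->
  SInt (fun p => a * f p) = a * SInt f.
Proof. by move=> fi; exact: (RintegralZl a measurable_usphere fi). Qed.

Lemma eq_SInt f g : (forall p, enorm p = 1 -> f p = g p) -> SInt f = SInt g.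
Proof. by move=> fg; congr fine; apply: eq_integral => p; rewrite inE => /fg ->. Qed.

Lemma le_SInt f g : mu.-integrable S (fun p : RvB m => (f p)%:E) ->
  mu.-integrable S (fun p : RvB m => (g p)%:E) ->
  (forall p, enorm p = 1 -> f p <= g p) -> SInt f <= SInt g.
Proof. by move=> fi gi fg; exact: (le_Rintegral measurable_usphere fi gi fg). Qed.

Lemma SInt_sum (I : Type) (s : seq I) (F : I -> 'rV[R]_m -> R) :
  (forall i, mu.-integrable S (fun p : RvB m => (F i p)%:E)) ->
  SInt (fun p => \sum_(i <- s) F i p) = \sum_(i <- s) SInt (F i).
Proof.
move=> Fi; elim: s => [|i s IH].
  rewrite big_nil (_ : SInt _ = SInt (fun=> 0)); last by apply: eq_SInt => p _; rewrite big_nil.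
  by rewrite /SInt integral0.
rewrite big_cons -IH -SIntD//.
  by apply: eq_SInt => p _; rewrite big_cons.
have := integrable_sum measurable_usphere s (P := xpredT) (fun i _ => Fi i).
by apply: eq_integrable => //; [exact: measurable_usphere|move=> p _; rewrite sumEFin].
Qed.

Lemma orthogonal_dotv (Q : 'M[R]_m) p q : orthogonal_mx Q -> dotv (p *m Q) (q *m Q) = dotv p q.
Proof.
move=> QQ; have dE (u v : 'rV[R]_m) : dotv u v = (u *m v^T) 0 0.
  by rewrite !mxE; apply: eq_bigr => j _; rewrite !mxE.
by rewrite !dE trmx_mul -mulmxA (mulmxA Q) QQ mul1mx.
Qed.

Lemma orthogonal_enorm (Q : 'M[R]_m) p : orthogonal_mx Q -> enorm (p *m Q) = enorm p.
Proof. by move=> oQ; rewrite /enorm orthogonal_dotv. Qed.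

Lemma continuous_mulmx (Q : 'M[R]_m) : continuous (fun p : 'rV[R]_m => p *m Q).
Proof.
move=> p; have nF := @nbhs_filter _ p.
apply/(@cvgrPdist_lt _ _ _ (nbhs p) nF) => e e0.
pose L := \sum_i \sum_j `|Q i j|.
have L0 : 0 <= L by apply: sumr_ge0 => i _; apply: sumr_ge0.
have L1 : 0 < L + 1 by rewrite ltr_wpDl.
apply: filterS (nbhsx_ballx p _ (divr_gt0 e0 L1)) => q; rewrite -ball_normE/= => pq.
rewrite -mulmxBl.
apply: (@le_lt_trans _ _ (L * `|p - q|)); last first.
  apply: (@le_lt_trans _ _ ((L + 1) * `|p - q|)); first by rewrite ler_wpM2r// lerDl.
  by rewrite mulrC -ltr_pdivlMr.
rewrite [leLHS]mx_normrE; apply: bigmax_le; first by rewrite mulr_ge0.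
move=> [i j] _ /=; rewrite mxE; apply: le_trans (ler_norm_sum _ _ _) _.
rewrite mulr_suml; apply: ler_sum => l _.
rewrite normrM mulrC ler_pM//; last by rewrite [leRHS]mx_normrE; exact: (le_bigmax _ _ (i, l)).
by rewrite (bigD1 j)//= lerDl sumr_ge0.
Qed.

Lemma SInt_orthogonal (Q : 'M[R]_m) f : orthogonal_mx Q -> continuous f ->
  (exists M, forall p, enorm p = 1 -> `|f p| <= M) ->
  SInt (fun p => f (p *m Q)) = SInt f.
Proof.
move=> oQ cf bf; have [_ _ /(_ Q oQ) inv] := muS.
pose phi (p : RvB m) : RvB m := (p : 'rV[R]_m) *m Q.
have mphi : measurable_fun setT phi.
  apply: (measurability (@open 'rV[R]_m : set (set (RvB m))) (erefl _)).
  move=> _ [U oU <-]; rewrite setTI; apply: sub_sigma_algebra.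
  by have /continuousP := @continuous_mulmx Q; exact.
have Sphi : phi @^-1` S = S.
  by apply/seteqP; split => p /=; rewrite /usphere /mkset /phi orthogonal_enorm.
congr fine.
have mf : measurable_fun setT (fun p : RvB m => (f p)%:E).
  by apply/measurable_EFinP; exact: continuous_RvB.
have fi : mu.-integrable (phi @^-1` S) ((fun p : RvB m => (f p)%:E) \o phi).
  rewrite Sphi; apply: (@sphere_integrable (fun p => f (p *m Q))).
    by move=> p; apply: continuous_comp; [exact: continuous_mulmx|exact: cf].
  have [M fM] := bf; exists M => p p1; apply: fM; by rewrite orthogonal_enorm.
transitivity (\int[pushforward mu phi]_(p in S) (f p)%:E)%E.
  by rewrite (integral_pushforward mphi mf fi measurable_usphere) Sphi.
apply: eq_measure_integral => A mA _; exact: inv.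
Qed.

End SphereMeasure.

Lemma enorm_lip_continuous (R : realType) (m : nat) (f : 'rV[R]_m -> R) (B : R) : 0 <= B ->
  (forall p q, `|f p - f q| <= B * enorm (p - q)) -> continuous f.
Proof.
move=> B0 fB p; have nF := @nbhs_filter _ p.
apply/(@cvgrPdist_lt _ _ _ (nbhs p) nF) => e e0.
have B1 : 0 < (B + 1) * (m%:R + 1) by rewrite mulr_gt0// ltr_wpDl.
apply: filterS (nbhsx_ballx p _ (divr_gt0 e0 B1)) => q; rewrite -ball_normE/= ltr_pdivlMr// => pq.
apply: le_lt_trans pq; apply: le_trans (fB p q) _.
apply: (@le_trans _ _ ((B + 1) * ((m%:R + 1) * `|p - q|))); last first.
  by rewrite mulrA [leRHS]mulrC.
apply: ler_pM => //; [exact: enorm_ge0|by rewrite lerDl|].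
apply: le_trans (ler_enorm_norm _) _; apply: ler_wpM2r => //.
by rewrite lerDl.
Qed.

Section Steiner.
Context {R : realType} {m : nat}.
Variable mu : {measure set (@RvB R m) -> \bar R}.
Hypothesis muS : is_sphere_measure mu.
Local Notation S := (@usphere R m : set (RvB m)).
Local Notation SI := (SInt mu).
Implicit Types (p q : 'rV[R]_m) (K : set 'rV[R]_m).

Lemma continuous_coord (j : 'I_m) : continuous (fun p : 'rV[R]_m => p 0 j).
Proof.
move=> p; have := @continuous_dotv R m (delta_mx 0 j) p.
have -> : dotv (delta_mx 0 j) = (fun p : 'rV[R]_m => p 0 j) => //.
apply/funext => u; rewrite /dotv (bigD1 j)//= mxE !eqxx mul1r big1 ?addr0// => i ij.
by rewrite mxE (negPf ij) andbF mul0r.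
Qed.

Lemma coord_prod_cont (i j : 'I_m) : continuous (fun p : 'rV[R]_m => p 0 i * p 0 j).
Proof.
move=> p; apply: (@continuousM R 'rV[R]_m (fun p => p 0 i) (fun p => p 0 j) p); exact: continuous_coord.
Qed.

Lemma coord_prod_bound (i j : 'I_m) : exists M, forall p, enorm p = 1 -> `|p 0 i * p 0 j| <= M.
Proof.
exists 1 => p p1; rewrite normrM -[1]mulr1.
by apply: ler_pM => //; rewrite -p1; exact: ler_coord_enorm.
Qed.

(** Changing the sign of the [i]-th coordinate preserves the measure and negates the integrand. *)
Lemma moment_offdiag (i j : 'I_m) : i != j -> SI (fun p => p 0 i * p 0 j) = 0.
Proof.
move=> ij; pose Q : 'M[R]_m := diag_mx (\row_l (if l == i then -1 else 1)).
have oQ : orthogonal_mx Q.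
  rewrite /orthogonal_mx /Q tr_diag_mx mulmx_diag; apply/matrixP => a b; rewrite !mxE.
  by case: (b =P i) => ?; case: (a =P i) => ?; rewrite ?mulrNN ?mulr1.
have Qp p l : (p *m Q) 0 l = p 0 l * (if l == i then -1 else 1).
  by rewrite /Q mul_mx_diag !mxE.
have := SInt_orthogonal muS oQ (@coord_prod_cont i j) (coord_prod_bound i j).
rewrite (_ : SI (fun p => _) = - 1 * SI (fun p => p 0 i * p 0 j)).
  by move=> h; lra.
rewrite -SIntZ//.
  apply: eq_SInt => p _; rewrite !Qp eqxx eq_sym (negPf ij); ring.
by apply: sphere_integrable => //; [exact: coord_prod_cont|exact: coord_prod_bound].
Qed.

(** Transpositions of coordinates make all these moments equal, and together they integrate
    [|p|^2 = 1]. *)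
Lemma moment_diag (i : 'I_m) : m%:R * SI (fun p => p 0 i * p 0 i) = 1.
Proof.
have eqd j : SI (fun p => p 0 j * p 0 j) = SI (fun p => p 0 i * p 0 i).
  have oQ : orthogonal_mx (tperm_mx i j : 'M[R]_m).
    by rewrite /orthogonal_mx tr_tperm_mx -perm_mxM perm.tperm2 perm_mx1.
  have := SInt_orthogonal muS oQ (@coord_prod_cont i i) (coord_prod_bound i i) => <-.
  apply: eq_SInt => p _; rewrite -xcolE !mxE perm.tpermL//.
transitivity (SI (fun p => \sum_j p 0 j * p 0 j)).
  rewrite SInt_sum//; last first.
    by move=> j; apply: sphere_integrable => //; [exact: coord_prod_cont|exact: coord_prod_bound].
  by rewrite (eq_bigr _ (fun j _ => eqd j)) sumr_const card_ord mulr_natl.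
transitivity (SI (fun=> 1)).
  by apply: eq_SInt => p p1; rewrite -[RHS](expr1n _ 2) -p1 enorm_sqr.
by rewrite /SInt integral_cst ?mu_usphere ?mul1e//; exact: measurable_usphere.
Qed.

(** The second moment matrix of the sphere is the identity divided by [m], which is what the factor
    [m] in the Steiner point compensates. *)
Lemma moment_dotv q r : m%:R * SI (fun p => dotv q p * dotv r p) = dotv q r.
Proof.
have int i j : mu.-integrable S (fun p : RvB m => ((p : 'rV[R]_m) 0 i * (p : 'rV[R]_m) 0 j)%:E).
  by apply: sphere_integrable => //; [exact: coord_prod_cont|exact: coord_prod_bound].
have intZ a i j : mu.-integrable S (fun p : RvB m => (a * ((p : 'rV[R]_m) 0 i * (p : 'rV[R]_m) 0 j))%:E).
  exact: (integrableZl (measurable_usphere) a (int i j)).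
have intS a i : mu.-integrable S (fun p : RvB m => (\sum_j a j * ((p : 'rV[R]_m) 0 i * (p : 'rV[R]_m) 0 j))%:E).
  have := integrable_sum measurable_usphere (index_enum 'I_m) (P := xpredT) (fun j _ => intZ (a j) i j).
  by apply: eq_integrable => //; [exact: measurable_usphere|move=> p _; rewrite sumEFin].
rewrite (_ : SI _ = SI (fun p => \sum_i \sum_j (q 0 i * r 0 j) * (p 0 i * p 0 j))); last first.
  apply: eq_SInt => p _; rewrite /dotv mulr_suml; apply: eq_bigr => i _.
  by rewrite mulr_sumr; apply: eq_bigr => j _; ring.
rewrite (SInt_sum _ (fun i => intS (fun j => q 0 i * r 0 j) i)) mulr_sumr.
apply: eq_bigr => i _; rewrite (SInt_sum _ (fun j => intZ (q 0 i * r 0 j) i j)).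
rewrite (bigD1 i)//= big1 ?addr0.
  rewrite SIntZ//; have := moment_diag i => h.
  by rewrite mulrCA h mulr1.
by move=> j ji; rewrite SIntZ// moment_offdiag ?mulr0// eq_sym.
Qed.

Lemma supp_fun_set1 (a p : 'rV[R]_m) : supp_fun [set a] p = dotv p a.
Proof. by rewrite /supp_fun image_set1 sup1. Qed.

Lemma steiner_set1 (a : 'rV[R]_m) : steiner_point mu [set a] = a.
Proof.
apply/rowP => j; rewrite mxE -[X in _ * X]/(SI (fun p => p 0 j * supp_fun [set a] p)).
have -> : SI (fun p => p 0 j * supp_fun [set a] p) = SI (fun p => dotv (delta_mx 0 j) p * dotv a p).
  apply: eq_SInt => p _; rewrite supp_fun_set1 dotvC; congr (_ * _).
  rewrite /dotv (bigD1 j)//= mxE !eqxx mul1r big1 ?addr0// => i ij.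
  by rewrite mxE (negPf ij) andbF mul0r.
rewrite moment_dotv /dotv (bigD1 j)//= mxE !eqxx mul1r big1 ?addr0// => i ij.
by rewrite mxE (negPf ij) andbF mul0r.
Qed.

Section SupportFunction.
Variables (K : set 'rV[R]_m) (B : R).
Hypothesis K0 : K !=set0.
Hypothesis KB : forall y, K y -> enorm y <= B.
Local Notation h := (supp_fun K).

Lemma B_ge0 : 0 <= B.
Proof. by have [y Ky] := K0; exact: le_trans (enorm_ge0 y) (KB Ky). Qed.

Lemma supp_ub p y : K y -> dotv p y <= h p.
Proof.
move=> Ky; apply: ub_le_sup; last by exists y.
exists (enorm p * B) => _ [z Kz <-]; apply: le_trans (ler_dotv _ _) _.
by apply: ler_wpM2l; [exact: enorm_ge0|exact: KB].
Qed.

Lemma supp_le p b : (forall y, K y -> dotv p y <= b) -> h p <= b.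
Proof.
move=> Kb; apply: ge_sup; first by have [y Ky] := K0; exists (dotv p y), y.
by move=> _ [y Ky <-]; exact: Kb.
Qed.

Lemma suppD p q (a : R) : 0 <= a -> h (p + a *: q) <= h p + a * h q.
Proof.
move=> a0; apply: supp_le => y Ky; rewrite dotvDl dotvZl.
by apply: lerD; [exact: supp_ub|apply: ler_wpM2l => //; exact: supp_ub].
Qed.

Lemma supp_lip p q : h p - h q <= B * enorm (p - q).
Proof.
rewrite lerBlDl; apply: supp_le => y Ky.
rewrite -[p in dotv p](subrK q) dotvDl addrC; apply: lerD; first exact: supp_ub.
apply: le_trans (ler_dotv _ _) _; rewrite mulrC.
by apply: ler_wpM2r; [exact: enorm_ge0|exact: KB].
Qed.

Lemma supp_dist p q : `|h p - h q| <= B * enorm (p - q).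
Proof. by rewrite ler_norml supp_lip andbT lerNl opprB enormB supp_lip. Qed.

Lemma supp_continuous : continuous h.
Proof. exact: enorm_lip_continuous B_ge0 supp_dist. Qed.

Lemma supp0 : h 0 = 0.
Proof.
apply/eqP; rewrite eq_le supp_le ?andTb; last by move=> y _; rewrite dot0v.
by have [y Ky] := K0; have := supp_ub 0 Ky; rewrite dot0v.
Qed.

Lemma supp_bound p : `|h p| <= B * enorm p.
Proof. by have := supp_dist p 0; rewrite supp0 !subr0. Qed.

Lemma supp_mul_integrable q (Q : 'M[R]_m) : orthogonal_mx Q ->
  mu.-integrable S (fun p : RvB m => (dotv q p * h ((p : 'rV[R]_m) *m Q))%:E).
Proof.
move=> oQ; apply: (@sphere_integrable _ _ _ muS (fun p => dotv q p * h (p *m Q))).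
  move=> p; apply: (@continuousM R 'rV[R]_m (dotv q) (fun p => h (p *m Q)) p).
    exact: continuous_dotv.
  by apply: continuous_comp; [exact: continuous_mulmx|exact: supp_continuous].
exists (enorm q * B) => p p1; rewrite normrM; apply: ler_pM => //.
  by apply: le_trans (ler_norm_dotv _ _) _; rewrite p1 mulr1.
by apply: le_trans (supp_bound _) _; rewrite orthogonal_enorm// p1 mulr1.
Qed.

Definition reflection q : 'M[R]_m := 1%:M - 2 *: (q^T *m q).

Lemma reflectionE q p : p *m reflection q = p - (2 * dotv q p) *: q.
Proof.
rewrite /reflection mulmxBr mulmx1 -scalemxAr mulmxA -scalerA; congr (_ - _ *: _).
have -> : p *m q^T = (dotv q p)%:M; last exact: mul_scalar_mx.
apply/matrixP => i j; rewrite !ord1 !mxE eqxx mulr1n.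
by apply: eq_bigr => l _; rewrite !mxE mulrC.
Qed.

Lemma reflection_orthogonal q : enorm q = 1 -> orthogonal_mx (reflection q).
Proof.
move=> q1; rewrite /orthogonal_mx.
have -> : (reflection q)^T = reflection q.
  by rewrite /reflection linearB/= linearZ/= trmx1 trmx_mul trmxK.
apply/row_matrixP => i; rewrite row_mul [row i (reflection q)]rowE reflectionE reflectionE.
rewrite dotvBr dotvZr -enorm_sqr q1 row1; set t := dotv q _.
by rewrite -addrA -opprD -scalerDl (_ : 2 * t + _ = 0) ?scale0r ?subr0//; ring.
Qed.

(* Reflecting in the hyperplane orthogonal to [q] folds the integral defining
   [dotv q (steiner_point mu K)] onto [2 (q.p)^2 h(q)]. *)
Lemma steiner_unit_halfspace q : enorm q = 1 -> dotv q (steiner_point mu K) <= h q.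
Proof.
move=> q1; have oQ := reflection_orthogonal q1; set Q := reflection q in oQ.
have o1 : orthogonal_mx (1%:M : 'M[R]_m) by rewrite /orthogonal_mx trmx1 mulmx1.
have int1 r : mu.-integrable S (fun p : RvB m => (dotv r p * h p)%:E).
  by have := supp_mul_integrable r o1; apply: eq_integrable; [exact: measurable_usphere|move=> p _; rewrite mulmx1].
have intQ := supp_mul_integrable q oQ.
have sE : dotv q (steiner_point mu K) = m%:R * SI (fun p => dotv q p * h p).
  rewrite (_ : SI _ = \sum_j q 0 j * SI (fun p => p 0 j * h p)).
    rewrite mulr_sumr; apply: eq_bigr => j _; rewrite mxE mulrCA; congr (_ * (_ * _)).
  have dj j (p : 'rV[R]_m) : p 0 j = dotv (delta_mx 0 j) p.
    rewrite /dotv (bigD1 j)//= mxE !eqxx mul1r big1 ?addr0// => i ij.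
    by rewrite mxE (negPf ij) andbF mul0r.
  have intj j : mu.-integrable S (fun p : RvB m => ((p : 'rV[R]_m) 0 j * h p)%:E).
    by apply: eq_integrable (int1 (delta_mx 0 j)); [exact: measurable_usphere|move=> p _; rewrite -dj].
  rewrite (eq_bigr (fun j => SI (fun p => q 0 j * (p 0 j * h p)))); last by move=> j _; rewrite SIntZ.
  rewrite -SInt_sum; last by move=> j; exact: (integrableZl measurable_usphere (q 0 j) (intj j)).
  by apply: eq_SInt => p _; rewrite /dotv mulr_suml; apply: eq_bigr => j _; rewrite mulrA.
have dQ p : dotv q (p *m Q) = - dotv q p.
  by rewrite reflectionE dotvBr dotvZr -enorm_sqr q1; ring.
have refl : SI (fun p => dotv q p * h p) = - SI (fun p => dotv q p * h (p *m Q)).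
  have cqh : continuous (fun p : 'rV[R]_m => dotv q p * h p).
    move=> p; apply: (@continuousM R 'rV[R]_m (dotv q) h p); [exact: continuous_dotv|exact: supp_continuous].
  have bqh : exists M, forall p, enorm p = 1 -> `|dotv q p * h p| <= M.
    exists (enorm q * B) => p p1; rewrite normrM; apply: ler_pM => //.
      by apply: le_trans (ler_norm_dotv _ _) _; rewrite p1 mulr1.
    by apply: le_trans (supp_bound _) _; rewrite p1 mulr1.
  rewrite -(SInt_orthogonal muS oQ cqh bqh) -mulN1r -SIntZ//.
  by apply: eq_SInt => p _; rewrite dQ; ring.
have int22 : mu.-integrable S (fun p : RvB m => (dotv q p * dotv q p)%:E).
  apply: (@sphere_integrable _ _ _ muS (fun p => dotv q p * dotv q p)).
    move=> p; apply: (@continuousM R 'rV[R]_m (dotv q) (dotv q) p); exact: continuous_dotv.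
  by exists (1 * 1) => p p1; rewrite normrM; apply: ler_pM => //; apply: le_trans (ler_norm_dotv _ _) _;
    rewrite p1 q1 mulr1.
have int2 : mu.-integrable S (fun p : RvB m => (2 * h q * (dotv q p * dotv q p))%:E).
  exact: (integrableZl measurable_usphere (2 * h q) int22).
have intN : mu.-integrable S (fun p : RvB m => (- 1 * (dotv q p * h ((p : 'rV[R]_m) *m Q)))%:E).
  exact: (integrableZl measurable_usphere (-1) intQ).
have int3 : mu.-integrable S (fun p : RvB m => (dotv q p * h p + - 1 * (dotv q p * h ((p : 'rV[R]_m) *m Q)))%:E).
  exact: (integrableD measurable_usphere (int1 q) intN).
have key : 2 * SI (fun p => dotv q p * h p) <= SI (fun p => 2 * h q * (dotv q p * dotv q p)).
  have -> : 2 * SI (fun p => dotv q p * h p) =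
      SI (fun p => dotv q p * h p + - 1 * (dotv q p * h (p *m Q))).
    by rewrite SIntD// SIntZ//; have := refl; move: (SI _) (SI _) => X Y ->; ring.
  apply: le_SInt => // p p1; rewrite reflectionE.
  (* A point and its reflection differ by [2 t q]. For [t >= 0] the support function at [p] is
     bounded by the one at the reflection, for [t < 0] the other way round; multiplying by [|t|]
     gives the same inequality. *)
  set t := dotv q p; have [t0|t0] := leP 0 t.
    have h1 := suppD (p - (2 * t) *: q) q (mulr_ge0 (ler0n R 2) t0).
    rewrite subrK in h1; have := ler_wpM2l t0 h1; lra.
  have nt0 : 0 <= - (2 * t) by lra.
  have h1 := suppD p q nt0.
  rewrite scaleNr in h1; have nt1 : 0 <= - t by lra.
  have := ler_wpM2l nt1 h1; lra.
move: key; rewrite SIntZ; last exact: int22.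
move=> /(ler_wpM2l (ler0n R m)).
have := moment_dotv q q; rewrite -enorm_sqr q1 expr1n sE.
move: (SI _) (SI _) => X Y e1; rewrite mulrCA -[leRHS]mulrCA.
rewrite [m%:R * Y]e1; lra.
Qed.

Lemma steiner_halfspace q b : (forall y, K y -> dotv q y <= b) -> dotv q (steiner_point mu K) <= b.
Proof.
move=> qb; have [q00|q0] := eqVneq q 0.
  by have [y Ky] := K0; have := qb y Ky; rewrite q00 !dot0v.
have qp : 0 < enorm q by rewrite lt_neqAle eq_sym enorm_eq0 q0 enorm_ge0.
have u1 : enorm ((enorm q)^-1 *: q) = 1.
  by rewrite enormZ gtr0_norm ?invr_gt0// mulVf// gt_eqF.
have := steiner_unit_halfspace u1; rewrite dotvZl.
have : h ((enorm q)^-1 *: q) <= (enorm q)^-1 * b.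
  by apply: supp_le => y Ky; rewrite dotvZl ler_pM2l ?invr_gt0// qb.
move=> h1 h2; have := le_trans h2 h1.
by rewrite ler_pM2l ?invr_gt0.
Qed.

End SupportFunction.

End Steiner.

(** * The epigraph of the conjugate and its Steiner selection *)

Section Epigraph.
Context {R : realType} {n : nat}.
Variables (H : @Ham R n) (t : R) (x : 'rV[R]_n).
Implicit Types (w a : 'rV[R]_(n + 1)) (p : 'rV[R]_n).
Local Notation E := (epiH H t x).

Lemma epiHP w : E w <-> forall p, dotv p (lsubmx w) <= H t x p + rsubmx w 0 0.
Proof.
rewrite /epiH /= /Hstar; split => [Ew p|Ew].
  have : ((dotv (lsubmx w) p - H t x p)%:E <= (rsubmx w 0 0)%:E)%E.
    by apply: le_trans Ew; apply: ereal_sup_ubound; exists p.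
  rewrite lee_fin dotvC; lra.
apply: ge_ereal_sup => _ [p _ <-]; rewrite lee_fin dotvC; have := Ew p; lra.
Qed.

Lemma dotv_row_mx p (s : R) w :
  dotv (row_mx p (const_mx s)) w = dotv p (lsubmx w) + s * rsubmx w 0 0.
Proof.
rewrite /dotv big_split_ord/=; congr (_ + _).
  by apply: eq_bigr => j _; rewrite row_mxEl mxE.
by rewrite big_ord1 row_mxEr !mxE.
Qed.

(** This presentation as an intersection of closed half-spaces serves twice: for closedness, and for
    membership of Steiner points through [steiner_halfspace]. *)
Lemma epiH_halfspace w : E w <-> forall p, dotv (row_mx p (const_mx (-1))) w <= H t x p.
Proof.
rewrite epiHP; split => h p; have := h p; rewrite dotv_row_mx; lra.
Qed.

Variable L : R.
Hypothesis L0 : 0 <= L.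
Hypothesis convH : forall p q (lam : R), 0 <= lam <= 1 ->
  H t x (lam *: p + (1 - lam) *: q) <= lam * H t x p + (1 - lam) * H t x q.
Hypothesis lipH : forall p q, `|H t x p - H t x q| <= L * enorm (p - q).

Lemma Hamiltonian_continuous : continuous (H t x).
Proof. exact: enorm_lip_continuous L0 lipH. Qed.

(** A subgradient of [H t x] at 0 with cost [- H t x 0] is a point of the epigraph. It comes from
    [measurable_selection] with constant data: by the Lipschitz bound, [v = 0] has slack [L]. *)
Lemma epiH_neq0 : E !=set0.
Proof.
have [w [_ _ wH]] := @measurable_selection R n _ (@LebT R) setT
  (fun=> H t x) (fun=> 0) (fun=> - H t x 0) (fun=> L)
  (fun _ _ => L0) (fun _ _ => Hamiltonian_continuous) (fun _ _ => convH)
  (fun _ _ p => ltac:(have := lipH 0 p; rewrite sub0r enormN dotv0 => h;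
     have := le_trans (ler_norm _) h; lra))
  (fun p => measurable_cst _) (fun j => measurable_cst _) (measurable_cst _) (measurable_cst _).
exists (row_mx (w 0) (const_mx (- H t x 0))); apply/epiHP => p.
by rewrite row_mxKl row_mxKr mxE; exact: wH.
Qed.

Lemma dist_set_le a w : E w -> dist_set a E <= enorm (a - w).
Proof.
by move=> Ew; apply: ge_inf; [exists 0 => _ [e _ <-]; exact: enorm_ge0|exists w].
Qed.

Lemma dist_set_ge0 a : 0 <= dist_set a E.
Proof.
apply: lb_le_inf; last by move=> _ [e _ <-]; exact: enorm_ge0.
by have [e Ee] := epiH_neq0; exists (enorm (a - e)), e.
Qed.

Lemma dist_set_adherent a (e : R) : 0 < e -> exists2 w, E w & enorm (a - w) < dist_set a E + e.
Proof.
move=> e0; have hi : has_inf [set enorm (a - w) | w in E].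
  split; first by have [w Ew] := epiH_neq0; exists (enorm (a - w)), w.
  by exists 0 => _ [w _ <-]; exact: enorm_ge0.
by have [_ [w Ew <-] h] := inf_adherent e0 hi; exists w.
Qed.

Lemma epiH_closed a : dist_set a E = 0 -> E a.
Proof.
move=> d0; apply/epiH_halfspace => p; apply/ler_addgt0Pr => e e0.
set q := row_mx _ _; have q1 : 0 < enorm q + 1 by rewrite ltr_wpDl// enorm_ge0.
have [w Ew] := dist_set_adherent a (divr_gt0 e0 q1).
rewrite d0 add0r ltr_pdivlMr// => aw.
have h1 := (epiH_halfspace w).1 Ew p; rewrite -/q in h1.
have h2 := ler_dotv q (a - w); rewrite dotvBr in h2.
have := enorm_ge0 (a - w); have : enorm (a - w) * (enorm q + 1) = enorm q * enorm (a - w) + enorm (a - w) by ring.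
lra.
Qed.

(** At positive distance the factor 2 in [PhiH] leaves room for a point that is only nearly closest;
    at distance 0 closedness puts [a] itself in the set. *)
Lemma PhiH_neq0 a : PhiH H t x a !=set0.
Proof.
have := dist_set_ge0 a; rewrite le_eqVlt => /predU1P[/esym d0|d0].
  exists a; split; first exact: epiH_closed.
  by rewrite /mkset subrr enorm0 d0 mulr0.
have [w Ew aw] := dist_set_adherent a d0.
by exists w; split => //; rewrite /mkset enormB; lra.
Qed.

Variable mu : {measure set (@RvB R (n + 1)) -> \bar R}.
Hypothesis muS : is_sphere_measure mu.

Lemma steinerFL_epiH a : E (steinerFL mu H t x a).
Proof.
apply/epiH_halfspace => p.
apply: (@steiner_halfspace R (n + 1) mu muS (PhiH H t x a) (enorm a + 2 * dist_set a E)).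
- exact: PhiH_neq0.
- move=> y [_ ya]; have := ler_enormD (y - a) a; rewrite subrK; move: ya; rewrite /mkset; lra.
- by move=> y [Ey _]; exact: ((epiH_halfspace y).1 Ey p).
Qed.

Lemma steinerFL_id a : E a -> steinerFL mu H t x a = a.
Proof.
move=> Ea; rewrite /steinerFL (_ : PhiH H t x a = [set a]); first exact: steiner_set1.
have d0 : dist_set a E = 0.
  apply/eqP; rewrite eq_le dist_set_ge0 andbT.
  by have := dist_set_le a Ea; rewrite subrr enorm0.
apply/seteqP; split => y /=; last first.
  by move=> ->; split => //; rewrite /mkset subrr enorm0 d0 mulr0.
move=> [_]; rewrite /mkset d0 mulr0 => ya.
by apply/eqP; rewrite -subr_eq0 -enorm_eq0 eq_le ya enorm_ge0.
Qed.

Lemma steiner_fl_epiH a p :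
  dotv p (steiner_f mu H t x a) <= H t x p + steiner_l mu H t x a.
Proof. exact: (epiHP _).1 (steinerFL_epiH a) p. Qed.

End Epigraph.

(** * Admissible pairs and arcs *)

Section ArcsAreAdmissible.
Context {R : realType} {n : nat}.
Implicit Types (t : R) (v : R -> 'rV[R]_n) (r : R -> R).

Lemma vInt_pt a v : vintg a a v -> vInt a a v = 0.
Proof.
move=> vi; have := vInt_chasles (lexx a) (lexx a) vi.
by move=> h; apply: (addrI (vInt a a v)); rewrite addr0 -h.
Qed.

Lemma arc_start a b x v : a <= b -> vintg a b v -> arc a b x v a = x.
Proof. by move=> ab vi; rewrite arcE ?lexx// vInt_pt ?addr0//; exact: vintgS vi. Qed.

Lemma arc_derive a b x v : vintg a b v ->
  {ae @Leb R, forall t : LebT, `[a, b]%classic t ->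
    derivable (arc a b x v) t 1 /\ derive1 (arc a b x v) t = v t}.
Proof.
move=> vi.
have H j : {ae @Leb R, forall t : LebT, `[a, b]%classic t ->
    derivable (fun s => arc a b x v s 0 j) t 1 /\ derive1 (fun s => arc a b x v s 0 j) t = v t 0 j}.
  have [N Nn HN] := FTC1_on (vi j).
  apply: negligibleS Nn => t /= nt; apply: contrapT => Nt; apply: nt; rewrite in_itv/= => tab.
  have [/andP[at_ tb] [d e]] := HN t tab Nt.
  have na : \forall s \near (t : R), a < s by exact: (open_nbhs_nbhs (conj (@open_gt R a) at_)).
  have nb : \forall s \near (t : R), s < b by exact: (open_nbhs_nbhs (conj (@open_lt R b) tb)).
  have ne : {near (t : R), (fun s => x 0 j + Int a s (fun u => v u 0 j)) =1 (fun s => arc a b x v s 0 j)}.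
    near=> s; rewrite arcE; last by apply/andP; split; apply: ltW; near: s.
    by rewrite mxE vIntE.
  have d' : derivable (fun s => x 0 j + Int a s (fun u => v u 0 j)) (t : R) 1.
    by apply: derivableD => //; exact: derivable_cst.
  split; first exact: near_eq_derivable d'.
  rewrite derive1E -(near_eq_derive _ ne) deriveD//.
  by rewrite derive_cst add0r -derive1E e.
have ff : Filter (almost_everywhere (@Leb R)) by exact: ae_filter_ringOfSetsType.
have := @filter_forall _ _
  (fun (j : 'I_n) (t : LebT) => `[a, b]%classic t ->
    derivable (fun s => arc a b x v s 0 j) t 1 /\ derive1 (fun s => arc a b x v s 0 j) t = v t 0 j) (almost_everywhere (@Leb R)) ff H.
apply: filterS => t ht tab.
have d : derivable (arc a b x v) t 1.
  by apply/derivable_mxP => i j; rewrite ord1; have [] := ht j tab.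
split=> //; rewrite derive1E derive_mx//.
apply/rowP => j; rewrite mxE; have [_] := ht j tab; by rewrite derive1E.
Unshelve. all: by end_near. Qed.

(** The pair [(v, r)] itself serves as control: along the arc it lies in the epigraph, where the
    Steiner selection is the identity. *)
Lemma value_le_arc (mu : {measure set (@RvB R (n + 1)) -> \bar R}) (H : @Ham R n)
    (c : R -> R) (g : 'rV[R]_n -> R) (t0 T : R) x0 v r :
  is_sphere_measure mu -> t0 <= T -> (forall t, 0 <= c t) ->
  (forall t, t0 <= t <= T -> forall x p q (lam : R), 0 <= lam <= 1 ->
    H t x (lam *: p + (1 - lam) *: q) <= lam * H t x p + (1 - lam) * H t x q) ->
  (forall t, t0 <= t <= T -> forall x p q,
    `|H t x p - H t x q| <= c t * (1 + enorm x) * enorm (p - q)) ->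
  vintg t0 T v -> intg t0 T r ->
  (forall t, t0 <= t <= T -> forall p, dotv p (v t) <= H t (arc t0 T x0 v t) p + r t) ->
  (value_fun g (steiner_f mu H) (steiner_l mu H) T (t0, x0) <=
    (g (arc t0 T x0 v T) + Int t0 T r)%:E)%E.
Proof.
move=> muS t0T c0 convH lipH vi ri mem.
pose a t : 'rV[R]_(n + 1) := row_mx (v t) (const_mx (r t)).
have fa t : t0 <= t <= T -> steinerFL mu H t (arc t0 T x0 v t) (a t) = a t.
  move=> tT; apply: (@steinerFL_id R n H t _ (c t * (1 + enorm (arc t0 T x0 v t)))) => //.
  - by rewrite mulr_ge0// addr_ge0// enorm_ge0.
  - exact: convH.
  - exact: lipH.
  - by apply/epiHP => p; rewrite row_mxKl row_mxKr mxE; exact: mem.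
apply: ereal_inf_lbound; exists (arc t0 T x0 v, a) => /=.
  split.
  - exact: arc_abs_cont.
  - exact: arc_start.
  - move=> j; case: (split_ordP j) => i ->.
      by apply: eq_intg (vi i) => t _; rewrite row_mxEl.
    by apply: eq_intg ri => t _; rewrite row_mxEr mxE.
  - have ff : Filter (almost_everywhere (@Leb R)) by exact: ae_filter_ringOfSetsType.
    apply: filterS (arc_derive x0 vi) => t h tT; have [d e] := h tT; split=> //.
    have tT' : t0 <= t <= T by move: tT; rewrite /= in_itv.
    by rewrite e /steiner_f (fa t tT') row_mxKl.
rewrite EFinD -IntE//; congr (_ + _)%E; apply: eq_integral => t.
by rewrite inE/= in_itv/= => tT; rewrite /steiner_l fa// row_mxKr mxE.
Qed.

End ArcsAreAdmissible.

(** * Comparison with integrals of nonmeasurable functions *)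

Section LowerIntegral.
Local Open Scope ereal_scope.
Context d (T : measurableType d) (R : realType) (mu : {measure set T -> \bar R}).

(** The integral of a nonnegative function is a supremum over the simple functions below it, so it
    is monotone even when no measurability is available. *)
Lemma ge0_le_integral_nonmeasurable (D : set T) (f g : T -> \bar R) :
  (forall t, D t -> 0 <= f t) -> (forall t, D t -> f t <= g t) ->
  \int[mu]_(t in D) f t <= \int[mu]_(t in D) g t.
Proof.
move=> f0 fg; have g0 t : D t -> 0 <= g t by move=> Dt; apply: le_trans (fg t Dt); exact: f0.
rewrite !ge0_integralE//; apply: ge_ereal_sup => _ [h hf <-].
apply: ereal_sup_ubound; exists h => // t; apply: le_trans (hf t) _.
by rewrite !patchE; case: ifPn => //; rewrite inE => /fg.
Qed.

(* [l] is not assumed measurable: its integral is then a difference of lower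
   integrals, for which monotonicity still holds. *)
Lemma le_lower_integral (D N : set T) (r l : T -> R) (phi : T -> R) :
  measurable D -> measurable N -> mu N = 0 -> measurable_fun D r ->
  mu.-integrable D (EFin \o phi) ->
  (forall t, D t -> (- phi t <= r t)%R) ->
  (forall t, D t -> N t -> r t = 0%R) ->
  (forall t, D t -> ~ N t -> (r t <= l t)%R) ->
  \int[mu]_(t in D) (l t)%:E < +oo ->
  mu.-integrable D (EFin \o r) /\ \int[mu]_(t in D) (r t)%:E <= \int[mu]_(t in D) (l t)%:E.
Proof.
move=> mD mN N0 mr phii phir rN rl lfin.
set rE := fun t => (r t)%:E; set lE := fun t => (l t)%:E.
have mrE : measurable_fun D rE by apply/measurable_EFinP.
have pos : \int[mu]_(t in D) rE^\+ t <= \int[mu]_(t in D) lE^\+ t.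
  apply: ge0_le_integral_nonmeasurable => t Dt; first exact: funepos_ge0.
  have [Nt|Nt] := pselect (N t).
    by rewrite funeposE /rE (rN t Dt Nt) maxxx funepos_ge0.
  by rewrite !funeposE ge_max le_max lee_fin rl//= le_max lexx orbT.
(* On the null set [N] nothing is known of [l], so its negative part is dominated by [+oo] there;
   [s] is measurable, and its integral does not see [N]. *)
pose s t := rE^\- t + +oo * (\1_N t)%:E.
have s0 t : 0 <= s t.
  by rewrite adde_ge0 ?funeneg_ge0// mule_ge0// lee_fin indicE.
have ms : measurable_fun D s.
  apply: emeasurable_funD; first exact: measurable_funeneg.
  apply: measurable_funeM; apply/measurable_EFinP; exact: measurable_indic.
have neg : \int[mu]_(t in D) lE^\- t <= \int[mu]_(t in D) rE^\- t.
  apply: (@le_trans _ _ (\int[mu]_(t in D) s t)).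
    apply: ge0_le_integral_nonmeasurable => t Dt; first exact: funeneg_ge0.
    have [Nt|Nt] := pselect (N t).
      by rewrite /s indicE mem_set// mule1 addey ?leey// gt_eqF// (lt_le_trans _ (funeneg_ge0 _ _)).
    rewrite /s indicE memNset// mule0 adde0 !funenegE ge_max le_max; apply/andP; split.
      by rewrite leeN2 lee_fin rl.
    by rewrite le_max lexx orbT.
  rewrite (ge0_negligible_integral mN mD ms (fun t _ => s0 t) N0).
  rewrite (ge0_negligible_integral mN mD (measurable_funeneg mrE) (fun t _ => funeneg_ge0 _ _) N0).
  apply: ge0_le_integral_nonmeasurable => // t [Dt Nt].
  by rewrite /s indicE memNset// mule0 adde0.
have rneg : \int[mu]_(t in D) rE^\- t < +oo.
  apply: (@le_lt_trans _ _ (\int[mu]_(t in D) `|(phi t)%:E|)); last by have /integrableP[] := phii.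
  apply: ge0_le_integral_nonmeasurable => t Dt; first exact: funeneg_ge0.
  rewrite funenegE ge_max abse_ge0 andbT /rE -EFinN lee_fin.
  by apply: le_trans (ler_norm _); rewrite lerNl; exact: phir.
have lneg : \int[mu]_(t in D) lE^\- t < +oo by exact: le_lt_trans rneg.
have lnegf : \int[mu]_(t in D) lE^\- t \is a fin_num.
  by rewrite ge0_fin_numE//; apply: integral_ge0 => t _; exact: funeneg_ge0.
have lpos : \int[mu]_(t in D) lE^\+ t < +oo.
  by move: lfin; rewrite integralE -/lE lteBlDr// => /lt_le_trans; apply; rewrite leey.
have rpos : \int[mu]_(t in D) rE^\+ t < +oo by exact: le_lt_trans lpos.
split; last first.
  by rewrite integralE [leRHS]integralE; exact: leeB.
apply/integrableP; split => //.
rewrite -[X in X < _]/(\int[mu]_(t in D) (abse \o rE) t) fune_abse.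
rewrite ge0_integralD//.
- by rewrite lte_add_pinfty.
- exact: measurable_funepos.
- exact: measurable_funeneg.
Qed.

End LowerIntegral.

Section ArcsOfAdmissiblePairs.
Context {R : realType} {n : nat}.
Implicit Types (t : R) (v : R -> 'rV[R]_n).

Lemma abs_cont_acR a b (x : R -> 'rV[R]_n) (j : 'I_n) :
  abs_cont_on a b x -> acR a b (fun t => x t 0 j).
Proof.
move=> acx e /acx[d d0 dP]; exists d => // k l r h1 h2 h3.
apply: le_lt_trans (dP k l r h1 h2 h3); apply: ler_sum => i _.
by have := ler_coord_enorm (x (r i) - x (l i)) j; rewrite !mxE.
Qed.

Lemma acR_sub a b t (F : R -> R) : t <= b -> acR a b F -> acR a t F.
Proof.
move=> tb acF e /acF[d d0 dP]; exists d => // k l r h1.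
by apply: dP => i /h1[? [? ?]]; split=> //; split=> //; exact: le_trans tb.
Qed.

(** Forward difference quotients of the clamped, hence continuous, arc converge to [v] off [N], and
    an indicator makes them 0 on [N]. The condition [N b] removes the right end point, where forward
    steps leave the interval. *)
Lemma measurable_derive a b (N : set R) (x : R -> 'rV[R]_n) (v : R -> 'rV[R]_n) (j : 'I_n) :
  a <= b -> abs_cont_on a b x -> measurable (N : set (@LebT R)) -> N b ->
  (forall t, a <= t <= b -> N t -> v t = 0) ->
  (forall t, a <= t <= b -> ~ N t -> derivable x t 1 /\ derive1 x t = v t) ->
  leb_measurable `[a, b]%classic (fun t => v t 0 j).
Proof.
move=> ab acx mN Nb vN vD.
pose xc t : R := x (clamp a b t) 0 j.
have cxc : continuous xc.
  move=> t; apply: (@continuous_comp _ _ _ (fun t => x (clamp a b t)) (fun p : 'rV[R]_n => p 0 j) t).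
    exact: abs_cont_clamp_continuous.
  exact: continuous_coord.
pose q (m : nat) t : R := \1_(~` N) t * (m.+1%:R * (xc (t + m.+1%:R^-1) - xc t)).
have mq m : leb_measurable `[a, b]%classic (q m).
  apply: measurable_funM; first by apply: measurable_indic; exact: measurableC.
  apply: continuous_leb; first exact: measurable_itvL.
  move=> t; apply: (@continuousM R R (fun=> m.+1%:R) (fun t => xc (t + m.+1%:R^-1) - xc t) t).
    exact: cst_continuous.
  apply: (@continuousB R R R (fun t => xc (t + m.+1%:R^-1)) xc t); last exact: cxc.
  apply: (@continuous_comp _ _ _ (fun t => t + m.+1%:R^-1) xc t); last exact: cxc.
  by apply: (@continuousD R R R id (fun=> m.+1%:R^-1) t); [exact: cvg_id|exact: cst_continuous].
apply: (measurable_fun_cvg mq) => t /=; rewrite in_itv/= => tab.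
have [Nt|Nt] := pselect (N t).
  rewrite (_ : (fun m => q m t) = (fun=> 0)); first by rewrite vN// mxE; exact: cvg_cst.
  by apply/funext => m; rewrite /q indicE memNset ?mul0r//; exact.
have [d e] := vD t tab Nt; have /andP[at_ tb] := tab.
have tb' : t < b by rewrite lt_neqAle tb andbT; apply/eqP => tb0; apply: Nt; rewrite tb0.
have dj : derivable (fun s => x s 0 j) t 1 by move/derivable_mxP : d; exact.
have ej : 'D_1 (fun s => x s 0 j) t = v t 0 j by rewrite -e derive1E derive_mx// mxE.
have lim : (fun h : R => h^-1 *: (((fun s => x s 0 j) \o shift t) (h *: (1 : R)) - x t 0 j)) @ (0 : R)^' --> v t 0 j.
  by rewrite -ej; exact: dj.
have h0 : (fun m : nat => m.+1%:R^-1 : R) @ \oo --> (0 : R) by exact: cvg_harmonic.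
have := (cvgr_dnbhsP _ _ _).1 lim (fun m => m.+1%:R^-1) (conj (fun m => _) h0).
move=> /(_ (fun m => ltac:(by rewrite invr_neq0// pnatr_eq0))).
apply: cvg_trans; apply: near_eq_cvg; near=> m.
rewrite /q indicE mem_set// mul1r invrK /GRing.scale/= mulr1 (addrC _ t) /xc.
rewrite !clampE//; apply/andP; split; first by rewrite (le_trans at_)// lerDl.
rewrite -lerBrDl; apply: ltW; near: m.
have bt0 : 0 < b - t by rewrite subr_gt0.
exact: (near_infty_natSinv_lt (PosNum bt0)).
Unshelve. all: by end_near. Qed.

Lemma arc_of_abs_cont a b (N : set R) (x : R -> 'rV[R]_n) v x0 :
  a <= b -> abs_cont_on a b x -> x a = x0 ->
  (@Leb R).-negligible (N : set LebT) -> vintg a b v ->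
  (forall t, a <= t <= b -> ~ N t -> derivable x t 1 /\ derive1 x t = v t) ->
  forall t, a <= t <= b -> x t = arc a b x0 v t.
Proof.
move=> ab acx xa Nn vi vD t tab; have /andP[at_ tb] := tab.
apply/rowP => j; rewrite arcE// mxE vIntE.
have <- : x t 0 j - x a 0 j = Int a t (fun s => v s 0 j).
  apply: (@FTC2_leb R a t (fun s => x s 0 j) _ N) => //.
  - by apply: acR_sub tb _; exact: abs_cont_acR.
  - exact: intgS (vi j).
  - move=> s /andP[as_ st] Ns; have [|d e] := vD s _ Ns; first by rewrite as_ (le_trans st).
    split; first by move/derivable_mxP : d; exact.
    by rewrite derive1E -e derive1E derive_mx// mxE.
by rewrite xa addrC subrK.
Qed.

Variables (t0 T : R) (c E : R -> R) (x0 : 'rV[R]_n).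
Hypothesis t0T : t0 <= T.
Hypothesis c0 : forall t, 0 <= c t.
Hypothesis ci : intg t0 T c.
Hypothesis E1 : forall t, t0 <= t <= T -> 1 <= E t.
Hypothesis cEi : intg t0 T (fun t => c t * E t).
Hypothesis cE : forall t, t0 <= t <= T -> Int t0 t (fun s => c s * E s) <= E t / 2.

(** Gronwall through a weighted supremum: with [u = (1 + |y v|) / E], [cE] gives
    [sup u <= 1 + |x0| + sup u / 2]. The crude bound [B] serves only to make the supremum finite, so
    that the last term can be absorbed. *)
Lemma arc_gronwall v : vintg t0 T v ->
  (forall t, t0 <= t <= T -> enorm (v t) <= c t * (1 + enorm (arc t0 T x0 v t))) ->
  forall t, t0 <= t <= T -> 1 + enorm (arc t0 T x0 v t) <= 2 * (1 + enorm x0) * E t.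
Proof.
move=> vi vc.
pose B := 1 + enorm x0 + Int t0 T (fun s => enorm (v s)).
pose u t := (1 + enorm (arc t0 T x0 v t)) / E t.
have Ep t : t0 <= t <= T -> 0 < E t by move=> tT; apply: lt_le_trans (E1 tT).
have uB t : t0 <= t <= T -> u t <= B.
  move=> tT; rewrite /u ler_pdivrMr ?Ep//.
  have h1 : 1 + enorm (arc t0 T x0 v t) <= B.
    rewrite /B -addrA lerD2l; apply: le_trans (arc_growth x0 tT vi) _; rewrite lerD2l.
    by apply: Int_mono => //; [exact: intg_enorm|move=> s; exact: enorm_ge0].
  apply: le_trans h1 _; rewrite ler_peMr ?E1//.
  by apply: addr_ge0; [rewrite addr_ge0// enorm_ge0|apply: Int_ge0 => s _; exact: enorm_ge0].
pose A := [set u t | t in [set t | t0 <= t <= T]].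
have A0 : A (u t0) by exists t0; rewrite //= lexx.
have hA : has_sup A by split; [exists (u t0)|exists B => _ [t tT <-]; exact: uB].
set Th := sup A.
have uTh t : t0 <= t <= T -> u t <= Th.
  by move=> tT; apply: ub_le_sup; [have [] := hA|exists t].
have Th0 : 0 <= Th.
  have tt : t0 <= t0 <= T by rewrite lexx.
  apply: le_trans (uTh t0 tt); rewrite /u divr_ge0// ?addr_ge0 ?enorm_ge0// ltW// Ep//.
have key t : t0 <= t <= T -> u t <= 1 + enorm x0 + Th / 2.
  move=> tT; have /andP[at_ tb] := tT; rewrite /u ler_pdivrMr ?Ep//.
  have h1 := arc_growth x0 tT vi.
  have h2 : Int t0 t (fun s => enorm (v s)) <= Th * Int t0 t (fun s => c s * E s).
    rewrite -IntZ; last exact: intgS cEi.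
    apply: le_Int; [by apply: intg_enorm; exact: vintgS vi|by apply: intgZ; exact: intgS cEi|].
    move=> s /andP[as_ st]; have sT : t0 <= s <= T by rewrite as_ (le_trans st).
    apply: le_trans (vc s sT) _; rewrite mulrCA ler_wpM2l//.
    by have := uTh s sT; rewrite /u ler_pdivrMr ?Ep.
  have h3 := ler_wpM2l Th0 (cE tT).
  have h4 : 1 + enorm x0 <= (1 + enorm x0) * E t.
    by rewrite ler_peMr ?E1// addr_ge0// enorm_ge0.
  rewrite mulrDl; apply: le_trans (_ : 1 + (enorm x0 + Th * (E t / 2)) <= _).
    by rewrite lerD2l; apply: le_trans h1 _; rewrite lerD2l; exact: le_trans h2 h3.
  by rewrite addrA (_ : Th / 2 * E t = Th * (E t / 2)); [rewrite lerD2r|ring].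
have Thle : Th <= 1 + enorm x0 + Th / 2.
  by apply: ge_sup; [exists (u t0)|move=> _ [t tT <-]; exact: key].
move=> t tT; have := uTh t tT; rewrite /u ler_pdivrMr ?Ep// => h.
apply: le_trans h _; apply: ler_wpM2r; first exact/ltW/Ep.
by move: Thle; rewrite -lerBlDr [X in X <= _](_ : _ = Th / 2) ?ler_pdivrMr 1?mulrC//; field.
Qed.

End ArcsOfAdmissiblePairs.

Section AdmissiblePairsAreArcs.
Context {R : realType} {n : nat}.
Variables (mu : {measure set (@RvB R (n + 1)) -> \bar R}) (H : @Ham R n).
Variables (t0 T : R) (c E phi : R -> R) (M : R) (x0 : 'rV[R]_n).
Hypothesis muS : is_sphere_measure mu.
Hypothesis t0T : t0 <= T.
Hypothesis mH : forall x p, leb_measurable `[t0, T]%classic (fun t => H t x p).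
Hypothesis cH : forall t, t0 <= t <= T -> continuous (fun xp : 'rV[R]_n * 'rV[R]_n => H t xp.1 xp.2).
Hypothesis convH : forall t, t0 <= t <= T -> forall x p q (lam : R), 0 <= lam <= 1 ->
  H t x (lam *: p + (1 - lam) *: q) <= lam * H t x p + (1 - lam) * H t x q.
Hypothesis lipH : forall t, t0 <= t <= T -> forall x p q,
  `|H t x p - H t x q| <= c t * (1 + enorm x) * enorm (p - q).
Hypothesis c0 : forall t, 0 <= c t.
Hypothesis ci : intg t0 T c.
Hypothesis E1 : forall t, t0 <= t <= T -> 1 <= E t.
Hypothesis cEi : intg t0 T (fun t => c t * E t).
Hypothesis cE : forall t, t0 <= t <= T -> Int t0 t (fun s => c s * E s) <= E t / 2.
Hypothesis EM : forall t, t0 <= t <= T -> 2 * (1 + enorm x0) * E t <= 1 + M.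
Hypothesis phii : intg t0 T phi.
Hypothesis Hphi : forall t, t0 <= t <= T -> forall x, enorm x <= M -> `|H t x 0| <= phi t.
Notation y := (arc t0 T x0).

(** Measurability comes from differentiating [x]. Integrability comes from the bound
    [|v| <= c * (1 + |x|)], valid at every point of the epigraph, and from the boundedness of the
    continuous [x]. *)
Lemma velocity_of_admissible x a : admissible (steiner_f mu H) T t0 x0 x a ->
  exists (v : R -> 'rV[R]_n) (N : set R), [/\ vintg t0 T v,
    measurable (N : set (@LebT R)) /\ @Leb R N = 0%E,
    forall t, t0 <= t <= T -> x t = y v t,
    forall t, t0 <= t <= T -> N t -> v t = 0 &
    (forall t, t0 <= t <= T -> ~ N t -> v t = steiner_f mu H t (x t) (a t)) /\
    forall t, t0 <= t <= T -> enorm (v t) <= c t * (1 + enorm (y v t))].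
Proof.
move=> [acx xt0 _ [N0 [mN0 N00 N0P]]].
pose N : set R := N0 `|` [set T].
have m1 : measurable ([set T] : set (@LebT R)).
  by rewrite -[X in measurable X]set_itv1; exact: measurable_itvL.
have mN : measurable (N : set (@LebT R)) by exact: measurableU.
have Nn : (@Leb R).-negligible (N : set LebT).
  by apply: negligibleU; apply/negligibleP => //; exact: Leb_set1.
have NL : @Leb R N = 0%E by move/negligibleP : Nn; exact.
have xD t : t0 <= t <= T -> ~ N t -> derivable x t 1 /\ derive1 x t = steiner_f mu H t (x t) (a t).
  move=> tT Nt; have /(subsetCl N0P) : (~` N0) t by move=> h; apply: Nt; left.
  by rewrite /mkset; apply; rewrite /= in_itv.
pose v t : 'rV[R]_n := if t \in N then 0 else steiner_f mu H t (x t) (a t).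
have vN t : t0 <= t <= T -> N t -> v t = 0 by move=> _ Nt; rewrite /v mem_set.
have vf t : t0 <= t <= T -> ~ N t -> v t = steiner_f mu H t (x t) (a t).
  by move=> _ Nt; rewrite /v memNset.
have vD t : t0 <= t <= T -> ~ N t -> derivable x t 1 /\ derive1 x t = v t.
  by move=> tT Nt; rewrite vf//; exact: xD.
have vc t : t0 <= t <= T -> enorm (v t) <= c t * (1 + enorm (x t)).
  move=> tT; have L0 : 0 <= c t * (1 + enorm (x t)) by rewrite mulr_ge0// addr_ge0// enorm_ge0.
  have [Nt|Nt] := pselect (N t); first by rewrite vN// enorm0.
  apply: (@Hamiltonian_dom R n (H t (x t)) _ _ (steiner_l mu H t (x t) (a t)) L0).
    exact: lipH.
  by move=> p; rewrite vf//; apply: (steiner_fl_epiH L0 (convH tT (x t)) (lipH tT (x t)) muS).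
have [B xB] : exists B, forall t, t0 <= t <= T -> enorm (x t) <= B.
  have cn : continuous (fun t => enorm (x (clamp t0 T t))).
    move=> t; apply: (@continuous_comp _ _ _ (fun t => x (clamp t0 T t)) (@enorm R n) t).
      exact: abs_cont_clamp_continuous.
    exact: continuous_enorm.
  have [s _ sM] := EVT_max t0T (continuous_subspaceT cn).
  exists (enorm (x (clamp t0 T s))) => t tT.
  by have := sM t; rewrite in_itv/= (clampE tT); apply.
have vi : vintg t0 T v.
  move=> j; apply: (@intg_le _ _ _ _ (fun t => (1 + B) * c t)).
  - by apply: (measurable_derive j t0T acx mN) => //; right.
  - move=> t tT; apply: le_trans (ler_coord_enorm _ _) _; apply: le_trans (vc t tT) _.
    by rewrite mulrC; apply: ler_wpM2r => //; rewrite lerD2l; exact: xB.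
  - exact: intgZ.
have xy := arc_of_abs_cont t0T acx xt0 Nn vi vD.
exists v, N; split => //; split => // t tT; by rewrite -xy// vc.
Qed.

Lemma arc_of_admissible (g : 'rV[R]_n -> R) x a : admissible (steiner_f mu H) T t0 x0 x a ->
  (\int[@Leb R]_(t in (`[t0, T]%classic : set LebT)) (steiner_l mu H t (x t) (a t))%:E < +oo)%E ->
  exists (v : R -> 'rV[R]_n) (r : R -> R) (N : set R),
   [/\ vintg t0 T v /\ intg t0 T r,
    measurable (N : set (@LebT R)) /\ @Leb R N = 0%E,
    forall t, t0 <= t <= T -> N t -> v t = 0 /\ r t = 0,
    (forall t, t0 <= t <= T -> ~ N t -> forall p, dotv p (v t) <= H t (y v t) p + r t) /\
    (forall t, t0 <= t <= T -> - phi t <= r t) &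
    (forall t, t0 <= t <= T -> 1 + enorm (y v t) <= 2 * (1 + enorm x0) * E t) /\
    ((g (y v T) + Int t0 T r)%:E <= (g (x T))%:E +
      \int[@Leb R]_(t in (`[t0, T]%classic : set LebT)) (steiner_l mu H t (x t) (a t))%:E)%E].
Proof.
move=> adm lfin.
have [v [N [vi [mN NL] xy vN [vf vc]]]] := velocity_of_admissible adm.
have yE := arc_gronwall t0T c0 E1 cEi cE vi vc.
have TT : t0 <= T <= T by rewrite t0T lexx.
pose l t := steiner_l mu H t (x t) (a t).
pose F (q : 'rV[rat]_n) t : R := \1_(~` N) t * (H t (y v t) (ratv q) - dotv (ratv q) (v t)).
have FN q t : N t -> F q t = 0 by move=> Nt; rewrite /F indicE memNset ?mul0r//; exact.
have FnN q t : ~ N t -> F q t = H t (y v t) (ratv q) - dotv (ratv q) (v t).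
  by move=> Nt; rewrite /F indicE mem_set ?mul1r.
have lH t : t0 <= t <= T -> ~ N t -> forall p, dotv p (v t) <= H t (y v t) p + l t.
  move=> tT Nt p; rewrite vf// -xy//.
  have L0 : 0 <= c t * (1 + enorm (x t)) by rewrite mulr_ge0// addr_ge0// enorm_ge0.
  exact: (steiner_fl_epiH L0 (convH tT (x t)) (lipH tT (x t)) muS).
have Flb t : t0 <= t <= T -> ~ N t -> forall q, - l t <= F q t.
  by move=> tT Nt q; rewrite FnN//; have := lH t tT Nt (ratv q); lra.
have Flb' t : t0 <= t <= T -> exists m, forall q, m <= F q t.
  move=> tT; have [Nt|Nt] := pselect (N t); first by exists 0 => q; rewrite FN.
  by exists (- l t); exact: Flb.
(* Off [N] this is the conjugate of [H t (y v t)] at [v t], computed over rational vectors: it is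
   measurable and at most [l]. On [N] the family is 0, so [r] vanishes there, as [le_lower_integral]
   requires. *)
pose r t := - finf (F ^~ t).
have rN t : t0 <= t <= T -> N t -> r t = 0.
  move=> tT Nt; apply/eqP; rewrite oppr_eq0 eq_le; apply/andP; split.
    by rewrite -(FN 0 t Nt); apply: (@ge_finf _ _ _ 0) => q; rewrite FN.
  by apply: le_finf => [|q]; [exact: 0|rewrite FN].
have rl t : t0 <= t <= T -> ~ N t -> r t <= l t.
  by move=> tT Nt; rewrite lerNl; apply: le_finf => [|q]; [exact: 0|exact: Flb].
have rF t q : t0 <= t <= T -> - F q t <= r t.
  by move=> /Flb'[m mF]; rewrite lerN2; exact: ge_finf mF.
have yM t : t0 <= t <= T -> enorm (y v t) <= M.
  by move=> tT; have := le_trans (yE t tT) (EM tT); rewrite lerD2l.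
have rphi t : t0 <= t <= T -> - phi t <= r t.
  move=> tT; apply: le_trans (rF t 0 tT); rewrite lerN2.
  have h := Hphi tT (yM t tT).
  have [Nt|Nt] := pselect (N t); first by rewrite FN// (le_trans _ h).
  by rewrite FnN// ratv0 dot0v subr0 (le_trans (ler_norm _) h).
have mem t : t0 <= t <= T -> ~ N t -> forall p, dotv p (v t) <= H t (y v t) p + r t.
  move=> tT Nt p; rewrite dotvC; move: p.
  have cHt : continuous (H t (y v t)) by apply: (@continuous_snd _ _ _ (H t)); exact: cH.
  have dl := @dense_le R n (dotv (v t)) (fun p : 'rV[R]_n => H t (y v t) p + r t).
  apply: dl; first exact: continuous_dotv.
    by move=> p; apply: (@continuousD R R 'rV[R]_n (H t (y v t)) (fun=> r t) p); [exact: cHt|exact: cst_continuous].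
  by move=> q; have := rF t q tT; rewrite FnN// dotvC; lra.
have mr : leb_measurable `[t0, T]%classic r.
  apply: measurable_funN; apply: measurable_finf; first exact: 0.
    by move=> t; rewrite /= in_itv/=; exact: Flb'.
  move=> q; apply: measurable_funM; first by apply: measurable_indic; exact: measurableC.
  apply: measurable_funB.
    apply: (@caratheodory_measurable R n t0 T (fun t x => H t x (ratv q)) (y v));
      [by move=> u; exact: mH| |exact: arc_continuous].
    by move=> t tT; apply: (@continuous_fst _ _ _ (H t)); exact: cH.
  exact: (intg_meas (intg_dotv (ratv q) vi)).
have [ri rle] := le_lower_integral (measurable_itvL `[t0, T]) mN NL mr phii
  (fun t Dt => rphi t ltac:(by move: Dt; rewrite /= in_itv))
  (fun t Dt => rN t ltac:(by move: Dt; rewrite /= in_itv))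
  (fun t Dt => rl t ltac:(by move: Dt; rewrite /= in_itv)) lfin.
exists v, r, N; split.
- by split.
- by split.
- by move=> t tT Nt; rewrite vN// rN.
- by split.
- split; first exact: yE.
  by rewrite EFinD -xy//; apply: leeD => //; rewrite -IntE.
Qed.

End AdmissiblePairsAreArcs.

(** * Perturbation of the Hamiltonian *)

Section Perturbation.
Context {R : realType} {n : nat}.

(* On the ball of radius [P] the two Hamiltonians are [eta]-close; outside of it
   the concave function [p.v - h2 p - s - eta] grows at most linearly, with slope
   its defect at the origin divided by [P]. *)
Lemma perturbed_steering (h1 h2 : 'rV[R]_n -> R) (v : 'rV[R]_n) (s eta phi P : R) :
  0 < P -> 0 <= eta -> `|h2 0| <= phi ->
  (forall p q (lam : R), 0 <= lam <= 1 ->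
    h2 (lam *: p + (1 - lam) *: q) <= lam * h2 p + (1 - lam) * h2 q) ->
  (forall p, enorm p <= P -> `|h1 p - h2 p| <= eta) ->
  (forall p, dotv p v <= h1 p + s) ->
  forall p, dotv p v - (eta + P^-1 * (phi + `|s| + eta)) * enorm p <=
    h2 p + (s + (eta + P^-1 * (phi + `|s| + eta))).
Proof.
move=> P0 eta0 hphi conv2 h12 hv.
have phi0 : 0 <= phi by exact: le_trans hphi.
set A := phi + `|s| + eta.
have A0 : 0 <= A by rewrite !addr_ge0.
have PA0 : 0 <= P^-1 * A by rewrite mulr_ge0// invr_ge0 ltW.
have near p : enorm p <= P -> dotv p v <= h2 p + s + eta.
  by move=> /h12; rewrite ler_norml => /andP[_ h]; have := hv p; lra.
move=> p; have p0 := enorm_ge0 p.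
have q0 : 0 <= (eta + P^-1 * A) * enorm p by rewrite mulr_ge0// addr_ge0.
have [pP|pP] := leP (enorm p) P; first by have := near p pP; lra.
have pp : 0 < enorm p by exact: lt_trans pP.
(* [lam *: p] lies on the sphere of radius [P], where the estimate is known; convexity between [p]
   and 0 then carries it out to [p]. *)
pose lam := P / enorm p.
have lam0 : 0 < lam by rewrite divr_gt0.
have lam1 : lam <= 1 by rewrite ler_pdivrMr// mul1r ltW.
have lamP : enorm (lam *: p) <= P by rewrite enormZ gtr0_norm// divfK ?gt_eqF.
have h := near _ lamP; rewrite dotvZl in h.
have lam01 : 0 <= lam <= 1 by rewrite ltW.
have hc := conv2 p 0 lam lam01; rewrite scaler0 addr0 in hc.
have a1 : h2 0 <= phi by exact: le_trans (ler_norm _) hphi.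
have a2 := ler_norm s.
have l1 : 0 <= 1 - lam by rewrite subr_ge0.
have b1 : (1 - lam) * (h2 0 + s + eta) <= (1 - lam) * A by apply: ler_wpM2l => //; rewrite /A; lra.
have b2 : (1 - lam) * A <= A by rewrite ler_piMl//; lra.
have key : lam * dotv p v <= lam * (h2 p + s + eta) + A.
  by move: hc h b1 b2; rewrite [(1 - lam) * (_ + _ + _)]mulrDr [(1 - lam) * (_ + s)]mulrDr !mulrDr; lra.
have lamA : A = lam * (P^-1 * A * enorm p).
  rewrite /lam; field; by rewrite !gt_eqF.
rewrite lamA -mulrDr ler_pM2l// in key.
have e0 : 0 <= eta * enorm p by rewrite mulr_ge0.
rewrite mulrDl; lra.
Qed.

Lemma Int_indic_null a b (N : set R) (f : R -> R) :
  measurable (N : set (@LebT R)) -> @Leb R N = 0%E -> intg a b f ->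
  intg a b (fun t => \1_N t * f t) /\ Int a b (fun t => \1_N t * f t) = 0.
Proof.
move=> mN N0 fi.
have i1 : intg a b (fun t => \1_N t * f t).
  apply: (@intg_le _ _ _ _ (fun t => `|f t|)).
  - by apply: measurable_funM; [exact: measurable_indic|exact: intg_meas fi].
  - by move=> t _; rewrite normrM indicE; case: (t \in N); rewrite ?normr1 ?normr0 ?mul1r ?mul0r.
  - exact: intg_norm.
split=> //; apply: EFin_inj; rewrite -IntE//.
rewrite (negligible_integral mN (measurable_itvL _) i1 N0).
by apply: integral0_eq => t [_ Nt]; rewrite indicE memNset// mul0r.
Qed.

End Perturbation.

Definition regular_Hamiltonian {R : realType} {n : nat} (T : R) (c : R -> R) (k : R -> R -> R)
    (H : @Ham R n) :=
  [/\ hypH1 T H, hypH2 T H, hypH3 T H, hypH4 T c H & hypHLC T k H].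

(** * Estimates uniform in the start point and the Hamiltonian *)

Section UniformFilippov.
Context {R : realType} {n : nat}.
Variables (mu : {measure set (@RvB R (n + 1)) -> \bar R}) (T M : R) (c : R -> R) (k : R -> R -> R).
Variable phi : R -> R.
Hypothesis muS : is_sphere_measure mu.
Hypothesis M0 : 0 < M.
Hypothesis c0 : forall t, 0 <= c t.
Hypothesis ci : intg 0 T c.
Hypothesis k0 : forall t, 0 <= k M t.
Hypothesis ki : intg 0 T (k M).
Hypothesis phii : intg 0 T phi.
Definition bounded_at0 (H : @Ham R n) :=
  forall t, 0 <= t <= T -> forall x, enorm x <= M -> `|H t x 0| <= phi t.
Let Wb := expR (2 * Int 0 T (k M)).
Implicit Types (v : R -> 'rV[R]_n) (r rho : R -> R).

Section FixedStart.
Variables (t0 : R) (x0 : 'rV[R]_n).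
Hypothesis t0T : 0 <= t0 <= T.
Hypothesis x0M : 2 * (1 + enorm x0) * expR (2 * Int 0 T c) <= 1 + M.
Notation y := (arc t0 T x0).
Let E t := expR (2 * Int t0 t c).
Let W t := expR (2 * Int t0 t (k M)).

Let t0le : t0 <= T. Proof. by have /andP[] := t0T. Qed.
Let t00 : 0 <= t0. Proof. by have /andP[] := t0T. Qed.
Let sub t : t0 <= t <= T -> 0 <= t <= T.
Proof. by move=> /andP[tt ->]; rewrite (le_trans t00 tt). Qed.
Let subI f : intg 0 T f -> intg t0 T f.
Proof. exact: intgS. Qed.

Let expW_ge1 (f : R -> R) t : (forall t, 0 <= f t) -> 1 <= expR (2 * Int t0 t f).
Proof. by move=> f0; rewrite -expR0 ler_expR mulr_ge0// Int_ge0. Qed.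

Let expW_le (f : R -> R) t : intg 0 T f -> (forall t, 0 <= f t) -> t0 <= t <= T ->
  expR (2 * Int t0 t f) <= expR (2 * Int 0 T f).
Proof.
move=> fi f0 tT; rewrite ler_expR ler_pM2l//.
apply: le_trans (Int_mono (subI fi) f0 tT) _.
by rewrite (Int_chasles t00 t0le fi) lerDr Int_ge0.
Qed.

Let EM t : t0 <= t <= T -> 2 * (1 + enorm x0) * E t <= 1 + M.
Proof.
move=> tT; apply: le_trans x0M; apply: ler_wpM2l; last exact: expW_le.
by rewrite mulr_ge0// addr_ge0// enorm_ge0.
Qed.

Lemma regular_start (H : @Ham R n) : regular_Hamiltonian T c k H ->
  [/\ forall x p, leb_measurable `[t0, T]%classic (fun t => H t x p),
   forall t, t0 <= t <= T -> continuous (fun xp : 'rV[R]_n * 'rV[R]_n => H t xp.1 xp.2),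
   forall t, t0 <= t <= T -> forall x p q (lam : R), 0 <= lam <= 1 ->
     H t x (lam *: p + (1 - lam) *: q) <= lam * H t x p + (1 - lam) * H t x q,
   forall t, t0 <= t <= T -> forall x p q,
     `|H t x p - H t x q| <= c t * (1 + enorm x) * enorm (p - q) &
   forall t, t0 <= t <= T -> forall x y p, enorm x <= M -> enorm y <= M ->
     `|H t x p - H t y p| <= k M t * (1 + enorm p) * enorm (x - y)].
Proof.
move=> [h1 h2 h3 h4 h5]; have DT t : t0 <= t <= T -> `[0, T]%classic t.
  by move=> tT; rewrite /= in_itv/=; exact: sub.
split.
- move=> x p; apply: measurable_funS (h1 x p); first exact: measurable_itvL.
  by move=> t; rewrite /= !in_itv/=; exact: sub.
- by move=> t tT; exact: h2 (DT t tT).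
- by move=> t tT x p q lam; exact: h3 (DT t tT) _ _ _ _.
- by move=> t tT x p q; exact: h4 (DT t tT) _ _ _.
- by move=> t tT x z p; exact: h5 M0 _ (DT t tT) _ _ _.
Qed.

Let weights := (Int_exp_weight (subI ci) c0, Int_exp_weight (subI ki) k0).

(** The corrected arc is admissible for the Steiner representation, so its cost bounds the value;
    its end point [z] is kept because the terminal costs are compared there. *)
Lemma filippov_value (H : @Ham R n) (g : 'rV[R]_n -> R) v0 r0 rho0 : regular_Hamiltonian T c k H ->
  vintg t0 T v0 -> intg t0 T r0 -> intg t0 T rho0 -> (forall t, t0 <= t <= T -> 0 <= rho0 t) ->
  (forall t, t0 <= t <= T -> 1 + enorm (y v0 t) <= 2 * (1 + enorm x0) * E t) ->
  (forall t, t0 <= t <= T -> forall p, dotv p (v0 t) - rho0 t * enorm p <= H t (y v0 t) p + (r0 t + rho0 t)) ->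
  exists z, [/\ enorm z <= M, enorm (z - y v0 T) <= 2 * Wb * Int t0 T rho0 &
    (value_fun g (steiner_f mu H) (steiner_l mu H) T (t0, x0) <=
      (g z + (Int t0 T r0 + (1 + Wb) * Int t0 T rho0))%:E)%E].
Proof.
move=> regH v0i r0i rho0i rho00 v0E sv0.
have [mH cH convH lipH lcH] := regular_start regH.
have [[cEi cE] [kWi kW]] := weights.
have E1 t : t0 <= t <= T -> 1 <= E t by move=> _; exact: expW_ge1.
have W1 t : t0 <= t <= T -> 1 <= W t <= Wb.
  by move=> tT; apply/andP; split; [exact: expW_ge1|exact: expW_le ki k0 tT].
have [v [r [vi ri mem vd rle]]] := filippov t0le mH cH convH lipH lcH c0 k0 W1 kWi kW E1 cEi cE EM
  v0i r0i rho0i rho00 v0E sv0.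
have TT : t0 <= T <= T by rewrite t0le lexx.
have vc t : t0 <= t <= T -> enorm (v t) <= c t * (1 + enorm (y v t)).
  move=> tT; apply: (@Hamiltonian_dom R n (H t (y v t)) _ _ (r t)).
  - by rewrite mulr_ge0// addr_ge0// enorm_ge0.
  - exact: lipH.
  - exact: mem.
have yE := arc_gronwall t0le c0 E1 cEi cE vi vc.
exists (y v T); split.
- by have := le_trans (yE T TT) (EM TT); rewrite lerD2l.
- exact: vd.
- apply: le_trans (value_le_arc g muS t0le c0 convH lipH vi ri mem) _.
  by rewrite lee_fin lerD2l.
Qed.

Lemma Int_start_le (f : R -> R) : intg 0 T f -> (forall t, 0 <= t <= T -> 0 <= f t) ->
  Int t0 T f <= Int 0 T f.
Proof.
move=> fi f0; rewrite [leRHS](Int_chasles t00 t0le fi) lerDr.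
apply: Int_ge0 => t /andP[tt tt0]; apply: f0; by rewrite tt (le_trans tt0).
Qed.

(** Filippov's theorem is applied to the constant arc with zero cost, whose defect is at most
    [(1 + M) * c + phi]. The resulting bound on the running part is the same for all the
    Hamiltonians considered. *)
Lemma value_ub (H : @Ham R n) (g : 'rV[R]_n -> R) : regular_Hamiltonian T c k H -> bounded_at0 H ->
  exists2 z, enorm z <= M & (value_fun g (steiner_f mu H) (steiner_l mu H) T (t0, x0) <=
      (g z + (1 + Wb) * ((1 + M) * Int 0 T c + Int 0 T phi))%:E)%E.
Proof.
move=> regH bH; have [mH cH convH lipH lcH] := regular_start regH.
have v0i : vintg t0 T (fun=> 0 : 'rV[R]_n).
  by move=> j; apply: eq_intg (intg_cst t0 T 0) => t _; rewrite mxE.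
have y0 t : t0 <= t <= T -> y (fun=> 0) t = x0.
  move=> tT; rewrite arcE// [X in _ + X](_ : _ = 0) ?addr0//.
  apply/rowP => j; rewrite vIntE mxE.
  have /andP[tt _] := tT; rewrite -[RHS](mul0r (t - t0)) -(Int_cst 0 tt).
  by congr (Int _ _ _); apply/funext => s; rewrite mxE.
have x0M' : enorm x0 <= M.
  have e1 : 1 <= expR (2 * Int 0 T c) by rewrite -expR0 ler_expR mulr_ge0// Int_ge0.
  have h0 := enorm_ge0 x0.
  have : (1 + enorm x0) * 1 <= 2 * (1 + enorm x0) * expR (2 * Int 0 T c).
    by apply: ler_pM => //; rewrite ?addr_ge0//; lra.
  by rewrite mulr1 => /le_trans /(_ x0M); rewrite lerD2l.
pose rho t := (1 + M) * c t + phi t.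
have phi0 t : 0 <= t <= T -> 0 <= phi t.
  by move=> tT; apply: le_trans (bH t tT x0 x0M').
have rhoi : intg 0 T rho by apply: intgD => //; exact: intgZ.
have M1 : 0 <= 1 + M by rewrite addr_ge0// ltW.
have rho0 t : 0 <= t <= T -> 0 <= rho t by move=> /phi0 h; rewrite addr_ge0// mulr_ge0.
have [] := @filippov_value H g (fun=> 0) (fun=> 0) rho regH v0i (intg_cst _ _ _) (subI rhoi).
- by move=> t /sub; exact: rho0.
- move=> t tT; rewrite y0//; have h0 := enorm_ge0 x0.
  rewrite -[leLHS]mulr1; apply: ler_pM => //; [by rewrite addr_ge0|lra|exact: expW_ge1].
- move=> t tT p; rewrite y0// dotv0 sub0r add0r.
  have h1 := bH t (sub tT) x0 x0M'; have h2 := lipH t tT x0 0 p.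
  rewrite sub0r enormN in h2.
  have p0 := enorm_ge0 p.
  have h3 : c t * (1 + enorm x0) * enorm p <= (1 + M) * c t * enorm p.
    by apply: ler_wpM2r => //; rewrite mulrC; apply: ler_wpM2r => //; rewrite lerD2l.
  have h4 : 0 <= phi t * enorm p by rewrite mulr_ge0// phi0// sub.
  have h5 : 0 <= (1 + M) * c t by rewrite mulr_ge0.
  have h6 := ler_norm (H t x0 0 - H t x0 p).
  have h7 := ler_norm (- H t x0 0); rewrite normrN in h7.
  rewrite /rho mulrDl; lra.
move=> z [zM _ Vz]; exists z => //; apply: le_trans Vz _.
rewrite lee_fin lerD2l.
have -> : Int t0 T (fun=> 0) = 0 :> R by rewrite Int_cst// mul0r.
rewrite add0r; apply: ler_wpM2l; first by rewrite addr_ge0// expR_ge0.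
by rewrite -IntZ// -IntD//; [exact: Int_start_le|exact: intgZ].
Qed.

(** The running cost [s] of the arc enters the error through the defect at [p = 0] divided by [P].
    It stays explicit because only near-optimality, known to the caller, bounds it. *)
Lemma transfer_value (H1 H2 : @Ham R n) (g1 g2 : 'rV[R]_n -> R) (eta : R -> R) (P : R) x a :
  regular_Hamiltonian T c k H1 -> regular_Hamiltonian T c k H2 -> bounded_at0 H1 -> bounded_at0 H2 ->
  0 < P -> intg 0 T eta -> (forall t, 0 <= t <= T -> 0 <= eta t) ->
  (forall t, 0 <= t <= T -> forall x p, enorm x <= M -> enorm p <= P -> `|H1 t x p - H2 t x p| <= eta t) ->
  admissible (steiner_f mu H1) T t0 x0 x a ->
  (\int[@Leb R]_(t in (`[t0, T]%classic : set LebT)) (steiner_l mu H1 t (x t) (a t))%:E < +oo)%E ->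
  exists z z' s, let err := (1 + P^-1) * Int 0 T eta + P^-1 * (3 * Int 0 T phi + s) in
    [/\ enorm z <= M, enorm z' <= M,
     ((g1 z + s)%:E <= (g1 (x T))%:E +
       \int[@Leb R]_(t in (`[t0, T]%classic : set LebT)) (steiner_l mu H1 t (x t) (a t))%:E)%E,
     enorm (z' - z) <= 2 * Wb * err &
     (value_fun g2 (steiner_f mu H2) (steiner_l mu H2) T (t0, x0) <= (g2 z' + (s + (1 + Wb) * err))%:E)%E].
Proof.
move=> reg1 reg2 b1 b2 P0 etai eta0 H12 adm lfin.
have [m1 c1 conv1 lip1 _] := regular_start reg1.
have [m2 c2 conv2 lip2 _] := regular_start reg2.
have [[cEi cE] [kWi kW]] := weights.
have E1 t : t0 <= t <= T -> 1 <= E t by move=> _; exact: expW_ge1.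
have [v [r [N [[vi ri] [mN N0] vrN [mem rphi] [yE cost]]]]] :=
  arc_of_admissible muS t0le m1 c1 conv1 lip1 c0 (subI ci) E1 cEi cE EM (subI phii)
    (fun t tT => b1 t (sub tT)) g1 adm lfin.
have TT : t0 <= T <= T by rewrite t0le lexx.
have yM t : t0 <= t <= T -> enorm (y v t) <= M.
  by move=> tT; have := le_trans (yE t tT) (EM tT); rewrite lerD2l.
have phi0 t : 0 <= t <= T -> 0 <= phi t.
  by move=> tT; apply: le_trans (b1 t tT 0 _) => //; rewrite enorm0 ltW.
(* On the null set [N] the constraint of [H1] may fail, but [v] and [r] vanish there; [sg] bounds
   the defect of zero velocity and, multiplied by the indicator of [N], adds nothing to the integral
   of [rho]. *)
pose sg t := (1 + M) * c t + phi t.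
have M1 : 0 <= 1 + M by rewrite addr_ge0// ltW.
have sg0 t : t0 <= t <= T -> 0 <= sg t by move=> /sub/phi0 ?; rewrite addr_ge0// mulr_ge0.
have sgi : intg t0 T sg by apply: intgD; [apply: intgZ|]; exact: subI.
have [Nsi Ns0] := Int_indic_null mN N0 sgi.
pose tau t := eta t + P^-1 * (phi t + `|r t| + eta t).
have taui : intg t0 T tau.
  apply: intgD; first exact: subI.
  apply: intgZ; apply: intgD; last exact: subI.
  by apply: intgD; [exact: subI|exact: intg_norm].
pose rho t := tau t + \1_N t * sg t.
have rhoi : intg t0 T rho by exact: intgD.
have iP0 : 0 <= P^-1 by rewrite invr_ge0 ltW.
have tau0 t : t0 <= t <= T -> 0 <= tau t.
  move=> /sub tT; have h1 := eta0 t tT; have h2 := phi0 t tT.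
  by rewrite addr_ge0// mulr_ge0// !addr_ge0.
have rho0 t : t0 <= t <= T -> 0 <= rho t.
  by move=> tT; rewrite addr_ge0 ?tau0// mulr_ge0 ?sg0// indicE.
have st t : t0 <= t <= T -> forall p, dotv p (v t) - rho t * enorm p <= H2 t (y v t) p + (r t + rho t).
  move=> tT p; have p0 := enorm_ge0 p.
  have [Nt|Nt] := pselect (N t).
    have [-> ->] := vrN t tT Nt; rewrite dotv0 sub0r add0r.
    have rs : sg t <= rho t by rewrite /rho indicE mem_set// mul1r lerDr tau0.
    have h1 := b2 t (sub tT) _ (yM t tT); have h2 := lip2 t tT (y v t) 0 p.
    rewrite sub0r enormN in h2.
    have h3 : c t * (1 + enorm (y v t)) * enorm p <= (1 + M) * c t * enorm p.
      by apply: ler_wpM2r => //; rewrite mulrC; apply: ler_wpM2r => //; rewrite lerD2l yM.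
    have h4 : 0 <= phi t * enorm p by rewrite mulr_ge0// phi0// sub.
    have h5 : 0 <= (1 + M) * c t by rewrite mulr_ge0.
    have h6 := ler_norm (H2 t (y v t) 0 - H2 t (y v t) p).
    have h7 := ler_norm (- H2 t (y v t) 0); rewrite normrN in h7.
    have h8 : sg t * enorm p <= rho t * enorm p by exact: ler_wpM2r.
    by move: h8 rs; rewrite /sg mulrDl; lra.
  have -> : rho t = tau t by rewrite /rho indicE memNset// mul0r addr0.
  apply: (@perturbed_steering R n (H1 t (y v t)) (H2 t (y v t)) (v t) (r t) (eta t) (phi t) P P0).
  - by apply: eta0; exact: sub.
  - by apply: b2; [exact: sub|exact: yM].
  - exact: conv2.
  - by move=> q qP; apply: H12 => //; [exact: sub|exact: yM].
  - exact: mem.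
have Irho : Int t0 T rho <= (1 + P^-1) * Int 0 T eta + P^-1 * (3 * Int 0 T phi + Int t0 T r).
  have e1 := Int_start_le etai eta0; have e2 := Int_start_le phii phi0.
  have [e0 p0] : 0 <= Int 0 T eta /\ 0 <= Int 0 T phi by split; exact: Int_ge0.
  have nri := intg_norm ri.
  have -> : Int t0 T rho = Int t0 T eta + P^-1 * (Int t0 T phi + Int t0 T (fun t => `|r t|) + Int t0 T eta).
    rewrite IntD// Ns0 addr0 IntD; last 2 first.
    - exact: subI.
    - by apply: intgZ; apply: intgD; [apply: intgD|]; try exact: subI.
    rewrite IntZ; last by apply: intgD; [apply: intgD|]; try exact: subI.
    rewrite IntD; last 2 first.
    - by apply: intgD; try exact: subI.
    - exact: subI.
    by rewrite IntD//; exact: subI.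
  (* From [- phi <= r] follows [|r| <= r + 2 * phi]; with the [phi] already in [tau] this makes the
     coefficient 3 in the error. *)
  have nr : Int t0 T (fun t => `|r t|) <= Int t0 T r + 2 * Int t0 T phi.
    rewrite -IntZ; last exact: subI.
    rewrite -IntD//; last by apply: intgZ; exact: subI.
    apply: le_Int => //; first by apply: intgD => //; apply: intgZ; exact: subI.
    move=> t tT; have := rphi t tT; have := phi0 t (sub tT).
    by case: (lerP 0 (r t)) => ? ? ?; [rewrite ger0_norm//|rewrite ltr0_norm//]; lra.
  rewrite [leRHS](_ : _ = Int 0 T eta + P^-1 * (3 * Int 0 T phi + Int t0 T r + Int 0 T eta)); last by ring.
  by apply: lerD => //; apply: ler_wpM2l => //; lra.
have [z' [z'M zd Vz]] := @filippov_value H2 g2 v r rho reg2 vi ri rhoi rho0 yE st.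
exists (y v T), z', (Int t0 T r); split => //.
- exact: yM.
- apply: le_trans zd _; apply: ler_wpM2l => //; by rewrite mulr_ge0// expR_ge0.
- apply: le_trans Vz _; rewrite lee_fin lerD2l lerD2l; apply: ler_wpM2l => //.
  by rewrite addr_ge0// expR_ge0.
Qed.

End FixedStart.

End UniformFilippov.

(** * Compact balls and uniform continuity *)

Section CompactBalls.
Context {R : realType} {n : nat}.

Lemma compact_enorm_ball (rad : R) : compact [set x : 'rV[R]_n | enorm x <= rad].
Proof.
apply: bounded_closed_compact.
  exists rad; split; first exact: num_real.
  by move=> b rb x /= xr; apply: le_trans (ltW rb); apply: le_trans xr; exact: ler_norm_enorm.
have -> : [set x : 'rV[R]_n | enorm x <= rad] = enorm @^-1` [set y | y <= rad] by [].
by apply: preimage_closed; [move=> x _; exact: continuous_enorm|exact: closed_le].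
Qed.

Lemma compact_norm_bounded (U : topologicalType) (K : set U) (f : U -> R) :
  compact K -> continuous f -> exists2 b, 0 <= b & forall x, K x -> `|f x| <= b.
Proof.
move=> cK cf; have [b [_ bP]] : bounded_set (f @` K).
  by apply: compact_bounded; apply: continuous_compact => //; exact: continuous_subspaceT.
exists (`|b| + 1); first by rewrite addr_ge0.
move=> x Kx; apply: bP; last by exists x.
by rewrite ltr_pwDr// ler_norm.
Qed.

Lemma compact_uniformly_continuous (K : set 'rV[R]_n) (f : 'rV[R]_n -> R) : compact K -> continuous f ->
  forall e : R, 0 < e -> exists2 d : R, 0 < d &
    forall x y, K x -> enorm (y - x) <= d -> `|f y - f x| <= e.
Proof.
move=> cK cf e e0; have e2 : 0 < e / 2 by rewrite divr_gt0.
have /compact_near_coveringP ncK := cK.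
have [d d0 dP] : \forall d \near 0^'+, K `<=` (fun x => forall y, enorm (y - x) <= d -> `|f y - f x| <= e).
  apply: (ncK R (0^'+) (fun d x => forall y, enorm (y - x) <= d -> `|f y - f x| <= e)) => x Kx.
  have nF := @nbhs_filter _ x.
  have /(@cvgrPdist_lt _ _ _ (nbhs x) nF)/(_ _ e2)/nbhs_ballP[r /= r0 rP] := cf x.
  have r2 : 0 < r / 2 by rewrite divr_gt0.
  exists (ball x (r / 2), [set d | d < r / 2]); first split => /=.
  - by apply/nbhs_ballP; exists (r / 2).
  - exact: nbhs_right_lt.
  move=> [x' d] /= [xx' dr] y yd.
  have h1 : `|f x - f x'| < e / 2.
    by apply: rP; apply: le_ball xx'; lra.
  have h2 : `|f x - f y| < e / 2.
    apply: rP; rewrite -ball_normE/=.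
    rewrite -ball_normE/= in xx'.
    have -> : x - y = (x - x') + (x' - y) by rewrite addrA subrK.
    apply: le_lt_trans (ler_normD _ _) _; rewrite (splitr r); apply: ltrD => //.
    by rewrite distrC (le_lt_trans (ler_norm_enorm _))// (le_lt_trans yd).
  have -> : f y - f x' = (f x - f x') - (f x - f y) by ring.
  apply: le_trans (ler_normB _ _) _; rewrite (splitr e).
  by apply: lerD; exact: ltW.
exists (d / 2); first by rewrite divr_gt0.
move=> x y Kx; apply: (dP (d / 2)) => //=; last by rewrite divr_gt0.
by rewrite sub0r normrN gtr0_norm ?divr_gt0// ltr_pdivrMr// ltr_pMr// ltr1n.
Qed.

End CompactBalls.

Lemma Int_zero (R : realType) (a b : R) : Int a b (fun=> 0) = 0.
Proof.
rewrite -[RHS](mul0r (Int a b (fun=> 0))) -IntZ; last exact: intg_cst.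
by apply: eq_Int => t _; rewrite mul0r.
Qed.

(** * Integrable control of the distance between the Hamiltonians *)

Section HamiltonianGap.
Context {R : realType} {n : nat}.
Variables (T M : R) (c : R -> R) (k : R -> R -> R) (phi : R -> R).
Hypothesis c0 : forall t, 0 <= c t.
Hypothesis ci : intg 0 T c.
Hypothesis phii : intg 0 T phi.
Variables (Hs : nat -> @Ham R n) (H : @Ham R n).
Hypothesis regHs : forall i, regular_Hamiltonian T c k (Hs i).
Hypothesis regH : regular_Hamiltonian T c k H.
Hypothesis bHs : forall i, bounded_at0 T (M + 1) phi (Hs i).
Hypothesis bH : bounded_at0 T (M + 1) phi H.
Hypothesis HsH : forall t, `[0, T]%classic t ->
  forall K : set ('rV[R]_n * 'rV[R]_n), compact K -> forall e : R, 0 < e ->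
    exists N : nat, forall i, (N <= i)%N -> forall xp, K xp ->
      `|Hs i t xp.1 xp.2 - H t xp.1 xp.2| <= e.

Let in0T t : 0 <= t <= T -> `[0, T]%classic t.
Proof. by move=> tT; rewrite /= in_itv. Qed.

Lemma regular_bound (H0 : @Ham R n) (P : R) : regular_Hamiltonian T c k H0 ->
  bounded_at0 T (M + 1) phi H0 -> 0 <= P ->
  forall t, 0 <= t <= T -> forall x p, enorm x <= M + 1 -> enorm p <= P ->
  `|H0 t x p| <= phi t + (M + 2) * P * c t.
Proof.
move=> [_ _ _ h4 _] b0 P0 t tT x p xM pP.
have h1 := b0 t tT x xM; have h2 := h4 t (in0T tT) x p 0; rewrite subr0 in h2.
have h3 : c t * (1 + enorm x) * enorm p <= c t * (M + 2) * P.
  apply: ler_pM => //; [by rewrite mulr_ge0// addr_ge0// enorm_ge0|exact: enorm_ge0|].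
  by apply: ler_wpM2l => //; lra.
have -> : H0 t x p = H0 t x 0 + (H0 t x p - H0 t x 0) by rewrite addrC subrK.
apply: le_trans (ler_normD _ _) _; apply: lerD => //.
by rewrite [leRHS]mulrC mulrA; exact: le_trans h3.
Qed.

(** [eta i] is the supremum of the gap over rational points, hence measurable. It is taken over
    balls enlarged by 1, since rational approximations of a boundary point may lie outside the
    original ones; [G] dominates it. *)
Lemma Hamiltonian_gap (P : R) : 0 <= P -> exists eta : nat -> R -> R,
  [/\ forall i, intg 0 T (eta i), forall i t, 0 <= t <= T -> 0 <= eta i t,
   forall i t, 0 <= t <= T -> forall x p, enorm x <= M -> enorm p <= P ->
     `|Hs i t x p - H t x p| <= eta i t &
   Int 0 T (eta i) @[i --> \oo] --> (0 : R)].
Proof.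
move=> P0.
pose box (q : 'rV[rat]_n * 'rV[rat]_n) : bool :=
  (@enorm R n (ratv q.1) <= M + 1) && (@enorm R n (ratv q.2) <= P + 1).
pose D i t (xp : 'rV[R]_n * 'rV[R]_n) := `|Hs i t xp.1 xp.2 - H t xp.1 xp.2|.
(* Points outside the box contribute 0, which is harmless in an infimum of nonpositive numbers. *)
pose F i q t : R := if box q then - D i t (ratv q.1, ratv q.2) else 0.
pose G t : R := 2 * (phi t + (M + 2) * (P + 1) * c t).
have DG i t : 0 <= t <= T -> forall xp, enorm xp.1 <= M + 1 -> enorm xp.2 <= P + 1 -> D i t xp <= G t.
  move=> tT [x p] /= xM pP; have P1 : 0 <= P + 1 by rewrite addr_ge0.
  have h1 := regular_bound (regHs i) (bHs i) P1 tT xM pP.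
  have h2 := regular_bound regH bH P1 tT xM pP.
  by apply: le_trans (ler_normB _ _) _; rewrite /G mulr2n mulrDl mul1r; exact: lerD.
have D0 i t xp : 0 <= D i t xp by exact: normr_ge0.
(* If [M + 1] is negative the ball of radius [M] is empty and the gap 0 works. *)
have [M1|M1] := leP 0 (M + 1); last first.
  exists (fun _ _ => 0); split => //.
  - by move=> i; exact: intg_cst.
  - move=> i t _ x p xM; have := enorm_ge0 x; lra.
  have -> : (fun i : nat => Int 0 T (fun=> 0)) = fun=> 0 :> R.
    by apply/funext => i; exact: Int_zero.
  exact: cvg_cst.
have G0 t : 0 <= t <= T -> 0 <= G t.
  by move=> tT; apply: le_trans (D0 0%N t (0, 0)) (DG 0%N t tT _ _ _); rewrite /= enorm0// addr_ge0.
have FG i t : 0 <= t <= T -> forall q, - G t <= F i q t.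
  move=> tT q; rewrite /F; case: ifPn => [/andP[q1 q2]|_]; last by rewrite oppr_le0 G0.
  by rewrite lerN2; exact: DG.
have box0 : box (0, 0) by rewrite /box /= !ratv0 !enorm0 M1 addr_ge0.
pose eta i t := - finf (fun q => F i q t).
have etaG i t : 0 <= t <= T -> 0 <= eta i t <= G t.
  move=> tT; apply/andP; split; last first.
    by rewrite lerNl; apply: le_finf => [|q]; [exact: (0, 0)|exact: FG].
  rewrite oppr_ge0; apply: le_trans (ge_finf (0, 0) (FG i t tT)) _.
  by rewrite /F box0 oppr_le0.
have meta i : leb_measurable `[0, T]%classic (eta i).
  apply: measurable_funN; apply: measurable_finf; first exact: (0, 0).
    by move=> t; rewrite /= in_itv/= => tT; exists (- G t); exact: FG.
  move=> q; rewrite /F; case: (box q); last exact: measurable_cst.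
  apply: measurable_funN; apply: (measurableT_comp (@normr_measurable R setT)).
  have [mi _ _ _ _] := regHs i; have [m _ _ _ _] := regH.
  by apply: measurable_funB; [exact: mi|exact: m].
have Gi : intg 0 T G by apply: intgZ; apply: intgD => //; exact: intgZ.
have etai i : intg 0 T (eta i).
  apply: (@intg_le _ _ _ _ G) => // t tT; have /andP[h1 h2] := etaG i t tT.
  by rewrite ger0_norm.
exists eta; split => //.
- by move=> i t /(etaG i)/andP[].
- move=> i t tT x p xM pP.
  have [_ ci_ _ _ _] := regHs i; have [_ cH _ _ _] := regH.
  have [qx qxP] := ratv_cvg x; have [qp qpP] := ratv_cvg p.
  have cD : {for (x, p), continuous (D i t)}.
    apply: cvg_norm; apply: cvgB; [exact: ci_ (in0T tT) (x, p)|exact: cH (in0T tT) (x, p)].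
  have cq : (ratv (qx j), ratv (qp j)) @[j --> \oo] --> (x, p) by exact: (cvg_pair qxP qpP).
  have cDq := cvg_comp _ _ cq cD.
  apply: (ler_cvg_to cDq (cvg_cst (eta i t))).
  have ex : enorm (ratv (qx j)) @[j --> \oo] --> enorm x by exact: (cvg_comp _ _ qxP (continuous_enorm (x := x))).
  have ep : enorm (ratv (qp j)) @[j --> \oo] --> enorm p by exact: (cvg_comp _ _ qpP (continuous_enorm (x := p))).
  near=> j; rewrite /= lerNr.
  apply: le_trans (ge_finf (qx j, qp j) (FG i t tT)) _.
  rewrite /F ifT//; apply/andP; split; apply: ltW; near: j.
    by apply: (cvgr_lt (enorm x)) => //; rewrite (le_lt_trans xM)// ltrDl.
  by apply: (cvgr_lt (enorm p)) => //; rewrite (le_lt_trans pP)// ltrDl.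
- have bnd i t : 0 <= t <= T -> `|eta i t| <= G t.
    by move=> tT; have /andP[h1 h2] := etaG i t tT; rewrite ger0_norm.
  suff ptw t : 0 <= t <= T -> eta ^~ t @ \oo --> (0 : R).
    have := @Int_dominated R 0 T eta (fun=> 0) G meta ptw Gi bnd; rewrite Int_zero.
    exact.
  move=> tT; apply/cvgrPdist_le => e e0.
  have cK := compact_setX (@compact_enorm_ball R n (M + 1)) (@compact_enorm_ball R n (P + 1)).
  have [N NP] := HsH (in0T tT) cK e0.
  near=> i; have /andP[h1 h2] := etaG i t tT.
  rewrite sub0r normrN ger0_norm// lerNl; apply: le_finf => [|q]; first exact: (0, 0).
  rewrite /F; case: ifPn => [/andP[q1 q2]|_]; last by rewrite oppr_le0 ltW.
  rewrite lerN2; apply: (NP i) => //.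
  by near: i; exact: nbhs_infty_ge.
Unshelve. all: by end_near. Qed.

End HamiltonianGap.

(** * Comparison of the values *)

Section ValueGap.
Context {R : realType} {n : nat}.
Variables (mu : {measure set (@RvB R (n + 1)) -> \bar R}) (T M : R) (c : R -> R) (k : R -> R -> R).
Variable phi : R -> R.
Hypothesis muS : is_sphere_measure mu.
Hypothesis M0 : 0 < M.
Hypothesis c0 : forall t, 0 <= c t.
Hypothesis ci : intg 0 T c.
Hypothesis k0 : forall t, 0 <= k M t.
Hypothesis ki : intg 0 T (k M).
Hypothesis phii : intg 0 T phi.

(** [P] and [delta] are fixed before the Hamiltonians and the start point, so one choice serves both
    orders of the pair and every [i]. This is possible because pairs cheaper than the a priori bound
    have uniformly bounded running cost. *)
Lemma value_gap (G d e : R) : 0 < d -> 0 < e -> exists P delta : R, [/\ 0 < P, 0 < delta &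
  forall (H1 H2 : @Ham R n) (g1 g2 : 'rV[R]_n -> R) (eta : R -> R) t0 x0,
  regular_Hamiltonian T c k H1 -> regular_Hamiltonian T c k H2 ->
  bounded_at0 T M phi H1 -> bounded_at0 T M phi H2 ->
  (forall z, enorm z <= M -> `|g1 z| <= G /\ `|g2 z| <= G) ->
  (forall z z', enorm z <= M -> enorm z' <= M -> enorm (z' - z) <= d -> `|g2 z' - g1 z| <= e / 2) ->
  intg 0 T eta -> (forall t, 0 <= t <= T -> 0 <= eta t) ->
  (forall t, 0 <= t <= T -> forall x p, enorm x <= M -> enorm p <= P -> `|H1 t x p - H2 t x p| <= eta t) ->
  Int 0 T eta <= delta ->
  0 <= t0 <= T -> 2 * (1 + enorm x0) * expR (2 * Int 0 T c) <= 1 + M ->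
  (value_fun g2 (steiner_f mu H2) (steiner_l mu H2) T (t0, x0) <=
   value_fun g1 (steiner_f mu H1) (steiner_l mu H1) T (t0, x0) + e%:E)%E].
Proof.
move=> d0 e0.
pose W := expR (2 * Int 0 T (k M)).
have W0 : 0 < W by exact: expR_gt0.
(* [U] is the bound of [value_ub]. A pair cheaper than [U] has running cost at most [U + G], so [S]
   bounds from above what the error divides by [P]. *)
pose U := G + (1 + W) * ((1 + M) * Int 0 T c + Int 0 T phi).
pose S := `|3 * Int 0 T phi + (U + G)|.
(* Target for the error: [2 * W * e1 <= d] keeps the end points within [d], and
   [(1 + W) * e1 <= e / 2] leaves [e / 2] for the terminal costs. *)
pose e1 := Num.min d e / (2 * (1 + W)).
have W1 : 0 < 1 + W by rewrite addr_gt0.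
have e10 : 0 < e1 by rewrite divr_gt0 ?lt_min ?d0// mulr_gt0.
have We : (1 + W) * e1 <= e / 2.
  have -> : (1 + W) * e1 = Num.min d e / 2 by rewrite /e1; field; rewrite gt_eqF.
  by rewrite ler_pM2r// ge_min lexx orbT.
have Wd : 2 * W * e1 <= d.
  apply: (@le_trans _ _ (2 * (1 + W) * e1)).
    by apply: ler_wpM2r; [exact: ltW|rewrite ler_pM2l// lerDr].
  have -> : 2 * (1 + W) * e1 = Num.min d e by rewrite /e1; field; rewrite gt_eqF.
  by rewrite ge_min lexx.
have S0 : 0 <= S by exact: normr_ge0.
(* This gives [S / P <= e1 / 2]; the summand 1 gives [P^-1 <= 1], so that [delta = e1 / 4] leaves at
   most [e1 / 2] for the part of [eta]. *)
pose P := 1 + 2 * S / e1.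
have Se0 : 0 <= 2 * S / e1 by apply: divr_ge0; [exact: mulr_ge0 (ler0n _ 2) S0|exact: ltW].
have P1 : 1 <= P by rewrite lerDl.
have P0 : 0 < P by exact: lt_le_trans P1.
have iP0 : 0 <= P^-1 by rewrite invr_ge0 ltW.
have iP1 : P^-1 <= 1 by rewrite invf_le1.
have PS : P^-1 * S <= e1 / 2.
  rewrite ler_pdivrMl//.
  have -> : P * (e1 / 2) = e1 / 2 + S by rewrite /P; field; rewrite gt_eqF.
  by rewrite lerDr divr_ge0// ltW.
exists P, (e1 / 4); split => //; first by rewrite divr_gt0.
move=> H1 H2 g1 g2 eta t0 x0 reg1 reg2 b1 b2 gG gd etai eta0 H12 etad t0T x0M.
set V2 := value_fun g2 _ _ _ _.
have V2U : (V2 <= U%:E)%E.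
  have [z zM h] := value_ub muS M0 c0 ci k0 ki phii t0T x0M g2 reg2 b2.
  apply: le_trans h _; rewrite lee_fin lerD2r.
  by have [_ h2] := gG z zM; exact: le_trans (ler_norm _) h2.
rewrite -leeBlDr//; apply: le_ereal_inf_tmp => _ [[x a] /= adm <-].
rewrite EFinN leeBlDr//; set J := (X in (_ <= X + _)%E).
(* A pair costing at least [U] satisfies the inequality already; for a cheaper one the running cost
   is below [+oo], as [transfer_value] requires. *)
have [JU|JU] := leP U%:E J.
  by apply: le_trans V2U _; apply: le_trans JU _; rewrite leeDl// lee_fin ltW.
have lfin : (\int[@Leb R]_(t in (`[t0, T]%classic : set LebT)) (steiner_l mu H1 t (x t) (a t))%:E < +oo)%E.
  by move: JU; rewrite /J; case: (\int[_]_(t in _) _)%E => //= r; rewrite ltry.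
have [z [z' [s [zM z'M zJ zd Vz]]]] := transfer_value muS M0 c0 ci k0 ki phii t0T x0M g1 g2
  reg1 reg2 b1 b2 P0 etai eta0 H12 adm lfin.
set err := (1 + P^-1) * _ + _ in zd Vz.
have sU : s <= U + G.
  have := le_lt_trans zJ JU; rewrite lte_fin => h.
  have [/ler_normlP[h2 _] _] := gG z zM; lra.
have errE : err <= e1.
  have a1 : (1 + P^-1) * Int 0 T eta <= 2 * (e1 / 4).
    apply: (@le_trans _ _ ((1 + P^-1) * (e1 / 4))).
      by apply: ler_wpM2l => //; rewrite addr_ge0.
    by apply: ler_wpM2r; [rewrite divr_ge0// ltW|rewrite (natrD _ 1 1) lerD2l].
  have a2 : P^-1 * (3 * Int 0 T phi + s) <= e1 / 2.
    apply: le_trans PS; apply: ler_wpM2l => //; apply: le_trans (ler_norm _).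
    by rewrite lerD2l.
  have -> : e1 = 2 * (e1 / 4) + e1 / 2 by field.
  exact: lerD.
have zd' : enorm (z' - z) <= d.
  apply: le_trans zd _; apply: le_trans Wd; rewrite -/W.
  by apply: ler_wpM2l errE; exact: mulr_ge0 (ler0n _ 2) (ltW W0).
have /ler_normlP[_ gg] := gd z z' zM z'M zd'.
have We' : (1 + W) * err <= e / 2 by apply: le_trans We; apply: ler_wpM2l => //; exact: ltW.
apply: le_trans Vz _; apply: (@le_trans _ _ (g1 z + s + e)%:E).
  by rewrite lee_fin -/W; lra.
by rewrite EFinD; exact: leeD2r.
Qed.

End ValueGap.

Theorem theorem4p11 (R : realType) (n : nat) (T : R)
  (mu : {measure set (RvB (n + 1)) -> \bar R})
  (Hs : nat -> Ham n) (H : Ham n)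
  (c : R -> R) (k : R -> R -> R) (mu0 : R -> R)
  (gs : nat -> 'rV[R]_n -> R) (g : 'rV[R]_n -> R) :
  (* mu is the normalized rotation-invariant measure on S^n ⊂ R^{n+1} *)
  is_sphere_measure mu ->
  (* the common data c, k_R are nonnegative and integrable *)
  (forall t, 0 <= c t) -> leb_integrable `[0, T]%classic c ->
  (forall Rad, 0 < Rad -> (forall t, 0 <= k Rad t) /\
                          leb_integrable `[0, T]%classic (k Rad)) ->
  (* (H1)-(H4), (HLC) for every H_i and for H, with the same c and k_R *)
  (forall i, [/\ hypH1 T (Hs i), hypH2 T (Hs i), hypH3 T (Hs i),
                 hypH4 T c (Hs i) & hypHLC T k (Hs i)]) ->
  [/\ hypH1 T H, hypH2 T H, hypH3 T H, hypH4 T c H & hypHLC T k H] ->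
  (* g_i, g continuous, g_i -> g uniformly on compact sets *)
  (forall i, continuous (gs i)) -> continuous g ->
  (forall K : set 'rV[R]_n, compact K -> forall e : R, 0 < e ->
     exists N : nat, forall i, (N <= i)%N -> forall x, K x -> `|gs i x - g x| <= e) ->
  (* bound at (0,0) by an integrable mu0 *)
  leb_integrable `[0, T]%classic mu0 ->
  (forall t i, `[0, T]%classic t -> Num.max `|Hs i t 0 0| `|H t 0 0| <= mu0 t) ->
  (* H_i(t,.,.) -> H(t,.,.) uniformly on compact sets, for every t in [0,T] *)
  (forall t, `[0, T]%classic t ->
     forall K : set ('rV[R]_n * 'rV[R]_n), compact K -> forall e : R, 0 < e ->
       exists N : nat, forall i, (N <= i)%N -> forall xp, K xp ->
         `|Hs i t xp.1 xp.2 - H t xp.1 xp.2| <= e) ->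
  (* conclusion: V_i -> V uniformly on compact subsets of [0,T] x R^n *)
  let Vs := fun i => value_fun (gs i) (steiner_f mu (Hs i)) (steiner_l mu (Hs i)) T in
  let V := value_fun g (steiner_f mu H) (steiner_l mu H) T in
  forall K : set (R * 'rV[R]_n), compact K -> K `<=` `[0, T]%classic `*` setT ->
  forall e : R, 0 < e -> exists N : nat, forall i, (N <= i)%N ->
    forall tx, K tx -> (V tx - e%:E <= Vs i tx <= V tx + e%:E)%E.
Proof.
move=> muS c0 ci kP regHs regH _ cg gsg mu0i mu0P HsH Vs V K cK KT e e0.
have [rho rho0 rhoP] : exists2 b, 0 <= b & forall tx, K tx -> `|enorm tx.2| <= b.
  apply: (compact_norm_bounded cK) => tx.
  by apply: continuous_comp; [exact: cvg_snd|exact: continuous_enorm].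
(* The factor 2 and the exponential are those of the growth bound in [arc_gronwall]: an arc that
   starts in [K] and obeys it stays in the ball of radius [M]. *)
pose M := 2 * (1 + rho) * expR (2 * Int 0 T c).
have M0 : 0 < M by rewrite !mulr_gt0 ?expR_gt0// ltr_wpDr.
have x0M tx : K tx -> 2 * (1 + enorm tx.2) * expR (2 * Int 0 T c) <= 1 + M.
  move=> /rhoP h; apply: (@le_trans _ _ M); last by rewrite lerDr.
  apply: ler_wpM2r; first exact: expR_ge0.
  by rewrite ler_pM2l// lerD2l (le_trans (ler_norm _) h).
have [k0 ki] := kP M M0.
(* The larger radius is the margin that [Hamiltonian_gap] uses for rational approximation. *)
have M10 : 0 < M + 1 by rewrite addr_gt0.
have [k10 k1i] := kP (M + 1) M10.
(* A bound for [|H t x 0|] on the ball of radius [M + 1]: (HLC) at [p = 0] compares [x] with the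
   origin. *)
pose phi t := mu0 t + (M + 1) * k (M + 1) t.
have phii : intg 0 T phi by apply: intgD => //; exact: intgZ.
have bnd1 (H0 : Ham n) : hypHLC T k H0 -> (forall t, `[0, T]%classic t -> `|H0 t 0 0| <= mu0 t) ->
    bounded_at0 T (M + 1) phi H0.
  move=> lc h0 t tT x xM; have t0T : `[0, T]%classic t by rewrite /= in_itv.
  have h1 := lc _ M10 t t0T x 0 0 xM; rewrite enorm0 subr0 addr0 mulr1 in h1.
  rewrite -[H0 t x 0](subrK (H0 t 0 0)) addrC.
  apply: le_trans (ler_normD _ _) _; apply: lerD; first exact: h0.
  apply: le_trans (h1 (ltW M10)) _; rewrite mulrC; exact: ler_wpM2r.
have bH1 : bounded_at0 T (M + 1) phi H.
  have [_ _ _ _ lc] := regH; apply: bnd1 => // t tT.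
  by apply: le_trans (mu0P t 0%N tT); rewrite le_max lexx orbT.
have bHs1 i : bounded_at0 T (M + 1) phi (Hs i).
  have [_ _ _ _ lc] := regHs i; apply: bnd1 => // t tT.
  by apply: le_trans (mu0P t i tT); rewrite le_max lexx.
have bndM (H0 : Ham n) : bounded_at0 T (M + 1) phi H0 -> bounded_at0 T M phi H0.
  by move=> b t tT x xM; apply: b => //; rewrite (le_trans xM)// lerDl.
have cM := @compact_enorm_ball R n M.
have e4 : 0 < e / 4 by rewrite divr_gt0.
have [G G0 gG] := compact_norm_bounded cM cg.
(* Only the limit [g] supplies a modulus of continuity; in both comparisons [gs i] is exchanged for
   [g] at a single end point, each of the two errors being at most [e / 4]. *)
have [d d0 gd] := compact_uniformly_continuous cM cg e4.
have [N1 N1P] := gsg _ cM _ e4.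
(* Tolerance 1 bounds [gs i] by [G + 1] for [i >= N2], the common bound that [value_gap] asks
   for. *)
have [N2 N2P] := gsg _ cM _ (@ltr01 R).
have [P [delta [P0 delta0 gap]]] := value_gap muS M0 c0 ci k0 ki phii (G + 1) d0 e0.
have [eta [etai eta0 Heta eta_cvg]] :=
  Hamiltonian_gap c0 ci phii regHs regH bHs1 bH1 HsH (ltW P0).
have [N3 _ N3P] : \forall i \near \oo, Int 0 T (eta i) <= delta.
  by have /cvgrPdist_le/(_ _ delta0) := eta_cvg; apply: filterS => i;
    rewrite sub0r normrN => /(le_trans (ler_norm _)).
exists (maxn N1 (maxn N2 N3)) => i; rewrite !geq_max => /and3P[i1 i2 i3] [t0 x0] Ktx.
have t0T : 0 <= t0 <= T by have [] := KT _ Ktx; rewrite /= in_itv.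
have giG z : enorm z <= M -> `|gs i z| <= G + 1.
  move=> zM; rewrite -[gs i z](subrK (g z)) addrC.
  by apply: le_trans (ler_normD _ _) _; apply: lerD; [exact: gG|exact: N2P].
have gG1 z : enorm z <= M -> `|g z| <= G + 1.
  by move=> zM; apply: le_trans (gG z zM) _; rewrite lerDl.
have Di := N3P i i3.
apply/andP; split; first rewrite leeBlDr//.
- apply: (gap (Hs i) H (gs i) g (eta i)) => //; try exact: bndM; try exact: (x0M _ Ktx).
  + by move=> z zM; split; [exact: giG|exact: gG1].
  + move=> z z' zM z'M zd; rewrite -[g z'](subrK (g z)) -addrA.
    have -> : e / 2 = e / 4 + e / 4 by field.
    apply: le_trans (ler_normD _ _) _; apply: lerD; first exact: gd.
    by rewrite distrC; exact: N1P.
  + exact: eta0.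
  + exact: Heta.
- rewrite /Vs; apply: (gap H (Hs i) g (gs i) (eta i)) => //; try exact: bndM; try exact: (x0M _ Ktx).
  + by move=> z zM; split; [exact: gG1|exact: giG].
  + move=> z z' zM z'M zd; rewrite -[gs i z'](subrK (g z')) -addrA.
    have -> : e / 2 = e / 4 + e / 4 by field.
    apply: le_trans (ler_normD _ _) _; apply: lerD; first exact: N1P.
    exact: gd.
  + exact: eta0.
  + by move=> t tT x p xM pP; rewrite distrC; exact: Heta.
Qed.
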